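(* Let $F$ be a field of characteristic not two with separable closure $F^{\mathrm{sep}}$ and absolute Galois group $\Gamma$, let $\mathbb{G}$ be an affine group superscheme over $F$, and let $V$ be a quasi-rational irreducible representation of $\mathbb{G}\otimes_F F^{\mathrm{sep}}$. Choose isomorphisms $\Phi_\sigma:{}^\sigma V\cong V$ ($\sigma\in\Gamma$) as in the context, and let $\beta^{\mathrm{BT}}_V\in\mathrm{Br}(F)$ be the resulting Borel–Tits class. Then: (1) $\beta_{V_F}=(\beta^{\mathrm{BT}}_V)^{-1}$ in $\mathrm{Br}(F)$, where $\beta_{V_F}=[\mathrm{End}_{\mathbb{G}}(V_F)]$. (2) If $V\not\cong\Pi V$, then $\beta^{\mathrm{super}}_{V_F}=(+,1,(\beta^{\mathrm{BT}}_V)^{-1})$, where $\beta^{\mathrm{super}}_{V_F}=[\underline{\mathrm{End}}_{\mathbb{G}}(V_F)]\in\mathrm{BW}(F)$. (3) Assume $V\cong\Pi V$. (i) There exists an isomorphism $S:V\cong\Pi V$ of representations of $\mathbb{G}\otimes_F F^{\mathrm{sep}}$, unique up to $F^\times$, such that $S\circ\Phi_\sigma=\Pi\Phi_\sigma\circ{}^\sigma S$ for every $\sigma\in\Gamma$. (ii) For any $S$ as in (i), $\Pi S\circ S=a\,\mathrm{id}_V$ for some $a\in F^\times$. Moreover, $a_{V_F}=a$ in $F^\times/(F^\times)^2$ for this $a$.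
   Context: Representations are right supercomodules over the Hopf superalgebra of $\mathbb{G}$, homomorphisms preserve parity, $\Pi$ is parity change (of spaces and maps; $\Pi S$ is the same linear map as $S$), ${}^\sigma(-)$ is base change along $\sigma\in\Gamma$. $V$ irreducible over $F^{\mathrm{sep}}$ is quasi-rational if $\mathrm{End}_{\mathbb{G}\otimes_F F^{\mathrm{sep}}}(V)=F^{\mathrm{sep}}\mathrm{id}_V$ and ${}^\sigma V\cong V$ for all $\sigma\in\Gamma$. $V_F$ is the unique irreducible representation of $\mathbb{G}$ whose base change to $F^{\mathrm{sep}}$ contains $V$. $\underline{\mathrm{End}}_{\mathbb{G}}(V_F)$ has even part $\mathrm{End}_{\mathbb{G}}(V_F)$ and odd part $\mathrm{Hom}_{\mathbb{G}}(V_F,\Pi V_F)$, with composition as product; for $V$ quasi-rational $\mathrm{End}_{\mathbb{G}}(V_F)$ is a central division algebra and $\underline{\mathrm{End}}_{\mathbb{G}}(V_F)$ is a central division superalgebra over $F$. Choice of $\Phi_\sigma$: there is a finite Galois extension $F'/F$ in $F^{\mathrm{sep}}$ and a representation $V_{F'}$ of $\mathbb{G}\otimes_F F'$ with $V_{F'}\otimes_{F'}F^{\mathrm{sep}}\cong V$; for each $\bar\sigma\in\mathrm{Gal}(F'/F)$ fix an isomorphism ${}^{\bar\sigma}V_{F'}\cong V_{F'}$, and let $\Phi_\sigma$ be the base change to $F^{\mathrm{sep}}$ of the isomorphism for $\bar\sigma=\sigma|_{F'}$. Then $\Phi_\sigma\circ{}^\sigma\Phi_\tau\circ\Phi_{\sigma\tau}^{-1}=c_{\sigma,\tau}\mathrm{id}_V$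 with $c_{\sigma,\tau}\in(F^{\mathrm{sep}})^\times$, and $\beta^{\mathrm{BT}}_V$ is the class of the continuous 2-cocycle $c$ in $H^2(\Gamma,(F^{\mathrm{sep}})^\times)\cong\mathrm{Br}(F)$. The isomorphism $\mathrm{Br}(F)\cong H^2(\Gamma,(F^{\mathrm{sep}})^\times)$: for a central simple algebra $A$, take a finite Galois $F'/F$, an $F$-vector space $W$ and $f:\mathrm{End}_{F'}(W\otimes_F F')\cong A\otimes_F F'$; write $f^{-1}\circ\sigma(f)$ (with $\sigma(f)=\sigma f\sigma^{-1}$) as conjugation by $g_\sigma$; $[A]$ maps to the class of the scalar cocycle $g_\sigma\sigma(g_\tau)g_{\sigma\tau}^{-1}$. Brauer–Wall group: $\mathrm{BW}(F)$ is the group of similarity classes of central simple superalgebras; there is a bijection $\mathrm{BW}(F)\cong\{+,-\}\times F^\times/(F^\times)^2\times\mathrm{Br}(F)$, $[A]\mapsto(\epsilon_A,a,D)$: $\epsilon_A=+$ if $A$ is central simple as an ungraded algebra, and $-$ otherwise. If $\epsilon_A=+$ and $A_{\bar1}\ne0$, the center of $A_{\bar0}$ is $F\oplus Fu$ with $u^2\in F^\times$, and the triple is $(+,u^2,[A])$; if $A_{\bar1}=0$ it is $(+,1,[A])$. If $\epsilon_A=-$, there is a nonzero odd $u$ (unique up to scalar) centralizing $A_{\bar0}$, $u^2\in F^\times$, and the triple is $(-,u^2,[A_{\bar0}])$. One writes $\beta^{\mathrm{super}}_{V_F}=(\epsilon_{V_F},a_{V_F},D_{V_F})$. *)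

(* Defs.v *)
From HB Require Import structures.
From mathcomp Require Import all_boot all_order all_algebra all_field.
From mathcomp Require Import sesquilinear generic_quotient.
From mathcomp Require Import boolp functions.

Set Implicit Arguments.
Unset Strict Implicit.
Unset Printing Implicit Defensive.

Import GRing.Theory.
Local Open Scope ring_scope.
Local Open Scope quotient_scope.

Section Tensor.
Variables (F : fieldType) (U V : lmodType F).

Definition tsum (W : lmodType F) (f : U -> V -> W) (s : seq (U * V)) : W :=
  \sum_(p <- s) f p.1 p.2.

(* Two formal sums of pure tensors are identified when no bilinear map tells
   them apart, so the universal property holds by construction. *)
Definition teq (s t : seq (U * V)) : bool :=
  `[< forall (W : lmodType F) (f : U -> V -> W),
        bilinear_for *:%R *:%R f -> tsum f s = tsum f t >].

Lemma teq_refl : reflexive teq.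
Proof. by move=> s; apply/asboolP. Qed.

Lemma teq_sym : symmetric teq.
Proof.
by move=> s t; apply/idP/idP => /asboolP h; apply/asboolP => W f hf; rewrite h.
Qed.

Lemma teq_trans : transitive teq.
Proof.
move=> t s u /asboolP h1 /asboolP h2; apply/asboolP => W f hf.
by rewrite h1 // h2.
Qed.

Canonical teq_equiv := EquivRel teq teq_refl teq_sym teq_trans.

Definition tensor := {eq_quot teq_equiv}.
HB.instance Definition _ := Choice.on tensor.
HB.instance Definition _ := EqQuotient.on tensor.

Definition tens (u : U) (v : V) : tensor := \pi_tensor [:: (u, v)].

Definition tlift (W : lmodType F) (f : U -> V -> W) (x : tensor) : W :=
  tsum f (repr x).

Lemma tensor_eqP (s t : seq (U * V)) :
  (forall (W : lmodType F) (f : U -> V -> W),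
     bilinear_for *:%R *:%R f -> tsum f s = tsum f t) ->
  \pi_tensor s = \pi_tensor t.
Proof. by move=> h; apply/eqmodP/asboolP. Qed.

Lemma tsum_repr (W : lmodType F) (f : U -> V -> W) (s : seq (U * V)) :
  bilinear_for *:%R *:%R f -> tsum f (repr (\pi_tensor s)) = tsum f s.
Proof.
move=> hf; have /eqmodP/asboolP : \pi_tensor (repr (\pi_tensor s)) = \pi_tensor s.
  by rewrite reprK.
exact.
Qed.

Lemma tsum_cat (W : lmodType F) (f : U -> V -> W) s t :
  tsum f (s ++ t) = tsum f s + tsum f t.
Proof. by rewrite /tsum big_cat. Qed.

Definition tscale_seq (a : F) (s : seq (U * V)) := [seq (a *: p.1, p.2) | p <- s].

Lemma tsum_scale (W : lmodType F) (f : U -> V -> W) a s :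
  bilinear_for *:%R *:%R f -> tsum f (tscale_seq a s) = a *: tsum f s.
Proof.
move=> [hf _]; rewrite /tsum big_map scaler_sumr; apply: eq_bigr => p _ /=.
have h0 : f 0 p.2 = 0 by have := hf p.2 (-1) 0 0; rewrite /= scaler0 addr0 scaleN1r addNr.
by have := hf p.2 a p.1 0; rewrite /= h0 !addr0.
Qed.

Definition tzero : tensor := \pi_tensor [::].
Definition tadd (x y : tensor) : tensor := \pi_tensor (repr x ++ repr y).
Definition tscale (a : F) (x : tensor) : tensor :=
  \pi_tensor (tscale_seq a (repr x)).

Lemma tsum_add (W : lmodType F) (f : U -> V -> W) x y :
  bilinear_for *:%R *:%R f -> tlift f (tadd x y) = tlift f x + tlift f y.
Proof. by move=> hf; rewrite /tlift tsum_repr // tsum_cat. Qed.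

Lemma tlift_scale (W : lmodType F) (f : U -> V -> W) a x :
  bilinear_for *:%R *:%R f -> tlift f (tscale a x) = a *: tlift f x.
Proof. by move=> hf; rewrite /tlift tsum_repr // tsum_scale. Qed.

Lemma tlift0 (W : lmodType F) (f : U -> V -> W) :
  bilinear_for *:%R *:%R f -> tlift f tzero = 0.
Proof. by move=> hf; rewrite /tlift tsum_repr // /tsum big_nil. Qed.

Lemma tlift_inj (x y : tensor) :
  (forall (W : lmodType F) (f : U -> V -> W),
     bilinear_for *:%R *:%R f -> tlift f x = tlift f y) -> x = y.
Proof. by move=> h; rewrite -[x]reprK -[y]reprK; apply: tensor_eqP. Qed.

Lemma taddA : associative tadd.
Proof. by move=> x y z; apply: tlift_inj => W f hf; rewrite !tsum_add // addrA. Qed.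
Lemma taddC : commutative tadd.
Proof. by move=> x y; apply: tlift_inj => W f hf; rewrite !tsum_add // addrC. Qed.
Lemma tadd0 : left_id tzero tadd.
Proof. by move=> x; apply: tlift_inj => W f hf; rewrite tsum_add // tlift0 // add0r. Qed.
Lemma taddN : left_inverse tzero (tscale (-1)) tadd.
Proof.
move=> x; apply: tlift_inj => W f hf.
by rewrite tsum_add // tlift0 // tlift_scale // scaleN1r addNr.
Qed.

HB.instance Definition _ := GRing.isZmodule.Build tensor taddA taddC tadd0 taddN.

Lemma tscaleA a b x : tscale a (tscale b x) = tscale (a * b) x.
Proof. by apply: tlift_inj => W f hf; rewrite !tlift_scale // scalerA. Qed.
Lemma tscale1 : left_id 1 tscale.
Proof. by move=> x; apply: tlift_inj => W f hf; rewrite !tlift_scale // scale1r. Qed.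
Lemma tscaleDr : right_distributive tscale +%R.
Proof.
move=> a x y; apply: tlift_inj => W f hf.
by rewrite tlift_scale // !tsum_add // !tlift_scale // scalerDr.
Qed.
Lemma tscaleDl x : {morph tscale^~ x : a b / a + b}.
Proof.
move=> a b; apply: tlift_inj => W f hf.
by rewrite tlift_scale // !tsum_add // !tlift_scale // scalerDl.
Qed.

HB.instance Definition _ :=
  GRing.Zmodule_isLmodule.Build F tensor tscaleA tscale1 tscaleDr tscaleDl.

Lemma tlift_linear (W : lmodType F) (f : U -> V -> W) :
  bilinear_for *:%R *:%R f -> linear (tlift f).
Proof. by move=> hf a x y; rewrite [LHS]tsum_add // tlift_scale. Qed.

Lemma tlift_tens (W : lmodType F) (f : U -> V -> W) u v :
  bilinear_for *:%R *:%R f -> tlift f (tens u v) = f u v.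
Proof. by move=> hf; rewrite /tlift tsum_repr // /tsum big_seq1. Qed.

Lemma tens_bilinear : bilinear_for *:%R *:%R tens.
Proof.
split=> [v|u] a x y /=; apply: tlift_inj => W f hf;
  rewrite (tlift_linear hf) !tlift_tens //.
- exact: hf.1.
- exact: hf.2.
Qed.

Lemma tensDl u u' v : tens (u + u') v = tens u v + tens u' v.
Proof. by have := tens_bilinear.1 v 1 u u'; rewrite /= !scale1r. Qed.
Lemma tensDr u v v' : tens u (v + v') = tens u v + tens u v'.
Proof. by have := tens_bilinear.2 u 1 v v'; rewrite /= !scale1r. Qed.

Lemma tens0l v : tens 0 v = 0.
Proof. by apply: (addrI (tens 0 v)); rewrite -tensDl !addr0. Qed.
Lemma tens0r u : tens u 0 = 0.
Proof. by apply: (addrI (tens u 0)); rewrite -tensDr !addr0. Qed.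
Lemma tensZl a u v : tens (a *: u) v = a *: tens u v.
Proof. by have := tens_bilinear.1 v a u 0; rewrite /= tens0l !addr0. Qed.
Lemma tensZr a u v : tens u (a *: v) = a *: tens u v.
Proof. by have := tens_bilinear.2 u a v 0; rewrite /= tens0r !addr0. Qed.

Lemma linear_sum_fun (X W : lmodType F) (h : X -> W) (I : Type) (s : seq I) (g : I -> X) :
  linear h -> h (\sum_(i <- s) g i) = \sum_(i <- s) h (g i).
Proof.
move=> hl; elim: s => [|i s IH].
  rewrite !big_nil; have := hl (-1) 0 0.
  rewrite scaler0 addr0 scaleN1r addNr. exact.
by rewrite !big_cons -IH -{1}[g i]scale1r hl scale1r.
Qed.

Lemma tensor_sum (x : tensor) : x = \sum_(p <- repr x) tens p.1 p.2.
Proof.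
apply: tlift_inj => W f hf.
rewrite (linear_sum_fun _ _ (tlift_linear hf)).
by under eq_bigr do rewrite tlift_tens //.
Qed.

Lemma tensor_ext (W : lmodType F) (h1 h2 : tensor -> W) :
  linear h1 -> linear h2 -> (forall u v, h1 (tens u v) = h2 (tens u v)) ->
  h1 =1 h2.
Proof.
move=> l1 l2 h x; rewrite (tensor_sum x) !linear_sum_fun //.
by apply: eq_bigr => p _; rewrite h.
Qed.

Lemma tensor_ext_add (W : zmodType) (h1 h2 : tensor -> W) :
  {morph h1 : x y / x + y} -> {morph h2 : x y / x + y} ->
  (forall u v, h1 (tens u v) = h2 (tens u v)) -> h1 =1 h2.
Proof.
have h0 (h : tensor -> W) : {morph h : x y / x + y} -> h 0 = 0.
  by move=> hD; apply: (addrI (h 0)); rewrite -hD !addr0.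
have hs (h : tensor -> W) s : {morph h : x y / x + y} ->
    h (\sum_(p <- s) tens p.1 p.2) = \sum_(p <- s) h (tens p.1 p.2).
  by move=> hD; apply: (big_morph h hD (h0 h hD)).
move=> l1 l2 h x; rewrite (tensor_sum x) !hs //.
by apply: eq_bigr => p _; rewrite h.
Qed.

Lemma linearDf (X W : lmodType F) (h : X -> W) :
  linear h -> {morph h : x y / x + y}.
Proof. by move=> hl x y; have := hl 1 x y; rewrite !scale1r. Qed.

Lemma linear0f (X W : lmodType F) (h : X -> W) : linear h -> h 0 = 0.
Proof. by move=> hl; have := hl (-1) 0 0; rewrite scaler0 addr0 scaleN1r addNr; exact. Qed.

Lemma linearZf (X W : lmodType F) (h : X -> W) a x :
  linear h -> h (a *: x) = a *: h x.
Proof. by move=> hl; have := hl a x 0; rewrite (linear0f hl) !addr0. Qed.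

End Tensor.

Section TensorMaps.
Variables (F : fieldType) (U U' V V' W : lmodType F).

Definition tmap (f : U -> U') (g : V -> V') : tensor U V -> tensor U' V' :=
  tlift (fun u v => tens (f u) (g v)).

Definition tassoc : tensor (tensor U V) W -> tensor U (tensor V W) :=
  tlift (fun x w => tlift (fun u v => tens u (tens v w)) x).

Lemma tmap_bilinear (f : U -> U') (g : V -> V') :
  linear f -> linear g ->
  bilinear_for *:%R *:%R (fun u v => tens (f u) (g v)).
Proof.
move=> hf hg; have [tl tr] := tens_bilinear U' V'.
by split=> [v|u] a x y; [rewrite hf; exact: tl | rewrite hg; exact: tr].
Qed.

Lemma tmap_linear (f : U -> U') (g : V -> V') :
  linear f -> linear g -> linear (tmap f g).
Proof. by move=> hf hg; apply/tlift_linear/tmap_bilinear. Qed.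

Lemma tmap_tens (f : U -> U') (g : V -> V') u v :
  linear f -> linear g -> tmap f g (tens u v) = tens (f u) (g v).
Proof. by move=> hf hg; rewrite /tmap tlift_tens //; apply: tmap_bilinear. Qed.

Lemma tassoc_bilinear_inner (w : W) :
  bilinear_for *:%R *:%R (fun (u : U) (v : V) => tens u (tens v w)).
Proof.
have [tl tr] := tens_bilinear U (tensor V W); have [tl' tr'] := tens_bilinear V W.
by split=> [v|u] a x y; [exact: tl | rewrite /= tl'; exact: tr].
Qed.

Lemma tassoc_bilinear :
  bilinear_for *:%R *:%R
    (fun (x : tensor U V) (w : W) => tlift (fun u v => tens u (tens v w)) x).
Proof.
have [tl tr] := tens_bilinear U (tensor V W); have [tl' tr'] := tens_bilinear V W.
split=> [w|x] a y z; first exact/tlift_linear/tassoc_bilinear_inner.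
rewrite /= /tlift /tsum scaler_sumr -big_split; apply: eq_bigr => p _ /=.
by rewrite tr' tr.
Qed.

Lemma tassoc_linear : linear tassoc.
Proof. exact/tlift_linear/tassoc_bilinear. Qed.

Lemma tassoc_tens u v w : tassoc (tens (tens u v) w) = tens u (tens v w).
Proof.
rewrite /tassoc tlift_tens; last exact: tassoc_bilinear.
by rewrite tlift_tens //; apply: tassoc_bilinear_inner.
Qed.

End TensorMaps.

(* Restriction of scalars along phi. *)
Definition res (K L : fieldType) (phi : {rmorphism K -> L}) (W : lmodType L)
  : Type := W.

Section Restriction.
Variables (K L : fieldType) (phi : {rmorphism K -> L}) (W : lmodType L).
Local Notation rW := (res phi W).
HB.instance Definition _ := GRing.Zmodule.copy rW W.

Definition res_scale (a : K) (w : rW) : rW := phi a *: (w : W).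

Lemma res_scaleA a b w : res_scale a (res_scale b w) = res_scale (a * b) w.
Proof. by rewrite /res_scale scalerA rmorphM. Qed.
Lemma res_scale1 : left_id 1 res_scale.
Proof. by move=> w; rewrite /res_scale rmorph1 scale1r. Qed.
Lemma res_scaleDr : right_distributive res_scale +%R.
Proof. by move=> a u v; rewrite /res_scale scalerDr. Qed.
Lemma res_scaleDl w : {morph res_scale^~ w : a b / a + b}.
Proof. by move=> a b; rewrite /res_scale rmorphD scalerDl. Qed.
HB.instance Definition _ := GRing.Zmodule_isLmodule.Build K rW
  res_scaleA res_scale1 res_scaleDr res_scaleDl.

Lemma res_scaleE (a : K) (w : rW) : a *: w = phi a *: (w : W) :> W.
Proof. by []. Qed.
End Restriction.

Lemma res_linear (K L : fieldType) (phi : {rmorphism K -> L}) (V W : lmodType L)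
    (f : V -> W) :
  linear f -> linear (f : res phi V -> res phi W).
Proof. by move=> hf a x y; apply: hf. Qed.

(* W (x)_K V for an L-module W and a K-module V, as an L-module. *)
Definition ltensor (K L : fieldType) (phi : {rmorphism K -> L}) (W : lmodType L)
  (V : lmodType K) : Type := tensor (res phi W) V.

Section LTensor.
Variables (K L : fieldType) (phi : {rmorphism K -> L}).
Variables (W : lmodType L) (V : lmodType K).
Local Notation T := (ltensor phi W V).
HB.instance Definition _ := GRing.Zmodule.copy T (tensor (res phi W) V).

Definition lscale (a : L) : T -> T :=
  tmap ((fun w : W => a *: w) : res phi W -> res phi W) (idfun : V -> V).

Lemma idfun_linear (M : lmodType K) : linear (idfun : M -> M).
Proof. by []. Qed.

Lemma scale_res_linear a :
  linear ((fun w : W => a *: w) : res phi W -> res phi W).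
Proof.
by move=> b x y; rewrite [LHS]scalerDr !res_scaleE !scalerA mulrC.
Qed.

Lemma lscale_linear a : linear (lscale a : tensor (res phi W) V -> tensor (res phi W) V).
Proof. exact: tmap_linear (scale_res_linear a) (@idfun_linear V). Qed.

Lemma lscale_tens a w v : lscale a (tens (w : res phi W) v) = tens ((a *: w) : res phi W) v.
Proof. exact: tmap_tens (scale_res_linear a) (@idfun_linear V). Qed.

Lemma lscaleA a b x : lscale a (lscale b x) = lscale (a * b) x.
Proof.
move: x; apply: tensor_ext => [c x y||u v].
- by rewrite !lscale_linear.
- exact: lscale_linear.
- by rewrite !lscale_tens scalerA.
Qed.
Lemma lscale1 : left_id 1 lscale.
Proof.
apply: tensor_ext => [||u v]; [exact: lscale_linear|by []|].
by rewrite lscale_tens scale1r.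
Qed.
Lemma lscaleDr : right_distributive lscale +%R.
Proof. by move=> a x y; have := lscale_linear a 1 x y; rewrite !scale1r. Qed.
Lemma lscaleDl x : {morph lscale^~ x : a b / a + b}.
Proof.
move=> a b; move: x; apply: tensor_ext => [|c x y|u v].
- exact: lscale_linear.
- by rewrite !lscale_linear scalerDr addrACA.
- by rewrite !lscale_tens scalerDl; exact: (@tensDl K (res phi W) V).
Qed.
HB.instance Definition _ := GRing.Zmodule_isLmodule.Build L T
  lscaleA lscale1 lscaleDr lscaleDl.

Lemma ltensor_scaleE (a : K) (x : tensor (res phi W) V) :
  a *: x = phi a *: (x : T) :> T.
Proof.
move: x; apply: tensor_ext_add => [x y|x y|w v].
- exact: (@scalerDr K (tensor (res phi W) V) a x y).
- exact: (@scalerDr L T (phi a) x y).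
- by rewrite [RHS]lscale_tens -tensZl.
Qed.
End LTensor.

Lemma to_ltensor_linear (K L : fieldType) (phi : {rmorphism K -> L})
    (M W : lmodType L) (V : lmodType K) (f : M -> ltensor phi W V) :
  linear f -> linear (f : res phi M -> tensor (res phi W) V).
Proof. by move=> hf a x y; rewrite [LHS]hf ltensor_scaleE. Qed.

Record grading (K : fieldType) (V : lmodType K) := Grading {
  hpart : bool -> {linear V -> V};
  hpartK : forall i j v, hpart i (hpart j v) = if i == j then hpart j v else 0;
  hpartD : forall v, hpart false v + hpart true v = v
}.

Definition homogeneous (K : fieldType) (V : lmodType K) (g : grading V)
  (i : bool) (v : V) : Prop := hpart g i v = v.

Section ParityShift.
Variables (K : fieldType) (V : lmodType K) (g : grading V).
Lemma swap_hpartK i j v :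
  hpart g (~~ i) (hpart g (~~ j) v) = if i == j then hpart g (~~ j) v else 0.
Proof. by rewrite hpartK (inj_eq negb_inj). Qed.
Lemma swap_hpartD v : hpart g (~~ false) v + hpart g (~~ true) v = v.
Proof. by rewrite addrC hpartD. Qed.
Definition grading_shift : grading V :=
  @Grading K V (fun i => hpart g (~~ i)) swap_hpartK swap_hpartD.
End ParityShift.

Record superalgebra (F : fieldType) := SuperAlgebra {
  sa_alg :> algType F;
  sa_gr : grading sa_alg;
  sa_one : homogeneous sa_gr false 1;
  sa_mul : forall i j x y, homogeneous sa_gr i x -> homogeneous sa_gr j y ->
    homogeneous sa_gr (i (+) j) (x * y)
}.

(* (a (x) b)(c (x) d) = (-1)^(|b||c|) ac (x) bd *)
Definition super_tmul (F : fieldType) (A : superalgebra F) (x y : tensor A A)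
  : tensor A A :=
  \sum_(i : bool) \sum_(j : bool) (-1) ^+ (i && j) *:
    tlift (fun a b => tlift (fun c d =>
      tens (a * hpart (sa_gr A) j c) (hpart (sa_gr A) i b * d)) y) x.

(* The coordinate superalgebra of an affine group superscheme over F. *)
Record hopf_superalgebra (F : fieldType) := HopfSuperalgebra {
  hs_alg :> superalgebra F;
  hs_supercomm : forall i j (x y : hs_alg),
    homogeneous (sa_gr hs_alg) i x -> homogeneous (sa_gr hs_alg) j y ->
    x * y = (-1) ^+ (i && j) *: (y * x);
  comul : {linear hs_alg -> tensor hs_alg hs_alg};
  counit : {linear hs_alg -> F^o};
  antipode : {linear hs_alg -> hs_alg};
  comul_even : forall k x, comul (hpart (sa_gr hs_alg) k x) =
    \sum_(i : bool) tmap (hpart (sa_gr hs_alg) i)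
                         (hpart (sa_gr hs_alg) (k (+) i)) (comul x);
  counit_even : forall x, counit (hpart (sa_gr hs_alg) true x) = 0;
  antipode_even : forall k x, antipode (hpart (sa_gr hs_alg) k x) =
    hpart (sa_gr hs_alg) k (antipode x);
  comul1 : comul 1 = tens 1 1;
  comulM : forall x y, comul (x * y) = super_tmul (comul x) (comul y);
  counit1 : counit 1 = 1;
  counitM : forall x y, counit (x * y) = counit x * counit y;
  comulA : forall x, tassoc (tmap comul idfun (comul x)) =
                     tmap idfun comul (comul x);
  counitl : forall x, tlift (fun a b => (counit a : F) *: b) (comul x) = x;
  counitr : forall x, tlift (fun a b => (counit b : F) *: a) (comul x) = x;
  antipodel : forall x, tlift (fun a b => antipode a * b) (comul x) =
                        (counit x : F)%:A;
  antipoder : forall x, tlift (fun a b => a * antipode b) (comul x) =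
                        (counit x : F)%:A
}.

(* A representation of G (x)_F K, for a field extension iota : F -> K: a right
   supercomodule over K (x)_F O(G). The coaction is written
   V -> V (x)_F O(G), through V (x)_K (K (x)_F O(G)) = V (x)_F O(G). *)
Record rep (F : fieldType) (G : hopf_superalgebra F) (K : fieldType)
    (iota : {rmorphism F -> K}) := Rep {
  rep_mod :> lmodType K;
  rep_gr : grading rep_mod;
  coact : {linear rep_mod -> ltensor iota rep_mod G};
  coact_even : forall k v, coact (hpart rep_gr k v) =
    \sum_(i : bool) (tmap (hpart rep_gr i : res iota rep_mod -> res iota rep_mod)
                     (hpart (sa_gr G) (k (+) i)) (coact v) : tensor _ _);
  coactA : forall v,
    tassoc (tmap (coact : res iota rep_mod -> tensor (res iota rep_mod) G)
                 (idfun : G -> G) (coact v)) =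
    tmap (idfun : res iota rep_mod -> res iota rep_mod) (comul G) (coact v);
  coact1 : forall v,
    tlift (fun (w : res iota rep_mod) (b : G) => (counit G b : F) *: w) (coact v)
    = v
}.

Section RepHom.
Variables (F : fieldType) (G : hopf_superalgebra F) (K : fieldType).
Variables (iota : {rmorphism F -> K}).

Definition rep_hom (V W : rep G iota) (f : V -> W) : Prop :=
  [/\ linear f,
      forall i v, f (hpart (rep_gr V) i v) = hpart (rep_gr W) i (f v)
    & forall v, coact W (f v) =
        tmap (f : res iota V -> res iota W) (idfun : G -> G) (coact V v)].

Definition rep_iso (V W : rep G iota) (f : V -> W) : Prop :=
  rep_hom f /\ bijective f.

Definition rep_isomorphic (V W : rep G iota) : Prop :=
  exists f : V -> W, rep_iso f.

Section Shift.
Variable V : rep G iota.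
Lemma shift_coact_even k v :
  coact V (hpart (grading_shift (rep_gr V)) k v) =
    \sum_(i : bool) (tmap (hpart (grading_shift (rep_gr V)) i
                             : res iota V -> res iota V)
                     (hpart (sa_gr G) (k (+) i)) (coact V v) : tensor _ _).
Proof.
rewrite coact_even (reindex_inj negb_inj) /=; apply: eq_bigr => i _.
by rewrite addbN addNb negbK.
Qed.
(* Pi V: since O(G) is on the right, the coaction acquires no sign. *)
Definition Pi_rep : rep G iota :=
  @Rep F G K iota V (grading_shift (rep_gr V)) (coact V) shift_coact_even
    (@coactA _ _ _ _ V) (@coact1 _ _ _ _ V).
End Shift.

Definition Pi_map (V W : rep G iota) (f : V -> W) : Pi_rep V -> Pi_rep W := f.

Definition subrep (V : rep G iota) (U : V -> Prop) : Prop :=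
  [/\ U 0, forall (a : K) x y, U x -> U y -> U (a *: x + y),
      forall i x, U x -> U (hpart (rep_gr V) i x)
    & forall x, U x -> exists2 s : seq (V * G),
        coact V x = \sum_(p <- s) tens (p.1 : res iota V) p.2
        & forall p, p \in s -> U p.1].

Record irrep := Irrep {
  irr_rep :> rep G iota;
  irr_neq0 : exists v : irr_rep, v <> 0;
  irr_min : forall U : irr_rep -> Prop, subrep U ->
    (forall v, U v -> v = 0) \/ (forall v, U v)
}.
End RepHom.

Section BaseChange.
Variables (F : fieldType) (G : hopf_superalgebra F) (K L : fieldType).
Variables (iK : {rmorphism F -> K}) (iL : {rmorphism F -> L}).
Variables (phi : {rmorphism K -> L}) (phiE : forall x, phi (iK x) = iL x).

Lemma ltmap_linear (W : lmodType L) (V V' : lmodType K) (f : V -> V') :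
  linear f ->
  linear (tmap (idfun : res phi W -> res phi W) f
          : ltensor phi W V -> ltensor phi W V').
Proof.
move=> hf a x y.
have hl : linear (tmap (idfun : res phi W -> res phi W) f) by apply: tmap_linear.
have := hl 1 (a *: x : tensor (res phi W) V) y; rewrite !scale1r => ->.
congr (_ + _); move: x; apply: tensor_ext => [b x z|b x z|u v].
- rewrite [RHS]/=; rewrite -hl; congr (tmap _ _ _); exact: lscale_linear.
- by rewrite hl; exact: lscale_linear.
- rewrite -[LHS]/(tmap _ _ (lscale a (tens u v))) lscale_tens !tmap_tens //.
  by rewrite [RHS]lscale_tens.
Qed.

Section BaseChangeRep.
Variable V : rep G iK.
Local Notation bmod := (ltensor phi L^o V).
Local Notation B := (res iL bmod).

Definition bhpart (i : bool) : bmod -> bmod :=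
  tmap (idfun : res phi L^o -> res phi L^o) (hpart (rep_gr V) i).

Lemma bhpart_linear i : linear (bhpart i).
Proof. by apply: ltmap_linear => a x y; rewrite linearP. Qed.

HB.instance Definition _ i :=
  GRing.isLinear.Build L bmod bmod *:%R (bhpart i) (bhpart_linear i).

Lemma bhpart_tens i x v : bhpart i (tens x v) = tens x (hpart (rep_gr V) i v).
Proof. by rewrite /bhpart tmap_tens // => a u w; rewrite linearP. Qed.

Lemma bhpartK i j z :
  bhpart i (bhpart j z) = if i == j then bhpart j z else 0.
Proof.
move: z; apply: tensor_ext_add => [x y|x y|x v].
- by rewrite !(linearDf (bhpart_linear _)).
- by case: ifP => _; rewrite ?(linearDf (bhpart_linear _)) ?addr0.
- rewrite !bhpart_tens hpartK; case: ifP => // _.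
  exact: (@tens0r K (res phi L^o) V).
Qed.

Lemma bhpartD z : bhpart false z + bhpart true z = z.
Proof.
move: z; apply: tensor_ext_add => [x y|//|x v].
- by rewrite !(linearDf (bhpart_linear _)) addrACA.
- by rewrite !bhpart_tens -(@tensDr K (res phi L^o) V) hpartD.
Qed.

Definition bgrading : grading bmod :=
  @Grading L bmod (fun i => bhpart i) bhpartK bhpartD.

Definition bincl (x : L) (v : V) : bmod := tens (x : res phi L^o) v.

Lemma lscale_bincl a x v : a *: bincl x v = bincl (a * x) v.
Proof. exact: lscale_tens. Qed.

Lemma binclDr x v w : bincl x (v + w) = bincl x v + bincl x w.
Proof. exact: (@tensDr K (res phi L^o) V). Qed.

Lemma binclDl x y v : bincl (x + y) v = bincl x v + bincl y v.
Proof. exact: (@tensDl K (res phi L^o) V). Qed.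

Lemma binclZ a x v : bincl x (a *: v) = bincl (phi a * x) v.
Proof.
by rewrite /bincl (@tensZr K (res phi L^o) V) -(@tensZl K (res phi L^o) V).
Qed.

Lemma bincl_linear x : linear (bincl x : res iK V -> B).
Proof.
move=> a v w; rewrite [LHS]binclDr; congr (_ + _).
by rewrite [LHS]binclZ phiE [RHS]lscale_bincl.
Qed.

(* x (x) v |-> sum (x (x) v_0) (x) v_1 *)
Definition bcoact : bmod -> ltensor iL bmod G :=
  tlift (W := res phi (ltensor iL bmod G)) (fun (x : res phi L^o) (v : V) =>
    tmap (bincl x : res iK V -> B) (idfun : G -> G) (coact V v)).

Local Notation tbincl x :=
  (tmap (bincl x : res iK V -> B) (idfun : G -> G)).

Lemma tbincl_linear x : linear (tbincl x).
Proof. by apply: tmap_linear => //; apply: bincl_linear. Qed.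

Lemma tbincl_tens x v b : tbincl x (tens v b) = tens (bincl x v : B) b.
Proof. by rewrite tmap_tens //; apply: bincl_linear. Qed.

Lemma tbinclD x y z : tbincl (x + y) z = tbincl x z + tbincl y z.
Proof.
move: z; apply: tensor_ext_add => [z t|z t|v b].
- exact/linearDf/tbincl_linear.
- by rewrite !(linearDf (tbincl_linear _)) addrACA.
- by rewrite !tbincl_tens binclDl; exact: (@tensDl F B G).
Qed.

Lemma tbincl_scale a x (z : ltensor iK V G) :
  tbincl x (a *: z) = tbincl (phi a * x) z.
Proof.
move: z; apply: tensor_ext_add => [z t|z t|v b].
- by rewrite scalerDr (linearDf (tbincl_linear _)).
- exact/linearDf/tbincl_linear.
- by rewrite [X in tmap _ _ X]lscale_tens !tbincl_tens binclZ.
Qed.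

Lemma tbincl_scalel a x z :
  tbincl (a * x) z = a *: (tbincl x z : ltensor iL bmod G).
Proof.
move: z; apply: tensor_ext_add => [z t|z t|v b].
- exact/linearDf/tbincl_linear.
- by rewrite (linearDf (tbincl_linear _)) [LHS]scalerDr.
- by rewrite !tbincl_tens [RHS]lscale_tens lscale_bincl.
Qed.

Lemma bcoact_bilinear : bilinear_for *:%R *:%R
  (fun (x : res phi L^o) (v : V) =>
    tbincl x (coact V v) : res phi (ltensor iL bmod G)).
Proof.
split=> [v|x] a y z /=.
- by rewrite tbinclD [X in X + _]tbincl_scalel.
- rewrite linearP (linearDf (tbincl_linear _)); congr (_ + _).
  by rewrite tbincl_scale tbincl_scalel.
Qed.

Lemma bcoact_tens x v : bcoact (bincl x v) = tbincl x (coact V v).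
Proof. by rewrite /bcoact tlift_tens //; apply: bcoact_bilinear. Qed.

Lemma bcoactD : {morph bcoact : x y / x + y}.
Proof. by move=> x y; exact: (linearDf (tlift_linear bcoact_bilinear) x y). Qed.

Lemma bcoact_linear : linear bcoact.
Proof.
move=> a x y; rewrite bcoactD; congr (_ + _); move: x.
apply: tensor_ext_add => [x z|x z|x v].
- by rewrite scalerDr bcoactD.
- by rewrite bcoactD scalerDr.
- rewrite -[tens x v]/(bincl x v) lscale_bincl !bcoact_tens.
  exact: tbincl_scalel.
Qed.

HB.instance Definition _ :=
  GRing.isLinear.Build L bmod (ltensor iL bmod G) *:%R bcoact bcoact_linear.

Lemma bcoact_even k z : bcoact (hpart bgrading k z) =
  \sum_(i : bool) (tmap (hpart bgrading i : B -> B)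
                    (hpart (sa_gr G) (k (+) i)) (bcoact z) : tensor B G).
Proof.
have hl i : linear (tmap (hpart bgrading i : B -> B) (hpart (sa_gr G) (k (+) i))).
  by apply: tmap_linear => a x y; rewrite [LHS]linearP.
move: z; apply: tensor_ext_add => [x y|x y|x v].
- by rewrite linearD bcoactD.
- by rewrite bcoactD -big_split; apply: eq_bigr => i _ /=; apply: linearDf (hl i) _ _.
- rewrite -[tens x v]/(bincl x v) [hpart _ _ _]bhpart_tens.
  rewrite -[tens x _]/(bincl x _) !bcoact_tens coact_even.
  rewrite (big_morph _ (linearDf (tbincl_linear x)) (linear0f (tbincl_linear x))).
  apply: eq_bigr => i _; move: (coact V v).
  have hp : linear (tmap (hpart (rep_gr V) i : res iK V -> res iK V)
                         (hpart (sa_gr G) (k (+) i))).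
    by apply: tmap_linear => a y w; rewrite [LHS]linearP.
  apply: tensor_ext_add => [y w|y w|w b].
  + by rewrite (linearDf hp) (linearDf (tbincl_linear x)).
  + by rewrite (linearDf (tbincl_linear x)) (linearDf (hl i)).
  + rewrite tmap_tens; try by move=> a y z; rewrite [LHS]linearP.
    rewrite !tbincl_tens tmap_tens; try by move=> a y z; rewrite [LHS]linearP.
    by congr (tens _ _); rewrite -[RHS]/(bhpart i (bincl x w)) bhpart_tens.
Qed.

Lemma bcoactA z :
  tassoc (tmap (bcoact : B -> tensor B G) (idfun : G -> G) (bcoact z)) =
  tmap (idfun : B -> B) (comul G) (bcoact z).
Proof.
have lb : linear (bcoact : B -> tensor B G).
  exact: to_ltensor_linear bcoact_linear.
have l1 : linear (tmap (bcoact : B -> tensor B G) (idfun : G -> G)).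
  by apply: tmap_linear.
have l2 : linear (tmap (idfun : B -> B) (comul G)).
  by apply: tmap_linear => // a x y; rewrite linearP.
have lc : linear (coact V : res iK V -> tensor (res iK V) G).
  by apply: to_ltensor_linear => a x y; rewrite linearP.
have l3 : linear (tmap (coact V : res iK V -> tensor (res iK V) G) (idfun : G -> G)).
  by apply: tmap_linear.
have l4 : linear (tmap (idfun : res iK V -> res iK V) (comul G)).
  by apply: tmap_linear => // a x y; rewrite linearP.
move: z; apply: tensor_ext_add => [x y|x y|x v].
- by rewrite bcoactD (linearDf l1) (linearDf (@tassoc_linear _ _ _ _)).
- by rewrite bcoactD (linearDf l2).
rewrite -[tens x v]/(bincl x v) bcoact_tens.
have l5 : linear (tmap (bincl x : res iK V -> B) (idfun : tensor G G -> _)).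
  by apply: tmap_linear => //; apply: bincl_linear.
transitivity (tmap (bincl x : res iK V -> B) (idfun : tensor G G -> _)
  (tassoc (tmap (coact V : res iK V -> tensor (res iK V) G)
     (idfun : G -> G) (coact V v)))); last first.
  rewrite coactA; move: (coact V v); apply: tensor_ext_add => [y z|y z|w b].
  + by rewrite (linearDf l4) (linearDf l5).
  + by rewrite (linearDf (tbincl_linear x)) (linearDf l2).
  + rewrite tbincl_tens !tmap_tens //; try exact: bincl_linear.
    * by move=> a y z; rewrite linearP.
    * by move=> a y z; rewrite linearP.
move: (coact V v); apply: tensor_ext_add => [y z|y z|w b].
- by rewrite (linearDf (tbincl_linear x)) (linearDf l1) (linearDf (@tassoc_linear _ _ _ _)).
- by rewrite (linearDf l3) (linearDf (@tassoc_linear _ _ _ _)) (linearDf l5).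
rewrite tbincl_tens !tmap_tens // -[bcoact _]/(bcoact (bincl x w)) bcoact_tens.
move: (coact V w); apply: tensor_ext_add => [y z|y z|w' b'].
- by rewrite (linearDf (tbincl_linear x)) tensDl (linearDf (@tassoc_linear _ _ _ _)).
- by rewrite tensDl (linearDf (@tassoc_linear _ _ _ _)) (linearDf l5).
rewrite tbincl_tens !tassoc_tens tmap_tens //; exact: bincl_linear.
Qed.

Lemma bcoact1 z :
  tlift (fun (w : B) (b : G) => (counit G b : F) *: w) (bcoact z) = z.
Proof.
have hb (M : lmodType F) : bilinear_for *:%R *:%R
    (fun (w : M) (b : G) => (counit G b : F) *: w).
  split=> [b|w] a x y /=; first by rewrite scalerDr !scalerA mulrC.
  by rewrite linearP scalerDl scalerA.
have lB := tlift_linear (hb B).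
have lV := tlift_linear (hb (res iK V)).
move: z; apply: tensor_ext_add => [x y|x y|x v].
- by rewrite bcoactD (linearDf lB).
- by [].
rewrite -[tens x v]/(bincl x v) bcoact_tens -[in RHS](coact1 v).
move: (coact V v); apply: tensor_ext_add => [y w|y w|w b].
- by rewrite (linearDf (tbincl_linear x)) (linearDf lB).
- by rewrite (linearDf lV) binclDr.
rewrite tbincl_tens !tlift_tens //.
by rewrite (linearZf _ _ (bincl_linear x)).
Qed.

Definition bchange : rep G iL :=
  @Rep F G L iL bmod bgrading bcoact bcoact_even bcoactA bcoact1.


End BaseChangeRep.

(* v |-> 1 (x) v *)
Definition bunit (V : rep G iK) : V -> bchange V := bincl 1.

Definition bchange_map (V W : rep G iK) (f : V -> W) : bchange V -> bchange W :=
  tmap (idfun : res phi L^o -> res phi L^o) f.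
End BaseChange.

Arguments bunit {F G K L iK iL phi} phiE {V} v.
Arguments bchange_map {F G K L iK iL phi} phiE {V W} f _.

Section EvenPart.
Variables (F : fieldType) (A : superalgebra F).

Definition even_pred : {pred A} := fun x => hpart (sa_gr A) false x == x.

Lemma even_pred_closed : GRing.subalg_closed even_pred.
Proof.
split=> [|a x y|x y]; rewrite !unfold_in.
- exact/eqP/sa_one.
- by move=> /eqP hx /eqP hy; rewrite linearP hx hy.
- by move=> /eqP hx /eqP hy; apply/eqP; apply: (sa_mul hx hy).
Qed.
HB.instance Definition _ := GRing.isSubalgClosed.Build F A even_pred even_pred_closed.

(* The ungraded algebra A_0. *)
Record even_alg : Type := EvenAlg { even_val :> A; _ : even_val \in even_pred }.
HB.instance Definition _ := [isSub for even_val].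
HB.instance Definition _ := [Choice of even_alg by <:].
HB.instance Definition _ := [SubChoice_isSubAlgebra of even_alg by <:].
End EvenPart.

Section EndSuperalgebra.
Variables (F : fieldType) (G : hopf_superalgebra F) (K : fieldType).
Variables (iota : {rmorphism F -> K}) (V : irrep G iota).

Definition uend_pred : {pred (V -> V) * (V -> V)} := fun p =>
  `[< rep_hom (V := V) (W := V) p.1 /\ rep_hom (V := V) (W := Pi_rep V) p.2 >].

Lemma coact_lin (U W : rep G iota) (f : U -> W) :
  linear f -> linear (tmap (f : res iota U -> res iota W) (idfun : G -> G)
                      : ltensor iota U G -> ltensor iota W G).
Proof.
move=> lf a x y; have l : linear (tmap (f : res iota U -> res iota W) (idfun : G -> G)).
  by apply: tmap_linear => // b u v; exact: (res_linear (phi := iota) lf).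
rewrite (linearDf l); congr (_ + _); move: x.
apply: tensor_ext_add => [x z|x z|w b].
- by rewrite scalerDr (linearDf l).
- by rewrite (linearDf l) scalerDr.
- rewrite [X in tmap _ _ X]lscale_tens !tmap_tens //; try exact: res_linear.
  by rewrite (linearZf _ _ lf) [RHS]lscale_tens.
Qed.

Lemma rep_hom_id (W : rep G iota) : rep_hom (V := W) (W := W) idfun.
Proof.
split=> // v; move: (coact W v); apply: tensor_ext_add => // [x y|w b].
- exact: (linearDf (coact_lin (@idfun_linear K W))).
- by rewrite tmap_tens.
Qed.

Lemma rep_hom_comp (U W X : rep G iota) (f : W -> X) (g : U -> W) :
  rep_hom f -> rep_hom g -> rep_hom (f \o g).
Proof.
move=> [lf ef cf] [lg eg cg]; split=> [a x y|i v|v] /=.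
- by rewrite lg lf.
- by rewrite eg ef.
rewrite cf cg.
have l1 := coact_lin lf; have l2 := coact_lin lg.
have l3 : linear (f \o g) by move=> a x y /=; rewrite lg lf.
move: (coact U v); apply: tensor_ext_add => [x y|x y|w b].
- by rewrite (linearDf l2) (linearDf l1).
- exact: (linearDf (coact_lin l3)).
- by rewrite !tmap_tens //; apply: res_linear.
Qed.

Lemma rep_hom_shift (U W : rep G iota) (f : U -> W) :
  rep_hom f -> rep_hom (Pi_map f).
Proof. by case=> lf ef cf; split=> // i v; apply: ef. Qed.

Lemma rep_hom0 (U W : rep G iota) : rep_hom (V := U) (W := W) (fun=> 0).
Proof.
have l0 : linear ((fun=> 0) : U -> W) by move=> a x y; rewrite scaler0 addr0.
split=> // [i v|v]; rewrite linear0 //.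
move: (coact U v); apply: tensor_ext_add => [x y|x y|w b].
- by rewrite addr0.
- exact: (linearDf (coact_lin l0)).
- rewrite tmap_tens //; last exact: (res_linear (phi := iota) l0).
  by rewrite (@tens0l F (res iota W) G).
Qed.

Lemma rep_hom_lin (U W : rep G iota) (a : K) (f g : U -> W) :
  rep_hom f -> rep_hom g -> rep_hom (V := U) (W := W) (fun v => a *: f v + g v).
Proof.
move=> [lf ef cf] [lg eg cg].
have lh : linear (fun v => a *: f v + g v).
  by move=> b x y; rewrite lf lg !scalerDr !scalerA addrACA mulrC.
split=> // [i v|v]; first by rewrite ef eg linearP.
rewrite linearP cf cg.
have l1 := coact_lin lf; have l2 := coact_lin lg; have l3 := coact_lin lh.
move: (coact U v); apply: tensor_ext_add => [x y|x y|w b].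
- by rewrite (linearDf l1) (linearDf l2) scalerDr addrACA.
- exact: (linearDf l3).
- rewrite !tmap_tens //; try exact: res_linear.
  rewrite [X in X + _]lscale_tens.
  by rewrite -(@tensDl F (res iota W) G).
Qed.

Lemma uend_pred_closed : GRing.submod_closed uend_pred.
Proof.
split=> [|a p q]; rewrite !unfold_in.
  by apply/asboolP; split; apply: rep_hom0.
move=> /asboolP[hp0 hp1] /asboolP[hq0 hq1]; apply/asboolP.
by split; apply: rep_hom_lin.
Qed.
HB.instance Definition _ :=
  GRing.isSubmodClosed.Build K ((V -> V) * (V -> V))%type uend_pred uend_pred_closed.

(* The pair (f, g) stands for f + g, with f in End_G(V) and
   g in Hom_G(V, Pi V). *)
Record uend : Type := UEnd {
  uend_val :> (V -> V) * (V -> V); _ : uend_val \in uend_pred }.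
HB.instance Definition _ := [isSub for uend_val].
HB.instance Definition _ := [Choice of uend by <:].
HB.instance Definition _ := [SubChoice_isSubLmodule of uend by <:].

Lemma uend_even (p : uend) : rep_hom (V := V) (W := V) (uend_val p).1.
Proof. by have := valP p; rewrite unfold_in => /asboolP[]. Qed.

Lemma uend_odd (p : uend) : rep_hom (V := V) (W := Pi_rep V) (uend_val p).2.
Proof. by have := valP p; rewrite unfold_in => /asboolP[]. Qed.

Lemma uendP (f g : V -> V) :
  rep_hom (V := V) (W := V) f -> rep_hom (V := V) (W := Pi_rep V) g ->
  (f, g) \in uend_pred.
Proof. by move=> hf hg; rewrite unfold_in; apply/asboolP. Qed.

Lemma rep_homD (U W : rep G iota) (f g : U -> W) :
  rep_hom f -> rep_hom g -> rep_hom (V := U) (W := W) (fun v => f v + g v).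
Proof.
move=> hf hg; have := rep_hom_lin 1 hf hg.
by under eq_fun do rewrite scale1r.
Qed.

Lemma Pi_rep_odd (f g : V -> V) :
  rep_hom (V := V) (W := Pi_rep V) f -> rep_hom (V := V) (W := Pi_rep V) g ->
  rep_hom (V := V) (W := V) (f \o g).
Proof.
move=> hf hg; have [l e c] := rep_hom_comp (rep_hom_shift hf) hg.
by split=> // i v; rewrite (e i v) /= negbK.
Qed.

Definition uend_one : uend := UEnd (uendP (rep_hom_id V) (rep_hom0 V (Pi_rep V))).

Lemma uend_mul_subproof (p q : uend) :
  ((fun v => p.1 (q.1 v) + p.2 (q.2 v)), (fun v => p.1 (q.2 v) + p.2 (q.1 v)))
    \in uend_pred.
Proof.
apply: uendP; apply: rep_homD.
- exact: rep_hom_comp (uend_even p) (uend_even q).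
- exact: Pi_rep_odd (uend_odd p) (uend_odd q).
- exact: rep_hom_comp (rep_hom_shift (uend_even p)) (uend_odd q).
- exact: rep_hom_comp (uend_odd p) (uend_even q).
Qed.

Definition uend_mul (p q : uend) : uend := UEnd (uend_mul_subproof p q).

Let lE (p : uend) := let: And3 l _ _ := uend_even p in l.
Let lO (p : uend) : linear (p.2 : V -> V) := let: And3 l _ _ := uend_odd p in l.

Lemma uend_eq (p q : uend) : p.1 =1 q.1 -> p.2 =1 q.2 -> p = q.
Proof.
move=> h1 h2; apply: val_inj; rewrite /=.
by rewrite [LHS]surjective_pairing [RHS]surjective_pairing (funext h1) (funext h2).
Qed.

Lemma uend_mulA : associative uend_mul.
Proof.
move=> p q r; apply: uend_eq => v /=.
- by rewrite (linearDf (lE p)) (linearDf (lO p)) addrACA addrA -!addrA; congr (_ + _); rewrite addrCA [in RHS]addrC !addrA.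
- by rewrite (linearDf (lE p)) (linearDf (lO p)) addrACA addrA -!addrA; congr (_ + _); rewrite addrCA [in RHS]addrC !addrA.
Qed.

Lemma uend_valD (p q : uend) : uend_val (p + q) = uend_val p + uend_val q.
Proof. by []. Qed.
Lemma uend_valZ (a : K) (p : uend) : uend_val (a *: p) = a *: uend_val p.
Proof. by []. Qed.

Lemma uend_mul1r : left_id uend_one uend_mul.
Proof. by move=> p; apply: uend_eq => v /=; rewrite addr0. Qed.
Lemma uend_mulr1 : right_id uend_one uend_mul.
Proof.
move=> p; apply: uend_eq => v /=.
- by rewrite (linear0f (lO p)) addr0.
- by rewrite (linear0f (lE p)) add0r.
Qed.
Lemma uend_mulDl : left_distributive uend_mul +%R.
Proof.
by move=> p q r; apply: uend_eq => v; rewrite /= addrACA.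
Qed.
Lemma uend_mulDr : right_distributive uend_mul +%R.
Proof.
move=> p q r; apply: uend_eq => v /=;
  by rewrite (linearDf (lE p)) (linearDf (lO p)) addrACA.
Qed.
Lemma uend_one_neq0 : uend_one != 0.
Proof.
apply/eqP => h; have [v nz] := irr_neq0 V; apply: nz.
by have := congr1 (fun p : uend => p.1 v) h.
Qed.
HB.instance Definition _ := GRing.Zmodule_isNzRing.Build uend
  uend_mulA uend_mul1r uend_mulr1 uend_mulDl uend_mulDr uend_one_neq0.

Lemma uend_scaleAl (a : K) (p q : uend) : a *: (p * q) = a *: p * q.
Proof. by apply: uend_eq => v /=; rewrite -[LHS]/(a *: (_ + _)) scalerDr. Qed.
HB.instance Definition _ := GRing.LSemiModule_isLSemiAlgebra.Build K uend uend_scaleAl.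

Lemma uend_scaleAr (a : K) (p q : uend) : a *: (p * q) = p * (a *: q).
Proof.
apply: uend_eq => v /=; rewrite -[LHS]/(a *: (_ + _)) scalerDr;
  by rewrite -(linearZf _ _ (lE p)) -(linearZf _ _ (lO p)).
Qed.
HB.instance Definition _ := GRing.Lalgebra_isAlgebra.Build K uend uend_scaleAr.

Lemma uend_part_subproof (i : bool) (p : uend) :
  (if i then 0 else p.1, if i then p.2 else 0) \in uend_pred.
Proof.
by case: i; apply: uendP; do ?[exact: rep_hom0|exact: uend_even|exact: uend_odd].
Qed.
Definition uend_part (i : bool) (p : uend) : uend := UEnd (uend_part_subproof i p).

Lemma uend_part_linear i : linear (uend_part i).
Proof.
move=> a p q; apply: val_inj => /=; case: i => /=;
by rewrite /uend_val /=; congr (_, _); apply/funext => v; rewrite /= ?scaler0 ?addr0.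
Qed.
HB.instance Definition _ i :=
  GRing.isLinear.Build K uend uend *:%R (uend_part i) (uend_part_linear i).

Lemma uend_partK i j p :
  uend_part i (uend_part j p) = if i == j then uend_part j p else 0.
Proof. by apply: val_inj; case: i; case: j. Qed.
Lemma uend_partD p : uend_part false p + uend_part true p = p.
Proof.
by apply: uend_eq => v; rewrite /= ?addr0 ?add0r.
Qed.
Definition uend_grading : grading uend :=
  @Grading K uend (fun i => uend_part i) uend_partK uend_partD.

Lemma uend_gr1 : homogeneous uend_grading false 1.
Proof. by apply: val_inj. Qed.

Lemma uend_grM i j (p q : uend) :
  homogeneous uend_grading i p -> homogeneous uend_grading j q ->
  homogeneous uend_grading (i (+) j) (p * q).
Proof.
rewrite /homogeneous /= => <- <-.
apply: uend_eq => v; case: i; case: j => //=;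
rewrite ?(linear0f (lE p)) ?(linear0f (lO p)) ?addr0 ?add0r //.
Qed.

Definition uEnd : superalgebra K := @SuperAlgebra K uend uend_grading uend_gr1 uend_grM.

Definition End_rep : algType K := even_alg uEnd.
End EndSuperalgebra.

Section Galois.
Variables (F K : fieldType) (iota : {rmorphism F -> K}).

(* Automorphisms of K over F. *)
Record relaut := RelAut {
  ra_fun :> {rmorphism K -> K};
  ra_bij : bijective ra_fun;
  ra_fix : forall x, ra_fun (iota x) = iota x
}.

Lemma ra_mul_fix (s t : relaut) x : s (t (iota x)) = iota x.
Proof. by rewrite !ra_fix. Qed.
Definition ra_mul (s t : relaut) : relaut :=
  @RelAut (ra_fun s \o ra_fun t) (bij_comp (ra_bij s) (ra_bij t)) (ra_mul_fix s t).

Definition separable_closure : Prop :=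
  (forall x : K, exists2 p : {poly F}, separable_poly p & root (map_poly iota p) x)
  /\ (forall p : {poly K}, separable_poly p -> (1 < size p)%N -> exists x, root p x).

(* Continuity for the Krull topology on relaut and the discrete one on K. *)
Definition gal_continuous (b : relaut -> K) : Prop :=
  forall s : relaut, exists e : seq K,
    forall t : relaut, (forall x, x \in e -> t x = s x) -> b t = b s.

(* ^s V. Since O(G) is defined over F, G (x)_F K is identified with its own base
   change along s, the coaction of ^s V being 1 (x) v |-> sum (1 (x) v_0) (x) v_1. *)
Definition twist (G : hopf_superalgebra F) (s : relaut) (V : rep G iota)
  : rep G iota := bchange (ra_fix s) V.

Definition quasi_rational (G : hopf_superalgebra F) (V : irrep G iota) : Prop :=
  (forall f : V -> V, rep_hom f -> exists c : K, forall v, f v = c *: v) /\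
  (forall s : relaut, rep_isomorphic (twist s V) V).

End Galois.

Definition base_irrep (F : fieldType) (G : hopf_superalgebra F) :=
  irrep G (idfun : {rmorphism F -> F}).

Section BorelTits.
Variables (F Fs : fieldType) (iota : {rmorphism F -> Fs}).
Local Notation Gamma := (relaut iota).

Definition extend (G : hopf_superalgebra F) (VF : base_irrep G) : rep G iota :=
  @bchange F G F Fs idfun iota iota (fun x => erefl) VF.

Definition lies_over (G : hopf_superalgebra F) (VF : base_irrep G)
    (V : irrep G iota) : Prop :=
  exists2 f : V -> extend VF, rep_hom f & injective f.

(* t is the restriction of s to the subfield k : L -> Fs. *)
Definition restricts (L : splittingFieldType F) (k : {rmorphism L -> Fs})
    (s : Gamma) (t : relaut (in_alg L)) : Prop := forall x, s (k x) = k (t x).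

(* Phi s is determined by its values on 1 (x) theta (1 (x) v) since these span
   the twist of V by s. *)
Definition BT_choice (G : hopf_superalgebra F) (V : irrep G iota)
    (Phi : forall s : Gamma, twist s V -> V) : Prop :=
  (forall s, rep_iso (Phi s)) /\
  exists (L : splittingFieldType F) (k : {rmorphism L -> Fs})
         (kE : forall x, k (in_alg L x) = iota x) (V' : rep G (in_alg L))
         (theta : bchange kE V' -> V)
         (phi : forall t : relaut (in_alg L), twist t V' -> V'),
    [/\ galois 1 {:L}, rep_iso theta, forall t, rep_iso (phi t) &
      forall s, exists2 t, restricts k s t &
        forall v, Phi s (bchange_map (ra_fix s) theta
                           (bunit (ra_fix s) (bunit kE v))) =
                  theta (bunit kE (phi t (bunit (ra_fix t) v)))].

(* Phi_s o ^s Phi_t = c_{s,t} Phi_{st}, evaluated at the elements 1 (x) 1 (x) v,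
   which are all of ^s ^t V = ^{st} V. *)
Definition BT_cocycle (G : hopf_superalgebra F) (V : irrep G iota)
    (Phi : forall s : Gamma, twist s V -> V) (c : Gamma -> Gamma -> Fs) : Prop :=
  forall s t v,
    Phi s (bchange_map (ra_fix s) (Phi t)
             (bunit (ra_fix s) (bunit (ra_fix t) v))) =
    c s t *: Phi (ra_mul s t) (bunit (ra_fix (ra_mul s t)) v).

(* S o Phi_s = Pi Phi_s o ^s S, using Pi (^s V) = ^s (Pi V). *)
Definition BT_compatible (G : hopf_superalgebra F) (V : irrep G iota)
    (Phi : forall s : Gamma, twist s V -> V) (S : V -> Pi_rep V) : Prop :=
  rep_iso (V := V) (W := Pi_rep V) S /\
  forall (s : Gamma) (z : twist s V),
    S (Phi s z) = Pi_map (Phi s) (bchange_map (ra_fix s) (W := Pi_rep V) S z).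

Definition cohomologous (c d : Gamma -> Gamma -> Fs) : Prop :=
  exists b : Gamma -> Fs,
    [/\ gal_continuous b, forall s, b s != 0 &
      forall s t, c s t = d s t * (b s * s (b t) / b (ra_mul s t))].

Definition tensor_mul (L : splittingFieldType F) (A : algType F)
    (z w : ltensor (in_alg L) L^o A) : ltensor (in_alg L) L^o A :=
  tlift (fun (x : res (in_alg L) L^o) (a : A) =>
    tlift (fun (y : res (in_alg L) L^o) (b : A) =>
      tens ((x : L) * (y : L) : res (in_alg L) L^o) (a * b)) w) z.

(* The class of A in Br(F) corresponds to the class of the 2-cocycle c in
   H^2(Gamma, Fs^x). Here f : End_L(W (x)_F L) -> L (x)_F A for W = F^n, the
   relation f^-1 o s(f) = conj (g s) is evaluated at s(X), and dG is the inflation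
   to Gamma of the cocycle d with g_s s(g_t) = d_{s,t} g_{st}. *)
Definition brauer_class (A : algType F) (c : Gamma -> Gamma -> Fs) : Prop :=
  exists (L : splittingFieldType F) (k : {rmorphism L -> Fs}) (n : nat)
         (f : 'M[L]_n -> ltensor (in_alg L) L^o A)
         (g : relaut (in_alg L) -> 'M[L]_n)
         (d : relaut (in_alg L) -> relaut (in_alg L) -> L)
         (dG : Gamma -> Gamma -> Fs),
    [/\ galois 1 {:L},
        forall x, k (in_alg L x) = iota x,
        [/\ linear f, bijective f,
            f 1%:M = tens ((1 : L) : res (in_alg L) L^o) 1
          & forall X Y, f (X *m Y) = tensor_mul (f X) (f Y)],
        forall s, g s \in unitmx &
      [/\ forall (s : relaut (in_alg L)) X,
            tmap (s : res (in_alg L) L^o -> res (in_alg L) L^o) (idfun : A -> A)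
                 (f X) =
            f (g s *m map_mx s X *m invmx (g s)),
          forall s t : relaut (in_alg L), g s *m map_mx s (g t) = d s t *: g (ra_mul s t),
          forall s t, exists s' t',
            [/\ restricts k s s', restricts k t t' & dG s t = k (d s' t')]
        & cohomologous c dG]].

End BorelTits.

Section BrauerWall.
Variables (F Fs : fieldType) (iota : {rmorphism F -> Fs}).

Definition fin_dim (A : algType F) : Prop :=
  exists e : seq A, forall x, exists c : nat -> F, x = \sum_(i < size e) c i *: e`_i.

Definition ideal2 (A : algType F) (I : A -> Prop) : Prop :=
  [/\ I 0, forall x y, I x -> I y -> I (x + y)
    & forall a x, I x -> I (a * x) /\ I (x * a)].

Definition central_simple (A : algType F) : Prop :=
  [/\ fin_dim A,
      forall I, ideal2 I -> (forall x : A, I x -> x = 0) \/ (forall x : A, I x)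
    & forall z : A, (forall x, z * x = x * z) -> exists a : F, z = a%:A].

Definition central_simple_super (A : superalgebra F) : Prop :=
  [/\ fin_dim A,
      forall I, ideal2 I ->
        (forall i (x : A), I x -> I (hpart (sa_gr A) i x)) ->
        (forall x : A, I x -> x = 0) \/ (forall x : A, I x)
    & forall z : A, homogeneous (sa_gr A) false z ->
        (forall x, z * x = x * z) -> exists a : F, z = a%:A].

Definition purely_even (A : superalgebra F) : Prop :=
  forall x : A, homogeneous (sa_gr A) false x.

Definition same_square_class (a b : F) : Prop := exists2 x : F, x != 0 & a = x ^+ 2 * b.

(* b in F^x represents the second invariant of A. *)
Definition bw_disc (A : superalgebra F) (b : F) : Prop :=
  [\/ [/\ central_simple A, purely_even A & b = 1],
      [/\ central_simple A, ~ purely_even A &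
        exists u : A,
          [/\ homogeneous (sa_gr A) false u,
              forall z : A, homogeneous (sa_gr A) false z ->
                (forall x : A, homogeneous (sa_gr A) false x -> z * x = x * z) <->
                (exists c d : F, z = c%:A + d *: u),
              forall c : F, u <> c%:A
            & u * u = b%:A]]
    | ~ central_simple A /\
        exists u : A,
          [/\ u <> 0, homogeneous (sa_gr A) true u,
              forall x : A, homogeneous (sa_gr A) false x -> u * x = x * u
            & u * u = b%:A]].

(* The invariants of the class of A in BW(F); eps = true stands for the sign +. *)
Record bw_triple (A : superalgebra F) (eps : bool) (a : F)
    (c : relaut iota -> relaut iota -> Fs) : Prop := BWTriple {
  bw_css : central_simple_super A;
  bw_sign : eps <-> central_simple A;
  bw_a : a != 0 /\ exists2 b : F, bw_disc A b & same_square_class a b;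
  bw_D : if eps then brauer_class A c else brauer_class (even_alg A) c
}.

End BrauerWall.

(* Main.v *)
(** Let L/F be a finite Galois extension over which V and the isomorphisms
    Phi are defined, V' the model of V over L, and phi_s the resulting s-semilinear
    automorphisms of V', so that phi_s phi_t = c_(s,t) phi_(st).  An L-linear
    functional on Fs carries the embedding of V into the extension of V_F to a
    nonzero morphism m0 from V' to W = L (x) V_F.  The sum of the conjugates
    s m0 phi_s^-1 (V') is stable under the Galois group, hence descends to V_F and
    is all of W; so W = V'^n, End(W) = M_n(L), and the Galois action on W is
    w |-> g_s phi_s(w) for matrices g_s.  Comparing the two actions of st gives
    g_s s(g_t) = c_(s,t)^-1 g_(st), which is (1).  Odd self-maps of V' form a line
    with a semilinear Galois action, and vanish exactly when V and Pi V are not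
    isomorphic; a fixed vector S of this line acts diagonally on W, commutes with
    End(W) and with the Galois action, and thus descends to an odd central u in the
    endomorphisms of V_F with u^2 = S^2. *)

From HB Require Import structures.
Require Import Defs.
From mathcomp Require Import all_boot all_order all_algebra all_field.
From mathcomp Require Import sesquilinear boolp.
From mathcomp Require classical_sets.

Set Implicit Arguments.
Unset Strict Implicit.
Unset Printing Implicit Defensive.

Import GRing.Theory.
Local Open Scope ring_scope.

(** * Linear functionals and tensors *)

(** No dimension is assumed finite, so bases are replaced by linear functionals, which come from
    Zorn's lemma. The finite multiplicity n has to come from the finite Galois group: W is generated
    by one image of V' for each group element, and a least generating family is independent. V' is
    only a model of V, which the self-maps of V need not preserve; contracting scalars along
    functionals on Fs moves what is needed from V to V', and base change moves it back. The [phi_s]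
    are not normalised, so [phi_1] is merely a scalar. In (3) the descended u commutes with odd
    endomorphisms as well as with even ones, without signs; a nonzero odd element is no scalar, so
    the ungraded algebra is not central and the sign is minus. Automorphisms of the possibly
    infinite extension Fs enter through the uniqueness of S: the ratio of two choices is fixed by
    all of them, and the fixed field has to be shown to be F. *)

Definition subspace (K : fieldType) (V : lmodType K) (H : V -> Prop) : Prop :=
  H 0 /\ forall (a : K) x y, H x -> H y -> H (a *: x + y).

Section Functionals.
Variables (K : fieldType) (V : lmodType K).

Lemma subspaceZ (H : V -> Prop) a x : subspace H -> H x -> H (a *: x).
Proof. by case=> H0 HL Hx; rewrite -[_ *: _]addr0; apply: HL. Qed.

Lemma subspaceD (H : V -> Prop) x y : subspace H -> H x -> H y -> H (x + y).
Proof. by case=> H0 HL Hx Hy; rewrite -[x]scale1r; apply: HL. Qed.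

Lemma subspaceB (H : V -> Prop) x y : subspace H -> H x -> H y -> H (x - y).
Proof. by case=> H0 HL Hx Hy; rewrite addrC -scaleN1r; apply: HL. Qed.

Lemma subspace_sum (H : V -> Prop) (I : eqType) (s : seq I) (P : pred I) (f : I -> V) :
  subspace H -> (forall i, i \in s -> P i -> H (f i)) ->
  H (\sum_(i <- s | P i) f i).
Proof.
move=> sH Hf; rewrite big_seq_cond; apply: big_ind => [|x y|i].
- exact: sH.1.
- exact: subspaceD.
- by case/andP=> /Hf.
Qed.

(** Zorn's lemma gives a maximal subspace containing H and missing v0; it is a complement of the
    line of v0, and l is the coordinate along that line. The order is put on sets X whose union
    [U X] with H is a subspace, because the union of the empty chain must qualify too. *)
Lemma functional_separation (H : V -> Prop) (v0 : V) : subspace H -> ~ H v0 ->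
  exists2 l : {linear V -> K^o}, forall v, H v -> l v = 0 & l v0 = 1.
Proof.
move=> sH nHv0.
pose U (X : V -> Prop) v := H v \/ X v.
pose P (X : V -> Prop) := subspace (U X) /\ ~ U X v0.
have [|X [[sX nXv0] maxX]] := @classical_sets.Zorn_bigcup V P.
  move=> C CP totC; split; last first.
    by case=> // [[X /CP[_ nX] Xv0]]; apply: nX; right.
  have incl X : C X -> forall v, U X v -> U (classical_sets.bigcup C id) v.
    by move=> CX v [Hv|Xv]; [left | right; exists X].
  split=> [|a x y]; first by left; exact: sH.1.
  case=> [Hx|[X CX Xx]] [Hy|[Y CY Yy]].
  - by left; exact: sH.2.
  - by apply: (incl Y CY); apply: (CP Y CY).1.2; [left | right].
  - by apply: (incl X CX); apply: (CP X CX).1.2; [right | left].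
  - have [XY|YX] := totC _ _ CX CY.
    + by apply: (incl Y CY); apply: (CP Y CY).1.2; right => //; apply: XY.
    + by apply: (incl X CX); apply: (CP X CX).1.2; right => //; apply: YX.
(* Adjoining a vector v outside the maximal subspace must capture v0, so v is a multiple of v0
   modulo that subspace. *)
have comp v : exists c, U X (v - c *: v0).
  have [Uv|nUv] := pselect (U X v); first by exists 0; rewrite scale0r subr0.
  pose Y w := exists c, U X (w - c *: v).
  have XY w : U X w -> Y w by move=> Uw; exists 0; rewrite scale0r subr0.
  have sY : subspace Y.
    split=> [|a x y [c Uc] [d Ud]]; first exact/XY/sX.1.
    exists (a * c + d).
    have -> : a *: x + y - (a * c + d) *: v = a *: (x - c *: v) + (y - d *: v).
      by rewrite scalerBr scalerDl scalerA opprD addrACA.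
    exact: sX.2.
  have [[c Uc]|nYv0] := pselect (Y v0).
    have [c0|cn0] := eqVneq c 0; first by move: Uc; rewrite c0 scale0r subr0 => /nXv0.
    exists c^-1; have := subspaceZ (- c^-1) sX Uc.
    by rewrite scalerBr !scaleNr scalerA mulVf // scale1r opprK addrC.
  have UY w : U Y w -> Y w by case=> // Hw; apply: XY; left.
  case: (maxX Y); last first.
    split; last by move/UY.
    split=> [|a x y /UY Yx /UY Yy]; [left; exact: sH.1 | right; exact: sY.2].
  split; first by move=> w Xw; apply: XY; right.
  move=> YX; apply: nUv; right; apply: YX; exists 1; rewrite scale1r subrr.
  exact: sX.1.
have [l Ul] := choice comp.
have uniq c v : U X (v - c *: v0) -> c = l v.
  move=> Uc; apply/eqP; rewrite -subr_eq0; apply: contra_notT nXv0 => nz.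
  have := subspaceB sX (Ul v) Uc.
  rewrite opprB addrC addrA subrK -scalerBl => /(subspaceZ (c - l v)^-1 sX).
  by rewrite scalerA mulVf // scale1r.
have ll : linear (l : V -> K^o).
  move=> a x y; symmetry; apply: (uniq (a * l x + l y)).
  have -> : a *: x + y - (a * l x + l y) *: v0
      = a *: (x - l x *: v0) + (y - l y *: v0).
    by rewrite scalerBr scalerDl -scalerA opprD addrACA.
  exact: sX.2.
pose m := GRing.isLinear.Build K V K^o *:%R l ll.
pose lL : {linear V -> K^o} := HB.pack l m.
exists lL => [v Hv|] /=; symmetry; apply: uniq.
- by rewrite scale0r subr0; left.
- by rewrite scale1r subrr; exact: sX.1.
Qed.

Lemma functional_exists (v0 : V) : v0 <> 0 ->
  exists l : {linear V -> K^o}, l v0 = 1.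
Proof.
move=> nz; have [|l _ lv0] := @functional_separation (fun v => v = 0) v0 _ nz.
  by split=> // a x y -> ->; rewrite scaler0 addr0.
by exists l.
Qed.

(** Induction on vs: if the family already built fails to reproduce v0, the error at v0 is added,
    with a functional that is 1 at v0 and vanishes on all vectors reproduced so far. *)
Lemma finite_dual_basis (vs : seq V) :
  exists s : seq (V * {linear V -> K^o}),
    forall v, v \in vs -> v = \sum_(p <- s) p.2 v *: p.1.
Proof.
elim: vs => [|v0 vs [s Hs]]; first by exists [::].
pose H v := v = \sum_(p <- s) (p.2 v : K) *: p.1.
have sH : subspace H.
  split=> [|a x y Hx Hy].
    by rewrite /H big1 // => p _; rewrite linear0 scale0r.
  rewrite /H {1}Hx {1}Hy scaler_sumr -big_split; apply: eq_bigr => p _ /=.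
  by rewrite linearP scalerDl scalerA.
have [H0|nH0] := pselect (H v0).
  by exists s => v; rewrite inE => /orP[/eqP->|/Hs].
have [l lH l0] := functional_separation sH nH0.
exists ((v0 - \sum_(p <- s) (p.2 v0 : K) *: p.1, l) :: s) => v.
rewrite inE big_cons /= => /orP[/eqP->|vs_v].
  by rewrite l0 scale1r subrK.
by rewrite (lH v (Hs v vs_v)) scale0r add0r -Hs.
Qed.

End Functionals.

(** * Contraction of tensors with functionals *)

Section TensorFunctionals.
Variables (K : fieldType) (U V : lmodType K).

Definition slice_r (l : V -> K) : tensor U V -> U := tlift (fun u v => l v *: u).
Definition slice_l (l : U -> K) : tensor U V -> V := tlift (fun u v => l u *: v).

Lemma slice_r_bilinear (l : {linear V -> K^o}) :
  bilinear_for *:%R *:%R (fun (u : U) (v : V) => (l v : K) *: u).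
Proof.
split=> [v|u] a x y /=; first by rewrite scalerDr !scalerA mulrC.
by rewrite linearP scalerDl scalerA.
Qed.

Lemma slice_l_bilinear (l : {linear U -> K^o}) :
  bilinear_for *:%R *:%R (fun (u : U) (v : V) => (l u : K) *: v).
Proof.
split=> [v|u] a x y /=; first by rewrite linearP scalerDl scalerA.
by rewrite scalerDr !scalerA mulrC.
Qed.

Lemma slice_r_linear (l : {linear V -> K^o}) : linear (slice_r l).
Proof. exact/tlift_linear/slice_r_bilinear. Qed.
Lemma slice_l_linear (l : {linear U -> K^o}) : linear (slice_l l).
Proof. exact/tlift_linear/slice_l_bilinear. Qed.

Lemma slice_r_tens (l : {linear V -> K^o}) u v : slice_r l (tens u v) = l v *: u.
Proof. by rewrite /slice_r tlift_tens //; apply: slice_r_bilinear. Qed.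
Lemma slice_l_tens (l : {linear U -> K^o}) u v : slice_l l (tens u v) = l u *: v.
Proof. by rewrite /slice_l tlift_tens //; apply: slice_l_bilinear. Qed.

Lemma tens_suml (I : Type) (s : seq I) (f : I -> U) (v : V) :
  tens (\sum_(i <- s) f i) v = \sum_(i <- s) tens (f i) v.
Proof. by apply: (big_morph (fun u => tens u v)) => [x y|]; rewrite ?tensDl ?tens0l. Qed.
Lemma tens_sumr (I : Type) (s : seq I) (u : U) (f : I -> V) :
  tens u (\sum_(i <- s) f i) = \sum_(i <- s) tens u (f i).
Proof. by apply: (big_morph (tens u)) => [x y|]; rewrite ?tensDr ?tens0r. Qed.

(** Only finitely many vectors of V occur in a tensor, so a dual system for these serves as a
    basis. *)
Lemma tensor_slices_r (z : tensor U V) :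
  exists s : seq (V * {linear V -> K^o}),
    z = \sum_(p <- s) tens (slice_r p.2 z) p.1.
Proof.
have [s Hs] := finite_dual_basis [seq p.2 | p <- repr z]; exists s.
rewrite (tensor_sum z); move: (repr z) Hs => r Hr.
rewrite {1}big_seq; under eq_bigr => q qr.
  rewrite {1}(Hr q.2 (map_f _ qr)) tens_sumr.
  under eq_bigr do rewrite tensZr -tensZl -slice_r_tens.
  over.
rewrite -big_seq exchange_big; apply: eq_bigr => p _ /=.
by rewrite -tens_suml (linear_sum_fun _ _ (slice_r_linear _)).
Qed.

Lemma tensor_slices_l (z : tensor U V) :
  exists s : seq (U * {linear U -> K^o}),
    z = \sum_(p <- s) tens p.1 (slice_l p.2 z).
Proof.
have [s Hs] := finite_dual_basis [seq p.1 | p <- repr z]; exists s.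
rewrite (tensor_sum z); move: (repr z) Hs => r Hr.
rewrite {1}big_seq; under eq_bigr => q qr.
  rewrite {1}(Hr q.1 (map_f _ qr)) tens_suml.
  under eq_bigr do rewrite tensZl -tensZr -slice_l_tens.
  over.
rewrite -big_seq exchange_big; apply: eq_bigr => p _ /=.
by rewrite -tens_sumr (linear_sum_fun _ _ (slice_l_linear _)).
Qed.

Lemma slice_r_inj (z w : tensor U V) :
  (forall l : {linear V -> K^o}, slice_r l z = slice_r l w) -> z = w.
Proof.
move=> h; apply/eqP; rewrite -subr_eq0; apply/eqP.
have [s ->] := tensor_slices_r (z - w); apply: big1 => p _.
have := slice_r_linear p.2 (-1) w z; rewrite scaleN1r h scaleN1r addNr addrC => ->.
exact: tens0l.
Qed.

Lemma slice_l_inj (z w : tensor U V) :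
  (forall l : {linear U -> K^o}, slice_l l z = slice_l l w) -> z = w.
Proof.
move=> h; apply/eqP; rewrite -subr_eq0; apply/eqP.
have [s ->] := tensor_slices_l (z - w); apply: big1 => p _.
have := slice_l_linear p.2 (-1) w z; rewrite scaleN1r h scaleN1r addNr addrC => ->.
exact: tens0r.
Qed.

End TensorFunctionals.

Lemma slice_r_tmap (K : fieldType) (U U' V V' : lmodType K) (f : U -> U')
    (l : {linear V' -> K^o}) (g : V -> V') (l' : {linear V -> K^o}) z :
  linear f -> linear g -> (forall v, l (g v) = l' v) ->
  slice_r l (tmap f g z) = f (slice_r l' z).
Proof.
move=> lf lg e; move: z; apply: tensor_ext => [a x y|a x y|u v].
- by rewrite (tmap_linear lf lg) slice_r_linear.
- by rewrite slice_r_linear lf.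
- by rewrite tmap_tens // !slice_r_tens e (linearZf _ _ lf).
Qed.

(** * Comodules as modules over the dual of O(G) *)

Section Action.
Variables (F : fieldType) (G : hopf_superalgebra F).

(* The dual of O(G) acts on every comodule; working with these operators
   instead of the coaction turns representations into modules. *)
Definition act (K : fieldType) (iota : {rmorphism F -> K}) (V : rep G iota)
    (l : {linear G -> F^o}) (v : V) : V :=
  slice_r l (coact V v : tensor (res iota V) G).

(* The source and the target may live over different fields, so that semilinear
   maps are covered. *)
Definition equivariant (K K' : fieldType) (iK : {rmorphism F -> K})
    (iK' : {rmorphism F -> K'}) (V : rep G iK) (W : rep G iK') (d : bool)
    (f : V -> W) : Prop :=
  (forall j v, f (hpart (rep_gr V) j v) = hpart (rep_gr W) (d (+) j) (f v)) /\
  (forall l v, f (act l v) = act l (f v)).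

Lemma equivariant_comp (K1 K2 K3 : fieldType) (i1 : {rmorphism F -> K1})
    (i2 : {rmorphism F -> K2}) (i3 : {rmorphism F -> K3})
    (U : rep G i1) (V : rep G i2) (W : rep G i3) d e (f : V -> W) (g : U -> V) :
  equivariant d f -> equivariant e g -> equivariant (d (+) e) (f \o g).
Proof.
move=> [fh fa] [gh ga]; split=> [j v|l v] /=.
- by rewrite gh fh addbA.
- by rewrite ga fa.
Qed.

Section OneField.
Variables (K : fieldType) (iota : {rmorphism F -> K}).
Implicit Types V W : rep G iota.

Lemma slice_r_ltensor (M : lmodType K) (l : {linear G -> F^o}) (a : K)
    (z : ltensor iota M G) :
  slice_r l (a *: z : tensor (res iota M) G) = a *: (slice_r l z : M).
Proof.
move: z; apply: tensor_ext_add => [x y|x y|u v].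
- rewrite -[slice_r l _]/(slice_r l
    ((a *: ((x : ltensor iota M G) + y)) : tensor (res iota M) G)).
  by rewrite scalerDr (linearDf (slice_r_linear _)).
- by rewrite (linearDf (slice_r_linear _)) scalerDr.
- rewrite [X in slice_r l X]lscale_tens !slice_r_tens.
  by rewrite -(linearZf _ _ (@scale_res_linear _ _ iota M a)).
Qed.

Lemma act_linear V l : linear (act l : V -> V).
Proof.
move=> a x y; rewrite /act linearP (linearDf (slice_r_linear _)).
by rewrite slice_r_ltensor.
Qed.

Lemma slice_r_tmap_id V W (f : V -> W) (l : {linear G -> F^o}) z : linear f ->
  slice_r l (tmap (f : res iota V -> res iota W) (idfun : G -> G) z) = f (slice_r l z).
Proof.
by move=> lf; apply: slice_r_tmap => //; exact: (res_linear (phi := iota) lf).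
Qed.

(** Slices along functionals of O(G) separate tensors, so compatibility with the coactions can be
    tested on the operators [act l]. *)
Lemma rep_homP V W (f : V -> W) :
  rep_hom f <-> linear f /\ equivariant false f.
Proof.
split=> [[lf hf cf]|[lf [hf af]]].
  by split=> //; split=> // l v; rewrite /act cf slice_r_tmap_id.
split=> // v; apply: (slice_r_inj (U := res iota W)) => l.
by rewrite slice_r_tmap_id //; symmetry; apply: af.
Qed.

Lemma rep_hom_PiP V W (f : V -> W) :
  rep_hom (W := Pi_rep W) f <-> linear f /\ equivariant true f.
Proof. exact: rep_homP. Qed.

Definition stable V (U : V -> Prop) : Prop :=
  [/\ subspace U, forall i x, U x -> U (hpart (rep_gr V) i x)
    & forall l x, U x -> U (act l x)].

(** [tensor_slices_r] writes the coaction of x with left legs of the form [act l x], which lie in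
    U. *)
Lemma stable_subrep V (U : V -> Prop) : stable U -> subrep U.
Proof.
case=> [[U0 UL] Uh Ua]; split=> // x Ux.
have [s es] := tensor_slices_r (coact V x : tensor (res iota V) G).
exists [seq (act p.2 x, p.1) | p <- s]; first by rewrite big_map {1}es.
elim: {es} s => //= p s IH q.
by rewrite inE => /orP[/eqP->|/IH//]; exact: Ua.
Qed.

Definition simple_rep V : Prop :=
  (exists v : V, v <> 0) /\
  forall U : V -> Prop, stable U -> (forall v, U v -> v = 0) \/ (forall v, U v).

Lemma irrep_simple (V : irrep G iota) : simple_rep V.
Proof. by split=> [|U /stable_subrep/irr_min]; first exact: irr_neq0. Qed.

Lemma stable_ker V W (f : V -> W) d : linear f -> equivariant d f ->
  stable (fun v => f v = 0).
Proof.
move=> lf [fh fa]; split=> [|i x fx|l x fx].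
- by split=> [|a x y fx fy]; rewrite ?(linear0f lf) // lf fx fy scaler0 addr0.
- by rewrite fh fx linear0.
- by rewrite fa fx (linear0f (@act_linear _ _)).
Qed.

Lemma stable_image V W (f : V -> W) d : linear f -> equivariant d f ->
  stable (fun w => exists v, w = f v).
Proof.
move=> lf [fh fa]; split=> [|i x [v ->]|l x [v ->]].
- split=> [|a _ _ [x ->] [y ->]]; first by exists 0; rewrite (linear0f lf).
  by exists (a *: x + y); rewrite lf.
- by exists (hpart (rep_gr V) (d (+) i) v); rewrite fh addbA addbb addFb.
- by exists (act l v); rewrite fa.
Qed.

Lemma simple_injective V W (f : V -> W) d v0 : simple_rep V -> linear f ->
  equivariant d f -> f v0 <> 0 -> injective f.
Proof.
move=> [_ sV] lf ef nz; have [k0|/(_ v0)//] := sV _ (stable_ker lf ef).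
move=> x y e; apply/eqP; rewrite -subr_eq0; apply/eqP/k0.
by rewrite addrC -scaleN1r lf scaleN1r e addNr.
Qed.

Lemma equivariant_inv V W (f : V -> W) (g : W -> V) d : linear f ->
  equivariant d f -> cancel f g -> cancel g f -> linear g /\ equivariant d g.
Proof.
move=> lf [fh fa] fK gK; have fI := can_inj fK; split=> [a x y|].
  by apply: fI; rewrite lf !gK.
by split=> [j v|l v]; apply: fI; rewrite ?fh ?fa !gK // addbA addbb addFb.
Qed.

(** Schur's lemma for maps of either parity, kernel and image being stable. *)
Lemma simple_inverse V W (f : V -> W) d v0 : simple_rep V -> simple_rep W ->
  linear f -> equivariant d f -> f v0 <> 0 ->
  exists g, [/\ linear g, equivariant d g, cancel f g & cancel g f].
Proof.
move=> sV sW lf ef nz; have fI := simple_injective sV lf ef nz.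
have [im0|im] := sW.2 _ (stable_image lf ef).
  by case: nz; apply: im0; exists v0.
have [g gE] := choice im.
have gK : cancel g f by move=> w; rewrite -gE.
have fK : cancel f g by move=> v; apply: fI; rewrite gK.
by exists g; have [] := equivariant_inv lf ef fK gK.
Qed.

End OneField.

(** * Base change in terms of the dual action *)

Section BaseChangeAction.
Variables (K L : fieldType) (iK : {rmorphism F -> K}) (iL : {rmorphism F -> L}).
Variables (phi : {rmorphism K -> L}) (phiE : forall x, phi (iK x) = iL x).
Implicit Types V W : rep G iK.
Local Notation bc := (bchange phiE).

Lemma act_bincl V l x (v : V) :
  act l (bincl phi x v : bc V) = bincl phi x (act l v).
Proof.
rewrite /act [coact _ _](bcoact_tens phiE); move: (coact V v).
have lb := bincl_linear phiE (V := V) x.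
apply: tensor_ext_add => [y z|y z|w b].
- by rewrite (linearDf (tbincl_linear phiE _)) (linearDf (slice_r_linear _)).
- by rewrite (linearDf (slice_r_linear _)) (linearDf lb).
- by rewrite (tbincl_tens phiE) !slice_r_tens (linearZf _ _ lb).
Qed.

Lemma hpart_bincl V j x (v : V) :
  hpart (rep_gr (bc V)) j (bincl phi x v) = bincl phi x (hpart (rep_gr V) j v).
Proof. exact: bhpart_tens. Qed.

Lemma bincl_ext (M : zmodType) V (f g : bc V -> M) :
  {morph f : x y / x + y} -> {morph g : x y / x + y} ->
  (forall x v, f (bincl phi x v) = g (bincl phi x v)) -> f =1 g.
Proof. by move=> fD gD e; apply: (tensor_ext_add fD gD) => u v; apply: e. Qed.

Lemma scale_bunit V x (v : V) : bincl phi x v = x *: bunit phiE v.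
Proof. by rewrite [RHS]lscale_bincl mulr1. Qed.

Lemma bunitD V : {morph (bunit phiE : V -> bc V) : x y / x + y}.
Proof. by move=> x y; apply: binclDr. Qed.

Lemma bunitZ V a (v : V) : bunit phiE (a *: v) = phi a *: (bunit phiE v : bc V).
Proof. by rewrite -scale_bunit [LHS]binclZ mulr1. Qed.

Lemma bunit_equivariant V : equivariant false (bunit phiE : V -> bc V).
Proof. by split=> [j v|l v]; rewrite ?[RHS]hpart_bincl ?[RHS]act_bincl. Qed.

Lemma bchange_ext V (W : lmodType L) (f g : bc V -> W) : linear f -> linear g ->
  (forall v, f (bunit phiE v) = g (bunit phiE v)) -> f =1 g.
Proof.
move=> lf lg e; apply: bincl_ext; try exact: linearDf.
by move=> x v; rewrite scale_bunit !(linearZf _ _ _) // e.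
Qed.

Lemma bincl_inj V x (v w : V) : x != 0 -> bincl phi x v = bincl phi x w -> v = w.
Proof.
move=> x0 e; apply/eqP; rewrite -subr_eq0; apply: contra_eqT e => nz.
have [|l lvw] := @functional_exists K V (v - w); first exact/eqP.
apply/eqP => /(congr1 (slice_r (U := res phi L^o) l)).
rewrite !slice_r_tens => /eqP; rewrite -subr_eq0 -scalerBl.
have -> : (l v - l w)%R = 1 by rewrite -linearB.
by rewrite scale1r (negPf x0).
Qed.

Lemma bunit_inj V : injective (bunit phiE : V -> bc V).
Proof. by move=> v w; apply: bincl_inj; apply: oner_neq0. Qed.

Lemma bunit0 V : bunit phiE 0 = 0 :> bc V.
Proof. exact: (@tens0r K (res phi L^o) V). Qed.

(** A functional equal to 1 at w contracts the equation to [y = phi (l u)]. This is how scalars of L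
    are recognised as scalars of K. *)
Lemma bunit_scalar V (y : L) (u w : V) : w <> 0 ->
  y *: (bunit phiE w : bc V) = bunit phiE u -> exists a, y = phi a.
Proof.
move=> nz; rewrite -scale_bunit => e; have [l lw] := functional_exists nz.
exists (l u); have := congr1 (slice_r (U := res phi L^o) l) e.
rewrite !slice_r_tens lw scale1r => ->.
exact: mulr1.
Qed.

Lemma bchange_map_bincl V W (f : V -> W) x v : linear f ->
  bchange_map phiE f (bincl phi x v) = bincl phi x (f v).
Proof. by move=> lf; rewrite /bchange_map tmap_tens. Qed.

Lemma bchange_map_bunit V W (f : V -> W) v : linear f ->
  bchange_map phiE f (bunit phiE v) = bunit phiE (f v).
Proof. exact: bchange_map_bincl. Qed.

Lemma bchange_map_linear V W (f : V -> W) : linear f ->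
  linear (bchange_map phiE f : bc V -> bc W).
Proof. exact: ltmap_linear. Qed.

Lemma bchange_map_equivariant V W (f : V -> W) d : linear f ->
  equivariant d f -> equivariant d (bchange_map phiE f).
Proof.
move=> lf [fh fa]; have lb := bchange_map_linear lf.
have lh (X : rep G iK) j : linear (hpart (rep_gr (bc X)) j) by move=> a x y; apply: linearP.
have la (X : rep G iK) l : linear (act l : bc X -> bc X) by apply: act_linear.
split=> [j|l]; apply: bincl_ext => [x y|x y|x v].
- by rewrite (linearDf (lh _ _)) (linearDf lb).
- by rewrite (linearDf lb) (linearDf (lh _ _)).
- by rewrite hpart_bincl !bchange_map_bincl // hpart_bincl fh.
- by rewrite (linearDf (la _ _)) (linearDf lb).
- by rewrite (linearDf lb) (linearDf (la _ _)).
- by rewrite act_bincl !bchange_map_bincl // act_bincl fa.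
Qed.

End BaseChangeAction.
End Action.

(** * Finite Galois groups *)

Lemma rmorphism_ext (K L : pzRingType) (f g : {rmorphism K -> L}) : f =1 g -> f = g.
Proof.
case: f => f [[f1] [f2]]; case: g => g [[g1] [g2]] /= e.
have {}e : f = g by exact/funext.
subst g; by rewrite (Prop_irrelevance f1 g1) (Prop_irrelevance f2 g2).
Qed.

Lemma relaut_ext (F K : fieldType) (iota : {rmorphism F -> K}) (s t : relaut iota) :
  s =1 t -> s = t.
Proof.
case: s => s bs fs; case: t => t bt ft /= e.
have {}e : s = t by exact: rmorphism_ext.
subst t; by rewrite (Prop_irrelevance bs bt) (Prop_irrelevance fs ft).
Qed.

Section GaloisGroup.
Variables (F : fieldType) (L : splittingFieldType F).

Definition gal_fun (g : gal_of {:L}) : {rmorphism L -> L} :=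
  GRing.RMorphism.clone _ _ (fun_of_lfun (ahval (gal_repr g))) _.

Lemma gal_fun_bij (g : gal_of {:L}) : bijective (gal_fun g).
Proof.
by exists (gal_fun (g^-1)%g) => x; rewrite /= -galM ?memvf // (mulVg, mulgV) gal_id.
Qed.

Lemma gal_fun_fix (g : gal_of {:L}) (x : F) : gal_fun g (in_alg L x) = in_alg L x.
Proof. by rewrite /= linearZ /= rmorph1. Qed.

Definition gal_relaut (g : gal_of {:L}) : relaut (in_alg L) :=
  RelAut (gal_fun_bij g) (@gal_fun_fix g).

(** Galois elements compose from left to right and [ra_mul] from right to left, hence the swap. *)
Lemma gal_relautM (g h : gal_of {:L}) :
  gal_relaut (g * h)%g = ra_mul (gal_relaut h) (gal_relaut g).
Proof. by apply: relaut_ext => x /=; rewrite galM ?memvf. Qed.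

Lemma relaut_gal (s : relaut (in_alg L)) : exists g, s = gal_relaut g.
Proof.
have sl : linear (s : L -> L).
  by move=> a x y; rewrite rmorphD -mulr_algl rmorphM (ra_fix s) mulr_algl.
pose m := GRing.isLinear.Build F L L *:%R (s : L -> L) sl.
pose f : {linear L -> L} := HB.pack (s : L -> L) m.
have fE : linfun f =1 s by move=> x; rewrite lfunE.
have kf : kAut 1 {:L} (linfun f).
  rewrite kAutfE; apply/kHomP_tmp; split=> [x /vlineP[a ->]|x y _ _].
    by rewrite fE; apply: (ra_fix s).
  by rewrite !fE rmorphM.
have [g _ gE] := kAut_to_gal kf.
by exists g; apply: relaut_ext => x; rewrite -fE gE ?memvf.
Qed.

Lemma gal_fixed (x : L) : galois 1 {:L} ->
  (forall s : relaut (in_alg L), s x = x) -> exists a, x = in_alg L a.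
Proof.
move=> /galois_fixedField gL fx.
have : x \in (1%VS : {vspace L}); last by case/vlineP=> a ->; exists a.
rewrite -gL; apply/fixedFieldP => [|g _]; first exact: memvf.
exact: fx (gal_relaut g).
Qed.

(** A functional equal to 1 at one of the vectors reduces this to Dedekind's independence of
    characters. *)
Lemma gal_vector_independent (M : lmodType L) (w : gal_of {:L} -> M) :
  (forall a, \sum_g gal_relaut g a *: w g = 0) -> forall g, w g = 0.
Proof.
move=> h g; apply/eqP; apply: contraT => /eqP nz.
have [l lg] := functional_exists nz.
have /(_ _ g isT)/eqP := @gal_independent _ L {:L}%AS predT (fun g => l (w g)).
rewrite lg oner_eq0 => -> // a _.
transitivity (l (\sum_g gal_relaut g a *: w g)); last by rewrite h linear0.
by rewrite linear_sum; apply: eq_bigr => y _; rewrite linearZ mulrC.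
Qed.

End GaloisGroup.

(** * The fixed field of the absolute Galois group *)

(** Take p of least size among the nonzero polynomials vanishing at z: minimality gives
    irreducibility, and division with remainder gives [p %| q]. *)
Lemma irreducible_factor_at_root (E K : fieldType) (p1 : {rmorphism E -> K})
    (q : {poly E}) (z : K) : q != 0 -> root (map_poly p1 q) z ->
  exists p, [/\ irreducible_poly p, root (map_poly p1 p) z & p %| q].
Proof.
move=> q0 qz; pose P n := `[< exists2 p : {poly E}, p != 0 &
  root (map_poly p1 p) z /\ size p = n >].
have exP : exists n, P n by exists (size q); apply/asboolP; exists q.
case: (ex_minnP exP) => n /asboolP[p p0 [pz <-]] minp.
have {}minp r : r != 0 -> root (map_poly p1 r) z -> (size p <= size r)%N.
  by move=> r0 rz; apply: minp; apply/asboolP; exists r.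
exists p; split=> //; last first.
  rewrite /dvdp -[_ == 0]negbK; apply/negP => m0.
  have := ltn_modp q p; rewrite p0 ltnNge minp // .
  move: qz; rewrite {1}(divp_eq q p) rmorphD rmorphM /= rootE hornerD hornerM.
  by move: pz; rewrite rootE => /eqP ->; rewrite mulr0 add0r.
split=> [|r r1 /dvdpP[s e]].
  by have := root_size_gt1 _ pz; rewrite size_map_poly map_poly_eq0; apply.
have [s0 r0] : s != 0 /\ r != 0.
  by apply/andP; rewrite -negb_or -mulf_eq0 -e.
rewrite -dvdp_size_eqp ?e ?dvdp_mulIr // -e eqn_leq.
rewrite {1}e dvdp_leq ?dvdp_mull -?e //=.
move: pz; rewrite {1}e rmorphM /= rootM => /orP[/(minp _ s0)|]; last exact: minp.
rewrite {1}e size_mul // => lps; case/negP: r1.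
move: lps; have : (0 < size r)%N by rewrite size_poly_gt0.
case: (size r) => // -[|k] _ //.
by rewrite !addnS /= -[X in (_ <= X)%N]addn0 -addnS leq_add2l.
Qed.

Section PartialAutomorphisms.
Variables (F K : fieldType) (iota : {rmorphism F -> K}).

(* The graph of an isomorphism over F between two subfields of K. *)
Definition partial_aut (R : K * K -> Prop) : Prop :=
  [/\ forall a, R (iota a, iota a),
      forall u v, R u -> R v -> R (u - v),
      forall u v, R u -> R v -> R (u * v),
      forall u, R u -> u.1 <> 0 -> R (u.1^-1, u.2^-1)
    & forall u, R u -> u.1 = 0 <-> u.2 = 0].

Lemma partial_aut_sym R : partial_aut R -> partial_aut (fun u => R (u.2, u.1)).
Proof.
case=> Ri RB RM RV R0; split=> //=.
- by move=> u v Ru Rv; apply: (RB _ _ Ru Rv).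
- by move=> u v Ru Rv; apply: (RM _ _ Ru Rv).
- by move=> u Ru u1; apply: (RV _ Ru) => /= /(R0 _ Ru).
- by move=> u Ru; split => /(R0 _ Ru).
Qed.

(** The graph is made of the pairs (P(z), P(w)) for P in E[X], the coefficients being mapped by p1
    and by p2. Either p divides P and both values vanish, or a Bezout relation inverts P modulo p
    and hence both values at once. *)
Lemma partial_aut_adjoin (E : fieldType) (p1 p2 : {rmorphism E -> K})
    (iE : F -> E) (p : {poly E}) (z w : K) :
  (forall a, p1 (iE a) = iota a) -> (forall a, p2 (iE a) = iota a) ->
  irreducible_poly p -> root (map_poly p1 p) z -> root (map_poly p2 p) w ->
  exists R, [/\ partial_aut R, forall x, R (p1 x, p2 x) & R (z, w)].
Proof.
move=> i1 i2 irr_p pz pw.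
pose ev (P : {poly E}) := ((map_poly p1 P).[z], (map_poly p2 P).[w]).
exists (fun u => exists P, u = ev P).
have dvd0 P : p %| P -> ev P = (0, 0).
  case/dvdpP=> s ->; rewrite /ev !rmorphM /= !hornerM.
  by move: pz pw; rewrite !rootE => /eqP-> /eqP->; rewrite !mulr0.
have inv P : ~~ (p %| P) -> exists Q, ev (Q * P) = (1, 1).
  move=> npP; have : coprimep p P by rewrite irreducible_poly_coprime.
  case/Bezout_eq1_coprimepP=> [[u v] /= e]; exists v.
  have := dvd0 (u * p) (dvdp_mull _ (dvdpp _)).
  rewrite -[v * P](addKr (u * p)) e /ev !rmorphD !rmorphN /= !rmorph1 !hornerD !hornerN.
  by case=> -> ->; rewrite !hornerC oppr0 !add0r.
have ev0 P : (ev P).1 = 0 <-> (ev P).2 = 0.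
  have [/dvd0->//|/inv[Q]] := boolP (p %| P).
  rewrite /ev !rmorphM !hornerM => -[e1 e2] /=.
  split=> h.
    by move: e1; rewrite h mulr0 => /eqP; rewrite eq_sym oner_eq0.
  by move: e2; rewrite h mulr0 => /eqP; rewrite eq_sym oner_eq0.
split; first split.
- by move=> a; exists (iE a)%:P; rewrite /ev !map_polyC !hornerC /= i1 i2.
- move=> _ _ [P ->] [Q ->]; exists (P - Q).
  by rewrite /ev !rmorphB /= !hornerD !hornerN.
- by move=> _ _ [P ->] [Q ->]; exists (P * Q); rewrite /ev !rmorphM /= !hornerM.
- move=> _ [P ->] nz; have [/dvd0 e|/inv[Q]] := boolP (p %| P).
    by move: nz; rewrite e.
  rewrite /ev !rmorphM !hornerM => -[e1 e2]; exists Q.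
  have nz2 : (ev P).2 != 0 by apply/eqP => /ev0.
  have {}nz : (ev P).1 != 0 by apply/eqP.
  congr (_, _) => /=.
    by apply: (mulIf nz); rewrite mulVf // e1.
  by apply: (mulIf nz2); rewrite mulVf // e2.
- by move=> _ [P ->].
- by move=> x; exists x%:P; rewrite /ev !map_polyC !hornerC.
- by exists 'X; rewrite /ev !map_polyX !hornerX.
Qed.

Section SubfieldOfPairs.
Record bundled_partial_aut := BundledPartialAut {
  pa_rel :> K * K -> Prop; pa_prop : partial_aut pa_rel }.

Variable R : bundled_partial_aut.
Let RP := pa_prop R.

Definition pair_pred : {pred K * K} := fun u => `[< R u >].

Lemma pair_pred_closed : GRing.divring_closed pair_pred.
Proof.
case: RP => Ri RB RM RV R0; split=> [|x y|x y]; rewrite !unfold_in.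
- by apply/asboolP; have := Ri 1; rewrite rmorph1.
- by move=> /asboolP hx /asboolP hy; apply/asboolP/RB.
- move=> /asboolP hx /asboolP hy; apply/asboolP/RM => //.
  have [y1|/eqP y1] := eqVneq y.1 0; last first.
    have y2 : y.2 <> 0 by move/(R0 _ hy).
    have -> : y^-1 = (y.1^-1, y.2^-1); last exact: RV.
    apply: mulr1_eq; rewrite [y in y * _]surjective_pairing.
    by rewrite /GRing.mul /= /mul_pair /= !mulfV //; apply/eqP.
  (* A pair with zero first coordinate is no unit of the product ring, and the inverse of a non-unit
     is itself by convention. *)
  suff -> : y^-1 = y by [].
  apply: invr_out; apply/negP => /unitrP[v [/(congr1 fst)/= e _]].
  by move/eqP: e; rewrite y1 mulr0 eq_sym oner_eq0.
Qed.
HB.instance Definition _ := GRing.isDivringClosed.Build (K * K)%type pair_pred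
  pair_pred_closed.

(** The graph is a subring of the product ring in which both coordinates of a nonzero pair are
    nonzero, hence a field. Its two projections to K are the embeddings to which
    [partial_aut_adjoin] is applied. *)
Record pair_field : Type := PairField { pf_val :> K * K; _ : pf_val \in pair_pred }.
HB.instance Definition _ := [isSub for pf_val].
HB.instance Definition _ := [Choice of pair_field by <:].
HB.instance Definition _ := [SubChoice_isSubComUnitRing of pair_field by <:].

Lemma pair_fieldP (x : pair_field) : x != 0 -> x \is a GRing.unit.
Proof.
have /asboolP Rx : pf_val x \in pair_pred := valP x.
case: RP => Ri RB RM RV R0.
move=> nz; have x1 : (pf_val x).1 <> 0.
  move=> h; case/eqP: nz; apply: val_inj => /=.
  have h2 := (R0 _ Rx).1 h.
  by rewrite [pf_val x]surjective_pairing h h2.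
have px : ((pf_val x).1^-1, (pf_val x).2^-1) \in pair_pred by apply/asboolP/RV.
apply/unitrP; exists (PairField px).
have x2 : (pf_val x).2 <> 0 by move/(R0 _ Rx).
move/eqP: x1 => x1; move/eqP: x2 => x2.
by split; apply: val_inj; rewrite /= /GRing.mul /= /mul_pair /= ?mulVf ?mulfV.
Qed.
HB.instance Definition _ := GRing.ComUnitRing_isField.Build pair_field pair_fieldP.

End SubfieldOfPairs.

(** The minimal polynomial of z over the domain divides a separable polynomial over F; its transport
    to the target is therefore separable and has a root w, to which z may be sent. *)
Lemma partial_aut_extend R z : separable_closure iota -> partial_aut R ->
  exists R', [/\ partial_aut R', forall u, R u -> R' u & exists w, R' (z, w)].
Proof.
move=> [alg closed] RP; pose Rb := BundledPartialAut RP; pose E := pair_field Rb.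
pose p1 : {rmorphism E -> K} := [the {rmorphism (K * K)%type -> K} of fst] \o val.
pose p2 : {rmorphism E -> K} := [the {rmorphism (K * K)%type -> K} of snd] \o val.
have iP a : (iota a, iota a) \in pair_pred Rb.
  by apply/asboolP; have [h _ _ _ _] := RP; apply: h.
pose iE a : E := PairField (iP a).
have [q sq qz] := alg z.
have iE0 : iE 0 = 0 by apply: val_inj; rewrite /= rmorph0.
pose qE := map_poly iE q.
have q1 : map_poly p1 qE = map_poly iota q.
  by apply/polyP => i; rewrite !coef_map coef_map_id0.
have q2 : map_poly p2 qE = map_poly iota q.
  by apply/polyP => i; rewrite !coef_map coef_map_id0.
have qE0 : qE != 0.
  rewrite -(map_poly_eq0 p1) q1 map_poly_eq0; exact: separable_poly_neq0.
have [|p [irr_p pz pq]] := @irreducible_factor_at_root _ _ p1 _ z qE0.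
  by rewrite q1.
have [||w pw] := closed (map_poly p2 p); last first.
- have [R' [R'P R'R zw]] := @partial_aut_adjoin E p1 p2 iE p z w
    (fun a => erefl) (fun a => erefl) irr_p pz pw.
  exists R'; split=> //; last by exists w.
  case=> u v Ruv; have uP : (u, v) \in pair_pred Rb by apply/asboolP.
  exact: (R'R (PairField uP)).
- by rewrite size_map_poly; case: irr_p.
- apply: (@dvdp_separable _ (map_poly p2 qE)); first by rewrite dvdp_map.
  by rewrite q2 separable_map.
Qed.

(** A maximal extension of R0 is defined everywhere by [partial_aut_extend]. The inverse graph is
    again a partial automorphism, and extending it shows that the maximal one is onto. *)
Lemma partial_aut_relaut R0 : separable_closure iota -> partial_aut R0 ->
  exists s : relaut iota, forall u, R0 u -> s u.1 = u.2.
Proof.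
move=> cl R0P; pose U (X : K * K -> Prop) u := R0 u \/ X u.
have [|X [XP maxX]] := @classical_sets.Zorn_bigcup (K * K)%type
    (fun X => partial_aut (U X)).
  move=> C CP totC.
  have incl X : C X -> forall v, U X v -> U (classical_sets.bigcup C id) v.
    by move=> CX v [Hv|Xv]; [left | right; exists X].
  have [[X0 CX0]|nC] := pselect (exists X, C X); last first.
    suff -> : U (classical_sets.bigcup C id) = R0 by [].
    apply/funext => u; apply/propext; split; last by left.
    by case=> // -[X CX]; case: nC; exists X.
  have inC u : U (classical_sets.bigcup C id) u -> exists2 X, C X & U X u.
    by case=> [Ru|[X CX Xu]]; [exists X0 => //; left | exists X => //; right].
  have inC2 u v : U (classical_sets.bigcup C id) u ->
      U (classical_sets.bigcup C id) v -> exists X, [/\ C X, U X u & U X v].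
    move=> /inC[X CX Xu] /inC[Y CY Yv]; have [XY|YX] := totC _ _ CX CY.
      by exists Y; split=> //; case: Xu => [|/XY]; [left | right].
    by exists X; split=> //; case: Yv => [|/YX]; [left | right].
  split=> [a|u v Uu Uv|u v Uu Uv|u Uu|u Uu].
  - by left; case: R0P.
  - have [X [CX Xu Xv]] := inC2 _ _ Uu Uv; apply: (incl X CX).
    by case: (CP X CX) => _ h _ _ _; apply: h.
  - have [X [CX Xu Xv]] := inC2 _ _ Uu Uv; apply: (incl X CX).
    by case: (CP X CX) => _ _ h _ _; apply: h.
  - have [X CX Xu] := inC _ Uu; move=> nz; apply: (incl X CX).
    by case: (CP X CX) => _ _ _ h _; apply: h.
  - have [X CX Xu] := inC _ Uu.
    by case: (CP X CX) => _ _ _ _ h; apply: h.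
have max R' : partial_aut R' -> (forall u, U X u -> R' u) -> forall u, R' u -> U X u.
  move=> R'P XR' u R'u; apply: contrapT => nXu; apply: (maxX R').
    split=> [v Xv|R'X]; first by apply: XR'; right.
    by apply: nXu; right; apply: R'X.
  suff -> : U R' = R' by [].
  apply/funext => v; apply/propext; split; last by right.
  by case=> // Rv; apply: XR'; left.
have tot z : exists w, U X (z, w).
  have [R' [R'P XR' [w zw]]] := partial_aut_extend z cl XP.
  by exists w; apply: max zw.
have surj w : exists z, U X (z, w).
  have [R' [R'P XR' [z zw]]] := partial_aut_extend w cl (partial_aut_sym XP).
  exists z; apply: (max _ (partial_aut_sym R'P)) => //= -[u v] Xuv.
  exact: XR'.
case: XP => Xi XB XM XV X0.
have fn z w w' : U X (z, w) -> U X (z, w') -> w = w'.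
  move=> h h'; apply/eqP; rewrite -subr_eq0; apply/eqP.
  by apply: (X0 _ (XB _ _ h h')).1; rewrite /= subrr.
have fi z z' w : U X (z, w) -> U X (z', w) -> z = z'.
  move=> h h'; apply/eqP; rewrite -subr_eq0; apply/eqP.
  by apply: (X0 _ (XB _ _ h h')).2; rewrite /= subrr.
have [s sE] := choice tot; have [t tE] := choice surj.
have sB : zmod_morphism s.
  by move=> x y; apply: fn (sE _) _; apply: XB (sE _) (sE _).
have sM : monoid_morphism s.
  split; first by apply: fn (sE _) _; have := Xi 1; rewrite rmorph1.
  by move=> x y; apply: fn (sE _) _; apply: XM (sE _) (sE _).
pose mB := GRing.isZmodMorphism.Build K K s sB.
pose mM := GRing.isMonoidMorphism.Build K K s sM.
pose f : {rmorphism K -> K} := HB.pack s mB mM.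
have f_bij : bijective f.
  exists t => x; first exact: fi (tE _) (sE _).
  exact: fn (sE _) (tE _).
have f_fix x : f (iota x) = iota x by apply: fn (sE _) (Xi x).
by exists (RelAut f_bij f_fix) => -[u v] Ruv; apply: fn (sE _) _; left.
Qed.

(** If the minimal polynomial of x had degree above 1, separability would give it another root w,
    and the partial automorphism sending x to w would extend to one of K moving x. So the degree is
    1 and x is minus the quotient of the two coefficients. *)
Lemma relaut_fixed_field (x : K) : separable_closure iota ->
  (forall s : relaut iota, s x = x) -> exists a, x = iota a.
Proof.
move=> cl fx; have [q sq qx] := cl.1 x.
have [p [irr_p px pq]] := irreducible_factor_at_root (separable_poly_neq0 sq) qx.
have sp : separable_poly (map_poly iota p).
  by rewrite separable_map; apply: dvdp_separable sq.
have [r pr] := factor_theorem _ _ px.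
have p0 : map_poly iota p != 0 by apply: separable_poly_neq0.
have r0 : r != 0 by apply: contraNneq p0; rewrite pr => ->; rewrite mul0r.
have szp : size p = (size r).+1.
  by rewrite -(size_map_poly iota) pr size_Mmonic ?monicXsubC // size_XsubC addn2.
have [r1|r1] := ltnP 1 (size r).
  have [||w rw] := cl.2 r; [|by []|].
    by apply: dvdp_separable sp; rewrite pr dvdp_mulr.
  have pw : root (map_poly iota p) w by rewrite pr rootM rw.
  have [R [RP _ Rxw]] := @partial_aut_adjoin F iota iota id p x w
    (fun=> erefl) (fun=> erefl) irr_p px pw.
  have [s sE] := partial_aut_relaut cl RP.
  move: (sE _ Rxw); rewrite /= fx => xw.
  move: sp; rewrite pr separable_mul => /and3P[_ _].
  by rewrite coprimep_XsubC xw rw.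
have sz2 : size p = 2%N.
  apply/eqP; rewrite eqn_leq {1}szp ltnS r1 /=; by case: irr_p.
have lp : p`_1 != 0.
  have := lead_coef_eq0 p; rewrite lead_coefE sz2 /= => ->.
  by apply: contraNneq p0 => ->; rewrite rmorph0.
exists (- p`_0 / p`_1).
move: px; rewrite rootE (horner_coef_wide x (n := 2)); last by rewrite size_map_poly sz2.
rewrite big_ord_recl big_ord1 !coef_map /= expr0 mulr1 expr1 addrC addr_eq0 => /eqP e.
by rewrite fmorph_div rmorphN -e mulrC mulKf // fmorph_eq0.
Qed.

End PartialAutomorphisms.

(** * Galois descent *)

Section GaloisAction.
Variables (F : fieldType) (L : splittingFieldType F).
Implicit Types (M : lmodType F) (s t : relaut (in_alg L)).

Definition galact M s : ltensor (in_alg L) L^o M -> ltensor (in_alg L) L^o M :=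
  tmap (s : res (in_alg L) L^o -> res (in_alg L) L^o) (idfun : M -> M).

Lemma relaut_linear s :
  linear (s : res (in_alg L) L^o -> res (in_alg L) L^o).
Proof.
move=> a x y; rewrite [LHS]rmorphD; congr (_ + _).
by rewrite [LHS](rmorphM s (in_alg L a) x) ra_fix.
Qed.

Lemma galact_tens M s (x : res (in_alg L) L^o) (v : M) :
  galact s (tens x v) = tens (s x : res (in_alg L) L^o) v.
Proof. by rewrite /galact tmap_tens //; apply: relaut_linear. Qed.

Lemma galactD M s : {morph @galact M s : x y / x + y}.
Proof. by apply: (linearDf (tmap_linear (relaut_linear s) _)). Qed.

Lemma galact_semilinear M s (a : L) (x y : ltensor (in_alg L) L^o M) :
  galact s (a *: x + y) = s a *: galact s x + galact s y.
Proof.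
rewrite galactD; congr (_ + _); move: x.
apply: tensor_ext_add => [x z|x z|x v].
- by rewrite scalerDr galactD.
- by rewrite galactD scalerDr.
- rewrite [X in galact s X]lscale_tens !galact_tens [RHS]lscale_tens.
  by congr tens; apply: (rmorphM s).
Qed.

Lemma galact0 M s : galact s (0 : ltensor (in_alg L) L^o M) = 0.
Proof. by apply: (addrI (galact s 0)); rewrite -galactD !addr0. Qed.

Lemma galactZ M s (a : L) (x : ltensor (in_alg L) L^o M) :
  galact s (a *: x) = s a *: galact s x.
Proof. by rewrite -[a *: x]addr0 galact_semilinear galact0 addr0. Qed.

Lemma galact_sum M s (I : Type) (r : seq I) (f : I -> ltensor (in_alg L) L^o M) :
  galact s (\sum_(i <- r) f i) = \sum_(i <- r) galact s (f i).
Proof. exact: (big_morph _ (@galactD M s) (@galact0 M s)). Qed.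

Lemma galactM M s t (x : ltensor (in_alg L) L^o M) :
  galact s (galact t x) = galact (ra_mul s t) x.
Proof.
move: x; apply: tensor_ext_add => [x y|x y|x v].
- by rewrite !galactD.
- by rewrite galactD.
- by rewrite !galact_tens.
Qed.

Lemma galact1 M (x : ltensor (in_alg L) L^o M) : galact (gal_relaut 1%g) x = x.
Proof.
move: x; apply: tensor_ext_add => [x y|x y|x v].
- by rewrite galactD.
- by [].
- by rewrite galact_tens /= gal_id.
Qed.

Lemma slice_r_galact M s (l : {linear M -> F^o}) (x : ltensor (in_alg L) L^o M) :
  slice_r l (galact s x) = s (slice_r l x) :> L.
Proof. exact: (slice_r_tmap x (relaut_linear s) (@idfun_linear F M) (l' := l)). Qed.

(** Slices of x along functionals of M are fixed elements of L, hence lie in F, and they rebuild x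
    by [tensor_slices_r]. *)
Lemma galact_fixed M (x : ltensor (in_alg L) L^o M) : galois 1 {:L} ->
  (forall s, galact s x = x) -> exists v, x = tens (1 : res (in_alg L) L^o) v.
Proof.
move=> gL fx; have [r] := tensor_slices_r (x : tensor (res (in_alg L) L^o) M).
have fs (l : {linear M -> F^o}) : exists a, slice_r l x = in_alg L a :> L.
  by apply: gal_fixed => // s; rewrite -slice_r_galact fx.
have [c cE] := choice fs => e.
exists (\sum_(p <- r) c p.2 *: p.1); rewrite {1}e tens_sumr.
apply: eq_bigr => p _; rewrite tensZr -tensZl cE; congr tens; symmetry; exact: mulr1.
Qed.

(** The trace of [a *: x0] is fixed and stays in U; by independence of characters it is nonzero for
    some a. *)
Lemma galois_stable_fixed M (U : ltensor (in_alg L) L^o M -> Prop) x0 :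
  galois 1 {:L} -> subspace U -> (forall s x, U x -> U (galact s x)) ->
  U x0 -> x0 <> 0 ->
  exists2 v, v <> 0 & U (tens (1 : res (in_alg L) L^o) v).
Proof.
move=> gL sU gU Ux0 nz.
pose y a := \sum_g galact (gal_relaut g) (a *: x0).
have [a ya] : exists a, y a <> 0.
  apply: contrapT => h; apply: nz; rewrite -(galact1 x0).
  apply: (gal_vector_independent (w := fun g => galact (gal_relaut g) x0)) => a.
  transitivity (y a); last by apply: contrapT => ?; apply: h; exists a.
  by apply: eq_bigr => g _; rewrite galactZ.
have [s|v yv] := @galact_fixed M (y a) gL.
  have [g ->] := relaut_gal s; rewrite galact_sum.
  rewrite [RHS](reindex_inj (mulIg g)); apply: eq_bigr => h _.
  by rewrite galactM gal_relautM.
exists v; last first.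
  rewrite -yv; apply: subspace_sum => // g _ _.
  by apply: gU; apply: subspaceZ.
by move=> v0; apply: ya; rewrite yv v0 tens0r.
Qed.
End GaloisAction.

(** * The isotypic decomposition of L (x) V_F *)

Lemma equivariant_cancel (F : fieldType) (G : hopf_superalgebra F) (K K' : fieldType)
    (i : {rmorphism F -> K}) (i' : {rmorphism F -> K'}) (V : rep G i) (W : rep G i')
    (f : V -> W) g d :
  equivariant d f -> cancel f g -> cancel g f -> equivariant d g.
Proof.
move=> [fh fa] fK gK; have fI := can_inj fK.
by split=> [j v|l v]; apply: fI; rewrite ?fh ?fa !gK // addbA addbb addFb.
Qed.

Lemma additive0 (U V : zmodType) (f : U -> V) : {morph f : x y / x + y} -> f 0 = 0.
Proof. by move=> fD; apply: (addrI (f 0)); rewrite -fD !addr0. Qed.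

Lemma additive_sum (U V : zmodType) (f : U -> V) (I : Type) (r : seq I) (P : pred I)
    (E : I -> U) : {morph f : x y / x + y} ->
  f (\sum_(i <- r | P i) E i) = \sum_(i <- r | P i) f (E i).
Proof. by move=> fD; apply: (big_morph f fD (additive0 fD)). Qed.

Section Isotypic.
Variables (F : fieldType) (G : hopf_superalgebra F) (K : fieldType).
Variables (iota : {rmorphism F -> K}) (V W : rep G iota).

Definition rep_morph (m : V -> W) := linear m /\ equivariant false m.

Definition generating n (m : 'I_n -> V -> W) : Prop :=
  forall w, exists v : 'I_n -> V, w = \sum_i m i (v i).

(* In a generating family of least size the images of V are independent. *)
Lemma isotypic_decomposition n0 (m0 : 'I_n0 -> V -> W) : simple_rep V ->
  (forall i, rep_morph (m0 i)) -> generating m0 ->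
  exists n (m : 'I_n -> V -> W) (p : 'I_n -> W -> V),
    [/\ forall i, rep_morph (m i),
        forall i, linear (p i) /\ equivariant false (p i),
        forall i j v, p i (m j v) = if i == j then v else 0
      & forall w, \sum_i m i (p i w) = w].
Proof.
move=> sV m0M m0G.
pose P n := `[< exists2 m : 'I_n -> V -> W, forall i, rep_morph (m i) & generating m >].
have exP : exists n, P n by exists n0; apply/asboolP; exists m0.
case: (ex_minnP exP) => n /asboolP[m mM mG] minn {n0 m0 m0M m0G exP}.
have ml i := (mM i).1.
have free v : \sum_i m i (v i) = 0 -> forall i, v i = 0.
  move=> v0 i0; apply: contrapT => nz.
  (* The i0-th coordinates of linear relations form a stable subset. If it is all of V, every value
     of [m i0] can be rewritten through the other maps, against the minimality of n. *)
  pose U x := exists u : 'I_n -> V, u i0 = x /\ \sum_i m i (u i) = 0.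
  have stU : stable U.
    split=> [|j x [u [<- u0]]|l x [u [<- u0]]].
    - split=> [|a _ _ [u [<- u0]] [u' [<- u'0]]].
        by exists (fun=> 0); split=> //; apply: big1 => i _; rewrite (linear0f (ml i)).
      exists (fun i => a *: u i + u' i); split=> //.
      under eq_bigr do rewrite ml.
      by rewrite big_split /= -scaler_sumr u0 u'0 scaler0 addr0.
    - exists (fun i => hpart (rep_gr V) j (u i)); split=> //.
      by under eq_bigr do rewrite (mM _).2.1; rewrite -linear_sum u0 linear0.
    - exists (fun i => act l (u i)); split=> //.
      under eq_bigr do rewrite (mM _).2.2.
      have al := @act_linear _ _ _ _ W l.
      by rewrite -(linear_sum_fun _ _ al) u0 (linear0f al).
  have [U0|Uall] := sV.2 U stU; first by apply: nz; apply: U0; exists v.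
  case: n => [|n] in m mM mG minn ml v v0 i0 nz U stU Uall *; first by case: i0 nz U stU Uall.
  suff /minn : P n by rewrite ltnn.
  apply/asboolP; exists (fun i => m (lift i0 i)) => [i|w]; first exact: mM.
  have [u ->] := mG w; have [u' [e u'0]] := Uall (u i0).
  exists (fun i => u (lift i0 i) - u' (lift i0 i)).
  transitivity (\sum_i (m i (u i) - m i (u' i))); first by rewrite sumrB u'0 subr0.
  rewrite (bigD1_ord i0) //= e subrr add0r.
  by apply: eq_bigr => i _; rewrite addrC -scaleN1r -ml scaleN1r addrC.
have [p pE] := choice mG.
have uniq w v : w = \sum_i m i (v i) -> forall i, v i = p w i.
  move=> e i; apply/eqP; rewrite -subr_eq0; apply/eqP.
  apply: (free (fun i => v i - p w i)).
  transitivity (\sum_i (m i (v i) - m i (p w i))).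
    by apply: eq_bigr => j _; rewrite addrC -scaleN1r (ml j) scaleN1r addrC.
  by rewrite sumrB -e -pE subrr.
exists n, m, (fun i w => p w i); split=> // [i|i j v].
  split=> [a x y|].
    symmetry; apply: (uniq _ (fun i => a *: p x i + p y i)).
    under eq_bigr do rewrite ml.
    by rewrite big_split /= -scaler_sumr -!pE.
  split=> [j w|l w]; symmetry.
    apply: (uniq _ (fun i => hpart (rep_gr V) (false (+) j) (p w i))).
    by under eq_bigr do rewrite (mM _).2.1; rewrite -linear_sum -pE.
  apply: (uniq _ (fun i => act l (p w i))).
  under eq_bigr do rewrite (mM _).2.2.
  by rewrite -(linear_sum_fun _ _ (@act_linear _ _ _ _ W l)) -pE.
symmetry; apply: (uniq _ (fun i => if i == j then v else 0)).
rewrite (bigD1 j) //= eqxx big1 ?addr0 // => k /negPf->.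
by rewrite (linear0f (ml k)).
Qed.
End Isotypic.

(** * Galois conjugates of a morphism into L (x) V_F *)

Section ExtendedIrrep.
Variables (F : fieldType) (G : hopf_superalgebra F) (VF : base_irrep G).
Variables (L : splittingFieldType F).

Definition ext_compat (x : F) : in_alg L ((idfun : {rmorphism F -> F}) x) = in_alg L x :=
  erefl.

Definition ext_irrep : rep G (in_alg L) := bchange ext_compat VF.
Local Notation W := ext_irrep.

Lemma galact_equivariant (s : relaut (in_alg L)) :
  equivariant false (galact s : W -> W).
Proof.
split=> [j|l]; apply: bincl_ext => [x y|x y|x v].
- by rewrite linearD galactD.
- by rewrite galactD linearD.
- by rewrite hpart_bincl !galact_tens [RHS]hpart_bincl.
- by rewrite (linearDf (@act_linear _ _ _ _ W l)) galactD.
- by rewrite galactD (linearDf (@act_linear _ _ _ _ W l)).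
- by rewrite act_bincl !galact_tens [RHS]act_bincl.
Qed.

(** W is irreducible once the Galois action is part of the structure: U contains some nonzero 1 (x)
    v, and the v with 1 (x) v in U form a stable subset of the irreducible V_F. *)
Lemma ext_irrep_galois_simple (U : W -> Prop) x0 : galois 1 {:L} -> stable U ->
  (forall s x, U x -> U (galact s x)) -> U x0 -> x0 <> 0 -> forall x, U x.
Proof.
move=> gL [sU Uh Ua] gU Ux0 nz.
have [v v0 Uv] := galois_stable_fixed gL sU gU Ux0 nz.
pose b : VF -> W := bunit ext_compat.
have [|U0|Uall] := (irrep_simple VF).2 (fun v => U (b v)).
- split=> [|i x Ux|l x Ux].
  + split=> [|a x y Ux Uy]; first by rewrite /b bunit0; exact: sU.1.
    by rewrite /b bunitD bunitZ; apply: sU.2.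
  + by rewrite /b (bunit_equivariant _ _).1; apply: Uh.
  + by rewrite /b (bunit_equivariant _ _).2; apply: Ua.
- by case: v0; apply: U0.
move=> x; rewrite (tensor_sum x).
apply: (@subspace_sum L W U _ _ _ _ sU) => -[a u] _ _ /=.
by rewrite -[tens _ _]/(bincl _ _ _) (scale_bunit ext_compat); apply: subspaceZ.
Qed.

Lemma ext_irrep_isotypic (V : rep G (in_alg L)) (phi : relaut (in_alg L) -> V -> V)
    (m0 : V -> W) v0 : galois 1 {:L} -> simple_rep V ->
  (forall s a x y, phi s (a *: x + y) = s a *: phi s x + phi s y) ->
  (forall s, equivariant false (phi s)) -> (forall s, bijective (phi s)) ->
  rep_morph m0 -> m0 v0 <> 0 ->
  exists n (m : 'I_n -> V -> W) (p : 'I_n -> W -> V),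
    [/\ forall i, rep_morph (m i),
        forall i, linear (p i) /\ equivariant false (p i),
        forall i j v, p i (m j v) = if i == j then v else 0
      & forall w, \sum_i m i (p i w) = w].
Proof.
move=> gL sV phiL phiE phiB [m0l m0e] nz.
have inv s : exists g, cancel (phi s) g /\ cancel g (phi s).
  by case: (phiB s) => g ? ?; exists g.
have [psi psiP] := choice inv.
have phiK s := (psiP s).1; have psiK s := (psiP s).2.
(* Both [galact s] and [phi s] are s-semilinear, so the conjugate is linear over L. *)
pose r s : V -> W := galact s \o (m0 \o psi s).
have rM s : rep_morph (r s).
  split; last first.
    apply: (equivariant_comp (d := false) (e := false)).
      exact: galact_equivariant.
    apply: (equivariant_comp (d := false) (e := false)) => //.
    exact: equivariant_cancel (phiE s) (phiK s) (psiK s).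
  move=> a x y; have [t tK Kt] := ra_bij s.
  have -> : a *: x + y = phi s (t a *: psi s x + psi s y) by rewrite phiL Kt !psiK.
  by rewrite /r /= phiK m0l galact_semilinear Kt.
(* The Galois action carries the image of [r t] into that of [r (ra_mul s t)], so the sum of all
   images is stable. *)
have galr s t v : galact s (r t v) = r (ra_mul s t) (phi (ra_mul s t) (psi t v)).
  by rewrite /r /= phiK galactM.
pose m (i : 'I_#|{: gal_of {:L}}|) := r (gal_relaut (enum_val i)).
apply: (isotypic_decomposition (m0 := m)) => [//|i|]; first exact: rM.
pose U w := exists v : gal_of {:L} -> V, w = \sum_g r (gal_relaut g) (v g).
have rl g := (rM (gal_relaut g)).1.
suff Uall w : U w.
  move=> w; have [v ->] := Uall w; exists (fun i => v (enum_val i)).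
  have eb := @enum_val_bij (gal_of {:L}).
  by rewrite (reindex _ (onW_bij _ eb)).
apply: (ext_irrep_galois_simple (x0 := r (gal_relaut 1%g) (phi (gal_relaut 1%g) v0))) => //.
- split=> [|j x [v ->]|l x [v ->]].
  + split=> [|a _ _ [x ->] [y ->]].
      by exists (fun=> 0); rewrite big1 // => g _; rewrite (linear0f (rl g)).
    exists (fun g => a *: x g + y g); rewrite scaler_sumr -big_split.
    by apply: eq_bigr => g _; rewrite rl.
  + exists (fun g => hpart (rep_gr V) j (v g)); rewrite linear_sum.
    by apply: eq_bigr => g _; rewrite (rM _).2.1.
  + exists (fun g => act l (v g)).
    rewrite (linear_sum_fun _ _ (@act_linear _ _ _ _ W l)).
    by apply: eq_bigr => g _; rewrite (rM _).2.2.
- move=> s x [v ->]; have [h ->] := relaut_gal s.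
  exists (fun g => phi (gal_relaut g) (psi (gal_relaut (g * h^-1)%g) (v (g * h^-1)%g))).
  rewrite galact_sum (reindex_inj (mulIg (h^-1)%g)); apply: eq_bigr => g _.
  by rewrite galr -gal_relautM mulgVK.
- exists (fun g : gal_of {:L} => if g == 1%g then phi (gal_relaut 1%g) v0 else 0).
  rewrite (bigD1 (1%g : gal_of {:L})) //= eqxx [X in _ + X]big1 ?addr0 // => g /negPf->.
  by rewrite (linear0f (rl g)).
- by rewrite /r /= phiK galact1.
Qed.

End ExtendedIrrep.

(** * Endomorphisms of V_F after extension of scalars *)

Section SliceEquivariance.
Variables (F : fieldType) (G : hopf_superalgebra F) (K L : fieldType).
Variables (iK : {rmorphism F -> K}) (iL : {rmorphism F -> L}).
Variables (phi : {rmorphism K -> L}) (phiE : forall x, phi (iK x) = iL x).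
Variables (V : rep G iK) (mu : {linear res phi L^o -> K^o}).

(** The coaction touches only the factor V, so contracting the scalars is a morphism. It brings maps
    defined over L back to K. *)
Lemma slice_l_equivariant :
  equivariant false (slice_l mu : bchange phiE V -> V).
Proof.
have sD := linearDf (slice_l_linear mu (V := V)).
split=> [j|l]; apply: bincl_ext => [x y|x y|x v].
- by rewrite linearD sD.
- by rewrite sD linearD.
- by rewrite hpart_bincl /bincl !slice_l_tens linearZ.
- by rewrite (linearDf (@act_linear _ _ _ _ _ l)) sD.
- by rewrite sD (linearDf (@act_linear _ _ _ _ _ l)).
- by rewrite act_bincl /bincl !slice_l_tens (linearZf _ _ (@act_linear _ _ _ _ _ l)).
Qed.

End SliceEquivariance.

Section TensorMul.
Variables (F : fieldType) (L : splittingFieldType F) (A : algType F).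
Local Notation T := (tensor (res (in_alg L) L^o) A).
Implicit Types (x y : L) (a b : A) (z w : T).

Lemma res_mulr_linear x :
  linear (fun y : res (in_alg L) L^o => (y : L) * x : res (in_alg L) L^o).
Proof. by move=> c y y'; rewrite [LHS]mulrDl; congr (_ + _); exact: esym (mulrA _ _ _). Qed.

Lemma res_mull_linear x :
  linear (fun y : res (in_alg L) L^o => x * (y : L) : res (in_alg L) L^o).
Proof. by move=> c y y'; rewrite [LHS]mulrDr; congr (_ + _); exact: mulrCA. Qed.

Lemma tensor_mul_bilinear_inner x a : bilinear_for *:%R *:%R
  (fun (y : res (in_alg L) L^o) (b : A) =>
    tens ((x : L) * (y : L) : res (in_alg L) L^o) (a * b) : T).
Proof.
split=> [b|y] c u v /=.
- by rewrite (res_mull_linear x c u v) tensDl tensZl.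
- by rewrite mulrDr -scalerAr tensDr tensZr.
Qed.

Lemma tensor_mul_bilinear w : bilinear_for *:%R *:%R
  (fun (x : res (in_alg L) L^o) (a : A) =>
    tlift (fun (y : res (in_alg L) L^o) (b : A) =>
      tens ((x : L) * (y : L) : res (in_alg L) L^o) (a * b) : T) w).
Proof.
split=> [a|x] c u v /=.
- rewrite /tlift /tsum scaler_sumr -big_split; apply: eq_bigr => q _ /=.
  by rewrite (res_mulr_linear q.1 c u v) tensDl tensZl.
- rewrite /tlift /tsum scaler_sumr -big_split; apply: eq_bigr => q _ /=.
  by rewrite mulrDl -scalerAl tensDr tensZr.
Qed.

Lemma tensor_mul_tens x y a b :
  tensor_mul (tens (x : res (in_alg L) L^o) a) (tens (y : res (in_alg L) L^o) b)
  = tens (x * y : res (in_alg L) L^o) (a * b).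
Proof.
rewrite /tensor_mul tlift_tens; last exact: tensor_mul_bilinear.
by rewrite tlift_tens //; apply: tensor_mul_bilinear_inner.
Qed.

Lemma tensor_mulDl w : {morph (fun z => tensor_mul z w : T) : z z' / z + z'}.
Proof. exact: linearDf (tlift_linear (tensor_mul_bilinear w)). Qed.

Lemma tensor_mulDr z : {morph (fun w => tensor_mul z w : T) : w w' / w + w'}.
Proof.
move=> w w'; rewrite /tensor_mul {1 2 3}/tlift /tsum -big_split.
apply: eq_bigr => q _ /=.
exact: linearDf (tlift_linear (tensor_mul_bilinear_inner q.1 q.2)) _ _.
Qed.

End TensorMul.

Lemma scalar_cancel (K : fieldType) (M : lmodType K) (a b : K) (v : M) :
  v <> 0 -> a *: v = b *: v -> a = b.
Proof.
move=> /eqP/negPf v0 /eqP; rewrite -subr_eq0 -scalerBl scaler_eq0 v0 orbF subr_eq0.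
by move/eqP.
Qed.

(** A longest family with free image in X spans: the image of a further vector must depend on it,
    and k is injective. *)
Lemma injective_fin_dim (F : fieldType) (A : algType F) (X : vectType F) (k : A -> X) :
  linear k -> (forall x y, k x = k y -> x = y) -> fin_dim A.
Proof.
move=> kl kI; pose P d := `[< exists2 e : seq A, size e = d & free (map k e) >].
have exP : exists d, P d by exists 0; apply/asboolP; exists [::]; rewrite ?nil_free.
have bP d : P d -> (d <= \dim {:X})%N.
  by case/asboolP=> e <-; rewrite /free size_map => /eqP <-; rewrite dimvS ?subvf.
case: (ex_maxnP exP bP) => d /asboolP[e ed fe] maxd; exists e => x.
have : k x \in <<map k e>>%VS.
  apply: contraT => nx; suff /maxd : P d.+1 by rewrite ltnn.
  by apply/asboolP; exists (x :: e); rewrite /= ?ed // free_cons nx.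
have sz : size (map k e) == size e by rewrite size_map.
move=> /(coord_span (X := Tuple sz)) kx.
exists (fun j => if insub j is Some i then coord (Tuple sz) i (k x) else 0).
apply: kI; rewrite {1}kx (linear_sum_fun _ _ kl); apply: eq_bigr => i _.
by rewrite (linearZf _ _ kl) valK (nth_map 0).
Qed.

Section EndomorphismAlgebra.
Variables (F : fieldType) (G : hopf_superalgebra F) (VF : base_irrep G).
Variables (L : splittingFieldType F) (gL : galois 1 {:L}).
Local Notation W := (ext_irrep VF L).
Local Notation Gamma := (relaut (in_alg L)).

Variables (V : rep G (in_alg L)) (sV : simple_rep V).
Hypothesis EndV : forall f : V -> V, linear f -> equivariant false f ->
  exists a, forall v, f v = a *: v.
Variable phi : Gamma -> V -> V.
Hypothesis phiL : forall s a x y, phi s (a *: x + y) = s a *: phi s x + phi s y.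
Hypothesis phiE : forall s, equivariant false (phi s).
Hypothesis phiB : forall s, bijective (phi s).
Variable c : Gamma -> Gamma -> L.
Hypothesis phiM : forall s t v, phi s (phi t v) = c s t *: phi (ra_mul s t) v.

Variables (n : nat) (m : 'I_n -> V -> W) (p : 'I_n -> W -> V).
Hypothesis mM : forall i, rep_morph (m i).
Hypothesis pM : forall i, linear (p i) /\ equivariant false (p i).
Hypothesis pm : forall i j v, p i (m j v) = if i == j then v else 0.
Hypothesis mp : forall w, \sum_i m i (p i w) = w.

Lemma semilinearD s : {morph phi s : x y / x + y}.
Proof. by move=> x y; rewrite -[x]scale1r phiL rmorph1 !scale1r. Qed.

Lemma semilinearZ s a x : phi s (a *: x) = s a *: phi s x.
Proof. by rewrite -[a *: x]addr0 phiL (additive0 (@semilinearD s)) addr0. Qed.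

(** In the coordinates of W = V^n this applies s to each coordinate and then the matrix X. The map s
    need not be linear: s = id gives the endomorphisms of W, s = [phi s] the Galois action, s = S
    the diagonal odd map. *)
Definition blockmap (s : V -> V) (X : 'M[L]_n) (w : W) : W :=
  \sum_i \sum_j X i j *: m i (s (p j w)).

Lemma p_blockmap s X i w : p i (blockmap s X w) = \sum_j X i j *: s (p j w).
Proof.
have pl k := (pM k).1; rewrite /blockmap (linear_sum_fun _ _ (pl i)) (bigD1 i) //=.
rewrite [X in _ + X]big1 ?addr0 => [|k /negPf ki].
  rewrite (linear_sum_fun _ _ (pl i)); apply: eq_bigr => j _.
  by rewrite (linearZf _ _ (pl i)) pm eqxx.
rewrite (linear_sum_fun _ _ (pl i)) big1 // => j _.
by rewrite (linearZf _ _ (pl i)) pm eq_sym ki scaler0.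
Qed.

Lemma p_inj w w' : (forall i, p i w = p i w') -> w = w'.
Proof. by move=> e; rewrite -(mp w) -(mp w'); under eq_bigr do rewrite e. Qed.

Lemma blockmap_entry s X i j v : s 0 = 0 ->
  p i (blockmap s X (m j v)) = X i j *: s v.
Proof.
move=> s0; rewrite p_blockmap (bigD1 j) //= pm eqxx big1 ?addr0 // => k /negPf kj.
by rewrite pm kj s0 scaler0.
Qed.

Lemma blockmap_inj s X Y : s 0 = 0 -> injective s ->
  blockmap s X =1 blockmap s Y -> X = Y.
Proof.
move=> s0 sI e; apply/matrixP => i j; have [v v0] := sV.1.
have := congr1 (p i) (e (m j v)); rewrite !blockmap_entry //.
by apply: scalar_cancel; rewrite -s0 => /sI.
Qed.

(** Moving a matrix past an s-semilinear map applies s to its entries; this is the source of the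
    twisted product g_s s(g_t). *)
Lemma blockmap_comp (s : Gamma) (f g h : V -> V) X Y w :
  (forall a x y, f (a *: x + y) = s a *: f x + f y) ->
  (forall v, f (g v) = h v) ->
  blockmap f X (blockmap g Y w) = blockmap h (X *m map_mx s Y) w.
Proof.
move=> fl fg; apply: p_inj => i; rewrite !p_blockmap.
have fD : {morph f : x y / x + y}.
  by move=> x y; rewrite -[x]scale1r fl rmorph1 !scale1r.
have fZ a x : f (a *: x) = s a *: f x.
  by rewrite -[a *: x]addr0 fl (additive0 fD) addr0.
under eq_bigr => j _.
  rewrite p_blockmap (additive_sum _ _ _ fD) scaler_sumr.
  under eq_bigr => k _ do rewrite fZ fg scalerA.
  over.
rewrite exchange_big; apply: eq_bigr => k _ /=.
by rewrite -scaler_suml mxE; under [in RHS]eq_bigr do rewrite mxE.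
Qed.


Lemma blockmap_linear_comp f h X Y w : linear f ->
  blockmap f X (blockmap h Y w) = blockmap (f \o h) (X *m Y) w.
Proof.
(* A linear map is semilinear for the identity, which is [gal_relaut 1] here. *)
move=> fl; have idl a x y : f (a *: x + y) = gal_relaut (1%g : gal_of {:L}) a *: f x + f y.
  by rewrite fl /= gal_id.
rewrite (blockmap_comp _ _ _ idl (h := f \o h)) //; congr (blockmap _ (_ *m _) _).
by apply/matrixP => i j; rewrite mxE /= gal_id.
Qed.

Lemma blockmap_id_comp h X Y w : blockmap id X (blockmap h Y w) = blockmap h (X *m Y) w.
Proof. exact: blockmap_linear_comp. Qed.

Lemma blockmap_linear f X : linear f -> linear (blockmap f X).
Proof.
move=> fl a x y; rewrite /blockmap scaler_sumr -big_split; apply: eq_bigr => i _ /=.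
rewrite scaler_sumr -big_split; apply: eq_bigr => j _ /=.
by rewrite (pM j).1 fl (mM i).1 scalerDr !scalerA mulrC.
Qed.

Lemma blockmap_equivariant f X d : equivariant d f -> equivariant d (blockmap f X).
Proof.
move=> [fh fa]; split=> [k v|l v]; rewrite /blockmap.
- rewrite linear_sum; apply: eq_bigr => i _; rewrite linear_sum.
  by apply: eq_bigr => j _; rewrite linearZ (pM j).2.1 fh (mM i).2.1.
- have al := @act_linear _ _ _ _ W l.
  rewrite (linear_sum_fun _ _ al); apply: eq_bigr => i _.
  rewrite (linear_sum_fun _ _ al); apply: eq_bigr => j _.
  by rewrite (linearZf _ _ al) (pM j).2.2 fa (mM i).2.2.
Qed.

Lemma endmap_linear X : linear (blockmap id X).
Proof. exact: blockmap_linear. Qed.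

Lemma endmap_equivariant X : equivariant false (blockmap id X).
Proof. exact: blockmap_equivariant. Qed.

Lemma blockmap1 w : blockmap id 1%:M w = w.
Proof.
apply: p_inj => i; rewrite p_blockmap (bigD1 i) //= mxE eqxx scale1r.
by rewrite big1 ?addr0 // => j /negPf ji; rewrite mxE eq_sym ji scale0r.
Qed.

Lemma blockmap_exists (e : W -> W) (s : V -> V) : {morph e : x y / x + y} ->
  (forall i j, exists a, forall v, p i (e (m j v)) = a *: s v) ->
  exists X, forall w, e w = blockmap s X w.
Proof.
move=> eD h; have h2 i : exists f : 'I_n -> L, forall j v, p i (e (m j v)) = f j *: s v.
  by have [f fE] := choice (h i); exists f.
have [X XE] := choice h2.
exists (\matrix_(i, j) X i j) => w; apply: p_inj => i; rewrite p_blockmap.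
rewrite -{1}(mp w) (additive_sum _ _ _ eD) (additive_sum _ _ _ (linearDf (pM i).1)).
by apply: eq_bigr => j _; rewrite XE mxE.
Qed.

Lemma blockmap_End (e : W -> W) : linear e -> equivariant false e ->
  exists X, forall w, e w = blockmap id X w.
Proof.
move=> el ee; apply: blockmap_exists => [|i j]; first exact: linearDf.
apply: EndV.
  by move=> a x y; rewrite (mM j).1 el (pM i).1.
exact: equivariant_comp (pM i).2 (equivariant_comp ee (mM j).2).
Qed.

(** Each block of [galact s], composed with the inverse of [phi s], is a linear even endomorphism of
    V and hence a scalar. *)
Lemma galact_blockmap : exists g : Gamma -> 'M[L]_n,
  forall s w, galact s w = blockmap (phi s) (g s) w.
Proof.
suff h s : exists X, forall w, galact s w = blockmap (phi s) X w.
  by have [g gE] := choice h; exists g.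
apply: blockmap_exists => [|i j]; first exact: galactD.
have [psi phiK psiK] := phiB s; have [t tK Kt] := ra_bij s.
have psiL a x y : psi (a *: x + y) = t a *: psi x + psi y.
  by apply: (can_inj phiK); rewrite phiL !psiK Kt.
have [|| a aE] := EndV (f := fun v => p i (galact s (m j (psi v)))).
- by move=> a x y; rewrite psiL (mM j).1 galact_semilinear (pM i).1 Kt.
- have e1 := equivariant_comp (mM j).2 (equivariant_cancel (phiE s) phiK psiK).
  exact: equivariant_comp (pM i).2 (equivariant_comp (galact_equivariant VF s) e1).
by exists a => v; rewrite -aE phiK.
Qed.

Lemma blockmap_scale a s X w : blockmap (fun v => a *: s v) X w = blockmap s (a *: X) w.
Proof.
rewrite /blockmap; apply: eq_bigr => i _; apply: eq_bigr => j _.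
by rewrite (linearZf _ _ (mM i).1) scalerA mxE mulrC.
Qed.

(** * The Brauer class of the endomorphism algebra *)

Section Brauer.
Variable g : Gamma -> 'M[L]_n.
Hypothesis gE : forall s w, galact s w = blockmap (phi s) (g s) w.

Lemma semilinear_inj s : injective (phi s).
Proof. exact: bij_inj. Qed.

Lemma semilinear0 s : phi s 0 = 0.
Proof. exact: additive0 (@semilinearD s). Qed.

Lemma phi_scalar_neq0 s t : c s t != 0.
Proof.
apply/eqP => c0; have [v v0] := sV.1.
have := phiM s t v; rewrite c0 scale0r => e.
by apply: v0; apply: (@semilinear_inj t); apply: (@semilinear_inj s); rewrite e !semilinear0.
Qed.

(** The Galois action on W composes strictly and the [phi s] only up to c, so the matrices must
    compensate by the inverse of c. *)
Lemma galmx_cocycle s t :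
  g s *m map_mx s (g t) = (c s t)^-1 *: g (ra_mul s t).
Proof.
apply: (canRL (scalerK (phi_scalar_neq0 s t))).
apply: (blockmap_inj (s := phi (ra_mul s t))); [exact: semilinear0|exact: semilinear_inj|].
move=> w; rewrite -gE -galactM !gE.
rewrite (blockmap_comp _ _ _ (@phiL s) (@phiM s t)) blockmap_scale //.
Qed.

(** The cocycle relation for s and its inverse makes g_s a left factor of a multiple of g_1. Since
    [phi o], for o the identity, is a nonzero scalar a, g_1 is the scalar matrix inverse to a. *)
Lemma galmx_unit s : g s \in unitmx.
Proof.
have [h sh] := relaut_gal s; pose t := gal_relaut (h^-1)%g.
pose o := gal_relaut (1%g : gal_of {:L}).
have st : ra_mul s t = o by rewrite sh -gal_relautM mulVg.
have ol a : o a = a by rewrite /= gal_id.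
have [|a aE] := EndV (f := phi o) _ (phiE o).
  by move=> a x y; rewrite phiL ol.
have a0 : a != 0.
  apply/eqP => a0; have [v v0] := sV.1; apply: v0; apply: (@semilinear_inj o).
  by rewrite !aE a0 !scale0r.
have go : a *: g o = 1%:M.
  apply: (blockmap_inj (s := id)) => // w.
  rewrite -blockmap_scale blockmap1 -[RHS]galact1 gE.
  by congr (blockmap _ _ _); apply/funext => v; rewrite aE.
have : g s *m (map_mx s (g t) *m ((c s t * a)%:M)) = 1%:M.
  rewrite mulmxA galmx_cocycle st mul_mx_scalar scalerA mulrC mulrA mulVf ?mul1r //.
  exact: phi_scalar_neq0.
by case/mulmx1_unit.
Qed.

Variables (A : algType F) (op : A -> VF -> VF).
Hypothesis opL : forall v, linear (op^~ v).
Hypothesis op_lin : forall a, linear (op a).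
Hypothesis op_eq : forall a, equivariant false (op a).
Hypothesis op1 : forall v, op 1 v = v.
Hypothesis opM : forall a b v, op (a * b) v = op a (op b v).
Hypothesis op_inj : forall a b, op a =1 op b -> a = b.
Hypothesis op_surj : forall h : VF -> VF, linear h -> equivariant false h ->
  exists a, op a =1 h.

Local Notation T := (ltensor (in_alg L) L^o A).
Local Notation b1 := (bunit (@ext_compat F L)).

(** The operator of z in L (x) A on W, restricted to the F-form V_F, by which a linear operator is
    determined. *)
Definition ev (z : T) (v : VF) : W :=
  tmap (idfun : res (in_alg L) L^o -> res (in_alg L) L^o) (op^~ v) z.

Lemma ev_linear v : linear (ev^~ v).
Proof. exact: ltmap_linear (opL v). Qed.

Lemma ev_tens x a v : ev (tens (x : res (in_alg L) L^o) a) v = bincl (in_alg L) x (op a v).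
Proof. exact: tmap_tens (opL v). Qed.

Lemma ev_inj z z' : ev z =1 ev z' -> z = z'.
Proof.
move=> e; apply: slice_l_inj => l; apply: op_inj => v.
have h (y : tensor (res (in_alg L) L^o) A) : slice_l l (ev y v) = op (slice_l l y) v.
  have evF : linear (ev^~ v : tensor (res (in_alg L) L^o) A ->
      tensor (res (in_alg L) L^o) VF) := tmap_linear (@idfun_linear F _) (opL v).
  move: y; apply: tensor_ext => [a x y|a x y|x a].
  - by rewrite evF slice_l_linear.
  - by rewrite slice_l_linear opL.
  - by rewrite ev_tens !slice_l_tens (linearZf _ _ (opL v)).
by rewrite -!h e.
Qed.

(** In a basis b_k of L over F the coordinates of e(1 (x) v) are endomorphisms of V_F in v, given by
    elements a_k of A; then z is the sum of the b_k (x) a_k. *)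
Lemma ev_exists (e : W -> W) : linear e -> equivariant false e ->
  exists z, forall v, ev z v = e (b1 v).
Proof.
move=> el ee; pose b := vbasis {:L}.
have cl k : linear (coord b k : res (in_alg L) L^o -> F^o).
  by move=> a x y; rewrite -[a *: x]/(a%:A * x) mulr_algl linearP.
pose mu k : {linear res (in_alg L) L^o -> F^o} :=
  HB.pack (coord b k : res (in_alg L) L^o -> F^o)
    (GRing.isLinear.Build F (res (in_alg L) L^o) F^o *:%R _ (cl k)).
have decomp (w : tensor (res (in_alg L) L^o) VF) :
    w = \sum_(k < \dim {:L}) tens (b`_k : res (in_alg L) L^o) (slice_l (mu k) w).
  move: w; apply: tensor_ext_add => [x y|x y|x v].
  - by [].
  - rewrite -big_split; apply: eq_bigr => k _.
    by rewrite (linearDf (slice_l_linear (mu k))) tensDr.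
  - under eq_bigr do rewrite slice_l_tens tensZr -tensZl.
    rewrite -tens_suml; congr tens.
    rewrite [LHS](coord_vbasis (memvf (x : L))); apply: eq_bigr => k _.
    by rewrite -[RHS]/(_%:A * _) mulr_algl.
have ex k : exists a, op a =1 (fun v => slice_l (mu k) (e (b1 v))).
  apply: op_surj => [a x y|].
    rewrite bunitD bunitZ el -ltensor_scaleE.
    exact: slice_l_linear.
  have e1 := equivariant_comp ee (bunit_equivariant (@ext_compat F L) VF).
  exact: equivariant_comp (slice_l_equivariant (@ext_compat F L) VF (mu k)) e1.
have [a aE] := choice ex.
exists (\sum_(k < \dim {:L}) tens (b`_k : res (in_alg L) L^o) (a k)) => v.
rewrite (linear_sum_fun _ _ (ev_linear v)).
rewrite [RHS]decomp; apply: eq_bigr => k _.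
by rewrite ev_tens aE.
Qed.

Lemma bmap_op_linear a : linear (bchange_map (@ext_compat F L) (op a) : W -> W).
Proof. exact: bchange_map_linear. Qed.

Lemma ev_tensor_mul z z' X v : (forall u, ev z u = blockmap id X (b1 u)) ->
  ev (tensor_mul z z') v = blockmap id X (ev z' v).
Proof.
move=> zX; have xl := endmap_linear X; have vl := ev_linear v.
have key (y : L) (b : A) u :
    ev (tensor_mul u (tens (y : res (in_alg L) L^o) b)) v = y *: ev u (op b v).
  move: u; apply: tensor_ext_add => [u u'|u u'|x a].
  - by rewrite tensor_mulDl (linearDf vl).
  - by rewrite (linearDf (ev_linear _)) scalerDr.
  - by rewrite tensor_mul_tens !ev_tens opM [RHS]lscale_tens mulrC.
move: z'; apply: tensor_ext_add => [u u'|u u'|y b].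
- by rewrite tensor_mulDr (linearDf vl).
- by rewrite (linearDf vl) (linearDf xl).
- by rewrite key zX ev_tens -(linearZf _ _ xl) [in RHS](scale_bunit (@ext_compat F L)).
Qed.

Lemma ev_galact s z v : ev (galact s z) v = galact s (ev z v).
Proof.
have vl := ev_linear v; move: z; apply: tensor_ext_add => [u u'|u u'|x a].
- by rewrite galactD (linearDf vl).
- by rewrite (linearDf vl) galactD.
- by rewrite galact_tens !ev_tens [RHS]galact_tens.
Qed.

Lemma ev_blockmap_inj X Y : (forall v, blockmap id X (b1 v) = blockmap id Y (b1 v)) ->
  X = Y.
Proof.
move=> e; apply: (blockmap_inj (s := id)) => //.
by apply: bchange_ext => //; exact: endmap_linear.
Qed.

(** The map f identifies M_n(L) with End(W) and then with L (x) A. Under it the Galois action on L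
    (x) A is conjugation by [galact s], and pushing [phi s] through a matrix leaves g_s and s on the
    entries. *)
Lemma brauer_data : exists f : 'M[L]_n -> T,
  [/\ [/\ linear f, bijective f,
      f 1%:M = tens ((1 : L) : res (in_alg L) L^o) 1
      & forall X Y, f (X *m Y) = tensor_mul (f X) (f Y)],
      forall a, exists X, f X = tens ((1 : L) : res (in_alg L) L^o) a &
      forall s X, galact s (f X) = f (g s *m map_mx s X *m invmx (g s))].
Proof.
have [f fE] := choice (fun X => ev_exists (endmap_linear X) (endmap_equivariant X)).
have fl : linear f.
  move=> a X Y; apply: ev_inj => v; rewrite ev_linear !fE.
  rewrite /blockmap scaler_sumr -big_split; apply: eq_bigr => i _ /=.
  rewrite scaler_sumr -big_split; apply: eq_bigr => j _ /=.
  by rewrite !mxE scalerDl scalerA.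
have surj z : exists X, f X = z.
  rewrite (tensor_sum z).
  apply: (@subspace_sum L T (fun z => exists X, f X = z)) => [|[x a] _ _] /=.
    split=> [|x _ _ [X <-] [Y <-]]; first by exists 0; rewrite (linear0f fl).
    by exists (x *: X + Y); rewrite fl.
  have [X XE] := blockmap_End (bmap_op_linear a)
    (bchange_map_equivariant (@ext_compat F L) (op_lin a) (op_eq a)).
  exists (x *: X); apply: ev_inj => v; rewrite (linearZf _ _ fl).
  rewrite (linearZf _ _ (ev_linear v)) fE -XE bchange_map_bunit // ev_tens.
  by rewrite [RHS](scale_bunit (@ext_compat F L)).
exists f; split=> [|a|s X]; [|exact: surj|].
- split=> //.
  + have [h hE] := choice surj; exists h => X; last exact: hE.
    by apply: ev_blockmap_inj => v; rewrite -!fE hE.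
  + apply: ev_inj => v; rewrite fE blockmap1 ev_tens op1 //.
  + move=> X Y; apply: ev_inj => v; rewrite (ev_tensor_mul _ _ (fE X)) !fE.
    by rewrite blockmap_id_comp.
- apply: ev_inj => v; rewrite ev_galact !fE.
  (* The vector 1 (x) v is fixed, so a Galois action may be inserted before it; its matrix g_s
     cancels the inverse. *)
  have e1 : b1 v = galact s (b1 v) by rewrite [RHS]galact_tens rmorph1.
  rewrite [in RHS]e1 !gE.
  rewrite (blockmap_comp _ _ _ (@phiL s) (h := phi s)) // blockmap_id_comp.
  by rewrite mulmxKV // galmx_unit.
Qed.

(** Commuting with A, hence with L (x) A, which is all of M_n(L), z acts on W by a scalar of L; as
    it preserves V_F, that scalar lies in F. *)
Lemma op_center (z : A) : (forall x, z * x = x * z) -> exists a : F, z = a%:A.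
Proof.
move=> zC; pose zW : W -> W := bchange_map (@ext_compat F L) (op z).
have zl : linear zW := bmap_op_linear z.
have zb v : zW (b1 v) = b1 (op z v) by rewrite /zW bchange_map_bunit.
have zev u v : zW (ev u v) = ev u (op z v).
  move: u; apply: tensor_ext_add => [u u'|u u'|x a].
  - by rewrite (linearDf (ev_linear _)) (linearDf zl).
  - by rewrite (linearDf (ev_linear _)).
  - by rewrite !ev_tens /zW bchange_map_bincl // -!opM zC.
have [Z ZE] := blockmap_End zl
  (bchange_map_equivariant (@ext_compat F L) (op_lin z) (op_eq z)).
have ZC X : Z *m X = X *m Z.
  have [u uE] := ev_exists (endmap_linear X) (endmap_equivariant X).
  apply: ev_blockmap_inj => v; rewrite -!blockmap_id_comp -!ZE.
  by rewrite zb -!uE zev.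
have [v v0] := (irrep_simple VF).1.
(* W is nonzero, so n is positive and a diagonal entry can be named. *)
have [j0 _] : exists j : 'I_n, True.
  apply: contrapT => h; case: v0; apply: (bunit_inj (phiE := @ext_compat F L)).
  by rewrite bunit0 -(mp (b1 v)) big1 // => i; case: h; exists i.
have Zs : Z = (Z j0 j0)%:M.
  apply/matrixP => k i; have := congr1 (fun M : 'M[L]_n => M k j0) (ZC (delta_mx i j0)).
  rewrite !mxE (bigD1 i) //= [X in _ = X -> _](bigD1 j0) //=.
  rewrite big1 => [|l /negPf li]; last by rewrite mxE li mulr0.
  rewrite big1 => [|l /negPf li]; last by rewrite mxE li andbF mul0r.
  by rewrite !mxE !eqxx !addr0 mulr1 andbT mulr_natl => ->; case: (k == i).
have zs w : zW w = Z j0 j0 *: w.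
  rewrite ZE {1}Zs -[(Z j0 j0)%:M]mulr1n.
  rewrite -[_ *+ 1]scalemx1 -blockmap_scale.
  rewrite -[in RHS](blockmap1 w) /blockmap scaler_sumr; apply: eq_bigr => i _.
  rewrite scaler_sumr; apply: eq_bigr => j _.
  by rewrite (linearZf _ _ (mM i).1) !scalerA mulrC.
have [a aE] := bunit_scalar v0 (esym (etrans (esym (zb v)) (zs (b1 v)))).
exists a; apply: op_inj => u; apply: (bunit_inj (phiE := @ext_compat F L)).
by rewrite -zb zs aE (linearZf _ _ (opL u)) op1 bunitZ.
Qed.

Lemma op_fin_dim : fin_dim A.
Proof.
have [f [[fl fB _ _] f_surj _]] := brauer_data.
have [h hE] := choice f_surj.
(* Matrices over L have their scalars in L; finite functions into L form a vector space over F, as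
   needed here. *)
pose k (a : A) : {ffun 'I_n * 'I_n -> L} := [ffun ij => h a ij.1 ij.2].
have hl a x y : h (a *: x + y) = a%:A *: h x + h y.
  by apply: (bij_inj fB); rewrite fl !hE tensDr tensZr ltensor_scaleE.
have kl : linear k.
  by move=> a x y; apply/ffunP => ij; rewrite !ffunE hl !mxE mulr_algl.
have kI x y : k x = k y -> x = y.
  move=> e; apply: op_inj => v; apply: (bunit_inj (phiE := @ext_compat F L)).
  have e2 : h x = h y.
    apply/matrixP => i j.
    by have := congr1 (fun q : {ffun _ -> _} => q (i, j)) e; rewrite !ffunE.
  have := congr1 (ev^~ v) (etrans (esym (hE x)) (etrans (congr1 f e2) (hE y))).
  by rewrite !ev_tens.
exact: injective_fin_dim kl kI.
Qed.

End Brauer.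

(** * Descent of a diagonal odd map to V_F *)

Section OddEndomorphism.
Variables (S : V -> V) (a : F).
Hypothesis SL : linear S.
Hypothesis SE : equivariant true S.
Hypothesis Sphi : forall s v, S (phi s v) = phi s (S v).
Hypothesis SS : forall v, S (S v) = a%:A *: v.
Local Notation b1 := (bunit (@ext_compat F L)).

Lemma odd_endomorphism_descent : exists u : VF -> VF,
  [/\ linear u, equivariant true u, forall v, u (u v) = a *: v &
    forall h : VF -> VF, linear h -> equivariant false h ->
      forall v, u (h v) = h (u v)].
Proof.
have [g gE] := galact_blockmap.
pose uW := blockmap S 1%:M.
have uWl : linear uW by apply: blockmap_linear.
have [uWh uWa] : equivariant true uW by apply: blockmap_equivariant.
have uWgal s w : galact s (uW w) = uW (galact s w).
  rewrite !gE /uW (blockmap_comp _ _ _ (@phiL s) (h := S \o phi s)); last first.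
    by move=> v /=; rewrite Sphi.
  rewrite blockmap_linear_comp // mul1mx; congr (blockmap _ _ _).
  by rewrite map_mx1 mulmx1.
have desc v : exists v', uW (b1 v) = b1 v'.
  apply: (galact_fixed gL) => s; rewrite uWgal; congr (uW _).
  by rewrite galact_tens rmorph1.
have [u uE] := choice desc.
have bI := bunit_inj (phiE := @ext_compat F L) (V := VF).
have [bh ba] := bunit_equivariant (@ext_compat F L) VF.
exists u; split=> [x v w||v|h hl he v].
- by apply: bI; rewrite -uE !(bunitD, bunitZ) uWl !uE.
- by split=> [j v|l v]; apply: bI; rewrite ?bh ?ba -!uE ?uWh ?uWa ?bh ?ba ?uWh ?uWa.
- apply: bI; rewrite -!uE bunitZ /uW blockmap_linear_comp // mul1mx.
  rewrite (_ : S \o S = fun v => a%:A *: v); last by apply/funext => w /=.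
  rewrite -[LHS]/(blockmap (fun v => a%:A *: id v) _ _) blockmap_scale.
  rewrite -[in RHS](blockmap1 (b1 v)) /blockmap scaler_sumr; apply: eq_bigr => i _.
  by rewrite scaler_sumr; apply: eq_bigr => j _; rewrite mxE scalerA.
- have hWl : linear (bchange_map (@ext_compat F L) h : W -> W) by exact: bchange_map_linear.
  have [X XE] := blockmap_End hWl (bchange_map_equivariant (@ext_compat F L) hl he).
  apply: bI; rewrite -uE -!(bchange_map_bunit _ _ hl) -uE !XE.
  by rewrite /uW blockmap_linear_comp // blockmap_id_comp mul1mx mulmx1.
Qed.

End OddEndomorphism.
End EndomorphismAlgebra.

(** * Odd endomorphisms *)

Lemma equivariant_lin (F : fieldType) (G : hopf_superalgebra F) (K : fieldType)
    (i : {rmorphism F -> K}) (V W : rep G i) d (I : Type) (r : seq I) (a : I -> K)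
    (f : I -> V -> W) : (forall k, equivariant d (f k)) ->
  equivariant d (fun v => \sum_(k <- r) a k *: f k v).
Proof.
move=> fe; split=> [j v|l v].
- by rewrite linear_sum; apply: eq_bigr => k _; rewrite (fe k).1 linearZ.
- have al := @act_linear _ _ _ _ W l.
  rewrite (linear_sum_fun _ _ al); apply: eq_bigr => k _.
  by rewrite (fe k).2 (linearZf _ _ al).
Qed.

Section OddSelfMap.
Variables (F : fieldType) (G : hopf_superalgebra F).
Variables (L : splittingFieldType F) (gL : galois 1 {:L}).
Local Notation Gamma := (relaut (in_alg L)).
Variables (V : rep G (in_alg L)) (sV : simple_rep V).
Hypothesis EndV : forall f : V -> V, linear f -> equivariant false f ->
  exists a, forall v, f v = a *: v.
Variable phi : Gamma -> V -> V.
Hypothesis phiL : forall s a x y, phi s (a *: x + y) = s a *: phi s x + phi s y.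
Hypothesis phiE : forall s, equivariant false (phi s).
Hypothesis phiB : forall s, bijective (phi s).
Variable c : Gamma -> Gamma -> L.
Hypothesis phiM : forall s t v, phi s (phi t v) = c s t *: phi (ra_mul s t) v.

(* The odd self-maps form a line on which conjugation by phi is an honest
   semilinear Galois action, so traces yield a fixed vector. *)
Lemma odd_selfmap_compatible (S1 : V -> V) v1 : linear S1 -> equivariant true S1 ->
  S1 v1 <> 0 ->
  exists (S : V -> V) (a : F),
    [/\ linear S, equivariant true S, forall s v, S (phi s v) = phi s (S v),
        a != 0 & forall v, S (S v) = a%:A *: v].
Proof.
move=> S1l S1e nz.
have S1I := simple_injective sV S1l S1e nz.
have inv s : exists g, cancel (phi s) g /\ cancel g (phi s).
  by case: (phiB s) => g ? ?; exists g.
have [psi psiP] := choice inv.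
have phiK s := (psiP s).1; have psiK s := (psiP s).2.
have pZ s a x := semilinearZ phiL s a x.
have p0 s : phi s 0 = 0 := semilinear0 phiL s.
pose R s v := phi s (S1 (psi s v)).
have RE s : equivariant true (R s).
  have e1 := equivariant_comp S1e (equivariant_cancel (phiE s) (phiK s) (psiK s)).
  exact: equivariant_comp (phiE s) e1.
have RL s : linear (R s).
  move=> a x y; have [t tK Kt] := ra_bij s.
  have -> : a *: x + y = phi s (t a *: psi s x + psi s y) by rewrite phiL Kt !psiK.
  by rewrite /R phiK S1l phiL Kt.
have Rphi s v : R s (phi s v) = phi s (S1 v) by rewrite /R phiK.
(* Conjugation by [phi s] after [phi t] is conjugation by [phi (ra_mul s t)], the scalar c
   cancelling. *)
have Rconj s t v : phi s (R t v) = R (ra_mul s t) (phi s v).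
  rewrite -(psiK t v) Rphi !phiM (linearZf _ _ (RL _)) Rphi //.
pose o := gal_relaut (1%g : gal_of {:L}).
pose v0 := phi o v1.
(* By independence of characters some weighted trace of the conjugates does not vanish at v0, the
   term of the identity being nonzero there. *)
have [x Sx] : exists x, \sum_g gal_relaut g x *: R (gal_relaut g) v0 <> 0.
  apply: contrapT => h; apply: nz; apply: (bij_inj (phiB o)); rewrite p0 -Rphi.
  apply: (gal_vector_independent (w := fun g => R (gal_relaut g) v0)) => y.
  by apply: contrapT => nzy; apply: h; exists y.
pose S v := \sum_g gal_relaut g x *: R (gal_relaut g) v.
have SL : linear S.
  move=> a y z; rewrite /S scaler_sumr -big_split; apply: eq_bigr => g _ /=.
  by rewrite RL scalerDr !scalerA mulrC.
have SE : equivariant true S by apply: equivariant_lin => g; apply: RE.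
have Sphi s v : S (phi s v) = phi s (S v).
  have [h ->] := relaut_gal s.
  rewrite /S (additive_sum _ _ _ (semilinearD phiL _)) [LHS](reindex_inj (mulIg h)).
  by apply: eq_bigr => g _; rewrite pZ Rconj gal_relautM.
have [|b bE] := EndV (f := S \o S) _ (equivariant_comp SE SE).
  by move=> a y z /=; rewrite !SL.
(* The square of S commutes with [phi s], and pulling the scalar b through [phi s] turns it into
   s(b). *)
have bfix (s : Gamma) : s b = b.
  apply: (scalar_cancel (v := phi s v1)) => [e|].
    by apply: nz; apply: (bij_inj (phiB s)); rewrite p0 (_ : v1 = 0) ?(linear0f S1l) //;
       apply: (bij_inj (phiB s)); rewrite e p0.
  by rewrite -pZ -!bE /= !Sphi.
have [a ba] := gal_fixed gL bfix.
exists S, a; split=> // [|v]; last by rewrite -[LHS]/((S \o S) v) bE ba.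
apply/eqP => a0; have := bE v0; rewrite ba a0 rmorph0 scale0r /= => e.
have SI := simple_injective sV SL SE Sx.
by apply: Sx; apply: SI; rewrite [LHS]e (linear0f SL).
Qed.

End OddSelfMap.

(** * Homogeneous endomorphisms of V_F *)

Section EndSuper.
Variables (F : fieldType) (G : hopf_superalgebra F) (VF : base_irrep G).
Local Notation E := (uEnd VF).
Implicit Types x y z : uend VF.

Lemma uend_op_linear1 x : linear (x.1 : VF -> VF).
Proof. by case: (uend_even x). Qed.
Lemma uend_op_linear2 x : linear (x.2 : VF -> VF).
Proof. by case: (uend_odd x). Qed.
Lemma uend_op_equivariant1 x : equivariant false (x.1 : VF -> VF).
Proof. by have /rep_homP[] := uend_even x. Qed.
Lemma uend_op_equivariant2 x : equivariant true (x.2 : VF -> VF).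
Proof. by have /rep_hom_PiP[] := uend_odd x. Qed.

Lemma uend_exists (f g : VF -> VF) : linear f -> equivariant false f ->
  linear g -> equivariant true g -> exists x, x.1 = f /\ x.2 = g.
Proof.
move=> fl fe gl ge.
have fh : rep_hom (V := VF) (W := VF) f by apply/rep_homP.
have gh : rep_hom (V := VF) (W := Pi_rep VF) g by apply/rep_hom_PiP.
by exists (UEnd (uendP fh gh)).
Qed.

Lemma zero_equivariant d : linear ((fun=> 0) : VF -> VF) /\
  equivariant d ((fun=> 0) : VF -> VF).
Proof.
split=> [a x y|]; first by rewrite scaler0 addr0.
split=> [j v|l v]; first by rewrite linear0.
by rewrite (linear0f (@act_linear _ _ _ _ VF l)).
Qed.

Lemma uend_evenP x : homogeneous (sa_gr E) false x <-> forall v, x.2 v = 0.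
Proof.
split=> [<- //|h]; apply: uend_eq => v //=; by rewrite h.
Qed.

Lemma uend_oddP x : homogeneous (sa_gr E) true x <-> forall v, x.1 v = 0.
Proof.
split=> [<- //|h]; apply: uend_eq => v //=; by rewrite h.
Qed.

(** Schur's lemma applied to the component of the parity i. It puts 1 into every nonzero graded
    ideal. *)
Lemma uend_homogeneous_unit i x : homogeneous (sa_gr E) i x -> x <> 0 ->
  exists y : E, y * x = 1.
Proof.
have [zl ze] := zero_equivariant false; have [_ ze'] := zero_equivariant true.
case: i => [/uend_oddP|/uend_evenP] h nz.
- have [v nv] : exists v, x.2 v <> 0.
    apply: contrapT => n; apply: nz; apply: uend_eq => v //=.
    by apply: contrapT => ?; apply: n; exists v.
  have [g [gl ge gK Kg]] := simple_inverse (irrep_simple VF) (irrep_simple VF)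
    (uend_op_linear2 x) (uend_op_equivariant2 x) nv.
  have [y [y1 y2]] := uend_exists zl ze gl ge.
  exists y; apply: uend_eq => w; rewrite /= y1 y2 ?h.
    by rewrite add0r gK.
  by rewrite add0r (linear0f gl).
- have [v nv] : exists v, x.1 v <> 0.
    apply: contrapT => n; apply: nz; apply: uend_eq => v //=.
    by apply: contrapT => ?; apply: n; exists v.
  have [g [gl ge gK Kg]] := simple_inverse (irrep_simple VF) (irrep_simple VF)
    (uend_op_linear1 x) (uend_op_equivariant1 x) nv.
  have [y [y1 y2]] := uend_exists gl ge zl ze'.
  exists y; apply: uend_eq => w; rewrite /= y1 y2 ?h.
    by rewrite addr0 gK.
  by rewrite addr0 (linear0f gl).
Qed.

Lemma uend_graded_ideal (I : E -> Prop) : ideal2 I ->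
  (forall i x, I x -> I (hpart (sa_gr E) i x)) ->
  (forall x : E, I x -> x = 0) \/ (forall x : E, I x).
Proof.
move=> [I0 ID IM] Ih.
have [[x [Ix nz]]|h] := pselect (exists x, I x /\ x <> 0); last first.
  by left=> x Ix; apply: contrapT => nz; apply: h; exists x.
right=> y; have [i ni] : exists i, hpart (sa_gr E) i x <> 0.
  apply: contrapT => h; apply: nz; rewrite -(hpartD (sa_gr E) x).
  have z i : hpart (sa_gr E) i x = 0 by apply: contrapT => ni; apply: h; exists i.
  by rewrite !z addr0.
have hi : homogeneous (sa_gr E) i (hpart (sa_gr E) i x).
  by rewrite /homogeneous hpartK eqxx.
have [z zx] := uend_homogeneous_unit hi ni.
have I1 : I 1 by rewrite -zx; apply: (IM z _ (Ih i _ Ix)).1.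
by rewrite -[y]mulr1; apply: (IM y _ I1).1.
Qed.

End EndSuper.

(** * The endomorphism superalgebra of V_F *)

(** A presentation of A as End_G(V_F) that leaves its construction open: it is used for the even
    part of the endomorphism superalgebra and, if that is purely even, for the whole of it. *)
Record end_action (F : fieldType) (G : hopf_superalgebra F) (VF : base_irrep G)
    (A : algType F) (op : A -> VF -> VF) : Prop := EndAction {
  ea_linear : forall v, linear (op^~ v);
  ea_lin : forall a, linear (op a);
  ea_equivariant : forall a, equivariant false (op a);
  ea_one : forall v, op 1 v = v;
  ea_mul : forall a b v, op (a * b) v = op a (op b v);
  ea_inj : forall a b, op a =1 op b -> a = b;
  ea_surj : forall h : VF -> VF, linear h -> equivariant false h ->
    exists a, op a =1 h
}.

Section EndActions.
Variables (F : fieldType) (G : hopf_superalgebra F) (VF : base_irrep G).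

Lemma end_action_even : end_action (fun (a : End_rep VF) v => (even_val a).1 v).
Proof.
have odd0 (a : End_rep VF) v : (even_val a).2 v = 0.
  by apply: (uend_evenP _).1; apply/eqP; exact: (valP a).
have [zl ze] := zero_equivariant VF true.
split.
- by move=> v a x y.
- by move=> a; apply: uend_op_linear1.
- by move=> a; apply: uend_op_equivariant1.
- by [].
- by move=> a b v; rewrite /= odd0 addr0.
- by move=> a b e; apply: val_inj; apply: uend_eq => v //=; rewrite !odd0.
- move=> h hl he; have [x [x1 x2]] := uend_exists hl he zl ze.
  have xe : (x : uEnd VF) \in even_pred (A := uEnd VF).
    by apply/eqP/uend_evenP => v; rewrite x2.
  by exists (EvenAlg xe) => v; rewrite /= x1.
Qed.

Lemma end_action_uend : purely_even (uEnd VF) ->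
  end_action (fun (a : uEnd VF) v => (a : uend VF).1 v).
Proof.
move=> pe; have odd0 (a : uend VF) v : a.2 v = 0 by apply: (uend_evenP _).1; apply: pe.
have [zl ze] := zero_equivariant VF true.
split.
- by move=> v a x y.
- by move=> a; apply: uend_op_linear1.
- by move=> a; apply: uend_op_equivariant1.
- by [].
- by move=> a b v; rewrite /= odd0 addr0.
- by move=> a b e; apply: uend_eq => v //; rewrite !odd0.
- move=> h hl he; have [x [x1 x2]] := uend_exists hl he zl ze.
  by exists x => v; rewrite /= x1.
Qed.

End EndActions.

(** * Invariants of the endomorphism superalgebra over L *)

Section SplittingLevel.
Variables (F : fieldType) (G : hopf_superalgebra F) (VF : base_irrep G).
Variables (L : splittingFieldType F) (gL : galois 1 {:L}).
Local Notation W := (ext_irrep VF L).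
Local Notation Gamma := (relaut (in_alg L)).

Variables (V : rep G (in_alg L)) (sV : simple_rep V).
Hypothesis EndV : forall f : V -> V, linear f -> equivariant false f ->
  exists a, forall v, f v = a *: v.
Variable phi : Gamma -> V -> V.
Hypothesis phiL : forall s a x y, phi s (a *: x + y) = s a *: phi s x + phi s y.
Hypothesis phiE : forall s, equivariant false (phi s).
Hypothesis phiB : forall s, bijective (phi s).
Variable c : Gamma -> Gamma -> L.
Hypothesis phiM : forall s t v, phi s (phi t v) = c s t *: phi (ra_mul s t) v.
Variables (m0 : V -> W) (v0 : V).
Hypothesis m0M : rep_morph m0.
Hypothesis m0_neq0 : m0 v0 <> 0.

Let isotypic := ext_irrep_isotypic gL sV phiL phiE phiB m0M m0_neq0.

Lemma end_brauer (A : algType F) (op : A -> VF -> VF) : end_action op ->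
  exists (n : nat) (f : 'M[L]_n -> ltensor (in_alg L) L^o A) (g : Gamma -> 'M[L]_n),
    [/\ [/\ linear f, bijective f,
            f 1%:M = tens ((1 : L) : res (in_alg L) L^o) 1
          & forall X Y, f (X *m Y) = tensor_mul (f X) (f Y)],
        forall s, g s \in unitmx,
        forall s X, galact s (f X) = f (g s *m map_mx s X *m invmx (g s))
      & forall s t, g s *m map_mx s (g t) = (c s t)^-1 *: g (ra_mul s t)].
Proof.
move=> [opL op_lin op_eq op1 opM op_inj op_surj].
have [n [m [p [mM pM pm mp]]]] := isotypic.
have [g gE] := galact_blockmap EndV phiL phiE phiB mM pM pm mp.
have [f [f1 f2 f3]] := brauer_data sV EndV phiL phiE phiB phiM mM pM pm mp gE
  opL op_lin op_eq op1 opM op_inj op_surj.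
exists n, f, g; split=> //.
- exact: (galmx_unit sV EndV phiL phiE phiB phiM mM pM pm mp gE).
- exact: (galmx_cocycle sV phiL phiB phiM mM pM pm mp gE).
Qed.

Lemma end_center (A : algType F) (op : A -> VF -> VF) (z : A) : end_action op ->
  (forall x, z * x = x * z) -> exists a : F, z = a%:A.
Proof.
move=> [opL op_lin op_eq op1 opM op_inj op_surj].
have [n [m [p [mM pM pm mp]]]] := isotypic.
exact: (op_center sV EndV mM pM pm mp opL op_lin op_eq op1 opM op_inj op_surj).
Qed.

Lemma end_fin_dim (A : algType F) (op : A -> VF -> VF) : end_action op -> fin_dim A.
Proof.
move=> [opL op_lin op_eq op1 opM op_inj op_surj].
have [n [m [p [mM pM pm mp]]]] := isotypic.
have [g gE] := galact_blockmap EndV phiL phiE phiB mM pM pm mp.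
exact: (op_fin_dim sV EndV phiL phiE phiB phiM mM pM pm mp gE
  opL op_lin op_eq op1 opM op_inj op_surj).
Qed.

Lemma end_odd_central (S1 : V -> V) v1 : linear S1 -> equivariant true S1 ->
  S1 v1 <> 0 -> exists (S : V -> V) (a : F) (u : VF -> VF),
    [/\ linear S, equivariant true S, forall s v, S (phi s v) = phi s (S v),
        forall v, S (S v) = a%:A *: v &
    [/\ a != 0, linear u, equivariant true u, forall v, u (u v) = a *: v &
      forall h : VF -> VF, linear h -> equivariant false h ->
        forall v, u (h v) = h (u v)]].
Proof.
move=> S1l S1e nz.
have [S [a [SL SE Sphi a0 SS]]] :=
  odd_selfmap_compatible gL sV EndV phiL phiE phiB phiM S1l S1e nz.
have [n [m [p [mM pM pm mp]]]] := isotypic.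
have [u [ul ue uu uh]] :=
  odd_endomorphism_descent gL EndV phiL phiE phiB mM pM pm mp SL SE Sphi SS.
by exists S, a, u.
Qed.

(** Over L, q is an n by n matrix of odd self-maps of V; if all blocks vanished, so would q. *)
Lemma end_odd_block (q : VF -> VF) v : linear q -> equivariant true q -> q v <> 0 ->
  exists (S1 : V -> V) v1, [/\ linear S1, equivariant true S1 & S1 v1 <> 0].
Proof.
move=> ql qe nz; have [n [m [p [mM pM pm mp]]]] := isotypic.
pose qW : W -> W := bchange_map (@ext_compat F L) q.
have qWl : linear qW by apply: bchange_map_linear.
have qWe : equivariant true qW by apply: bchange_map_equivariant.
apply: contrapT => h; apply: nz.
apply: (bunit_inj (phiE := @ext_compat F L)); rewrite bunit0.
rewrite -(bchange_map_bunit _ _ ql) -/qW -[LHS]mp big1 // => i _.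
rewrite -(mp (bunit _ v)) (linear_sum_fun _ _ qWl) (linear_sum_fun _ _ (pM i).1).
rewrite big1 ?(linear0f (mM i).1) // => j _.
apply: contrapT => nz; apply: h.
exists (fun v => p i (qW (m j v))), (p j (bunit (@ext_compat F L) v)); split=> //.
- by move=> a x y; rewrite (mM j).1 qWl (pM i).1.
- exact: equivariant_comp (pM i).2 (equivariant_comp qWe (mM j).2).
Qed.

Lemma uend_center (z : uEnd VF) : homogeneous (sa_gr (uEnd VF)) false z ->
  (forall x, z * x = x * z) -> exists a : F, z = a%:A.
Proof.
move=> /eqP ze zC; pose z' : End_rep VF := EvenAlg (A := uEnd VF) ze.
have [x|a za] := end_center (z := z') (end_action_even VF); last first.
  by exists a; exact: (congr1 (@even_val _ _) za).
by apply: val_inj; apply: zC.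
Qed.

Lemma uend_css : fin_dim (uEnd VF) -> central_simple_super (uEnd VF).
Proof.
by move=> fd; split=> //; [exact: uend_graded_ideal | exact: uend_center].
Qed.

Lemma uend_purely_even_simple : purely_even (uEnd VF) ->
  fin_dim (uEnd VF) /\ central_simple (uEnd VF).
Proof.
move=> pe; have fd := end_fin_dim (end_action_uend pe).
split=> //; split=> // [I iI|z zC]; last exact: uend_center.
apply: uend_graded_ideal => // -[] x Ix; last by rewrite (pe x).
rewrite (_ : hpart _ true x = 0); first by case: iI.
by rewrite -(pe x) hpartK.
Qed.

(** If x is odd then u x is even, so u commutes with u x and, being injective, with x. Thus u is
    central in the ungraded algebra without being a scalar. It also exchanges even and odd parts,
    which bounds the dimension. *)
Lemma uend_odd_type (a : F) (u : VF -> VF) : a != 0 -> linear u -> equivariant true u ->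
  (forall v, u (u v) = a *: v) ->
  (forall h : VF -> VF, linear h -> equivariant false h ->
        forall v, u (h v) = h (u v)) ->
  [/\ fin_dim (uEnd VF), ~ central_simple (uEnd VF) & bw_disc (uEnd VF) a].
Proof.
move=> a0 ul ue uu uh; have [zl ze] := zero_equivariant VF false.
have uI : injective u.
  by move=> y z /(congr1 u); rewrite !uu => /(congr1 (fun v => a^-1 *: v)); rewrite !scalerK.
have [U [U1 U2]] := uend_exists zl ze ul ue.
have Unz : (U : uEnd VF) <> 0.
  move=> e; have [v nv] := irr_neq0 VF; apply: nv.
  have := uu v; rewrite -U2 e /= => /esym/eqP; rewrite scaler_eq0 (negPf a0).
  by move/eqP.
have UU : (U : uEnd VF) * U = a%:A.
  apply: uend_eq => v; rewrite /= U1 U2 /= ?add0r ?uu //.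
  by rewrite (linear0f ul); symmetry; exact: scaler0.
have Uodd : homogeneous (sa_gr (uEnd VF)) true U by apply/uend_oddP => v; rewrite U1.
have UC (x : uEnd VF) : (U : uEnd VF) * x = x * U.
  have xl := uend_op_linear1 x; have xo := uend_op_linear2 x.
  apply: uend_eq => v; rewrite /= U1 U2 ?(linear0f xl) ?(linear0f xo) !(add0r, addr0).
    have [l e] : linear (fun v => u (x.2 v)) /\ equivariant false (fun v => u (x.2 v)).
      split=> [b y z|]; first by rewrite xo ul.
      exact: equivariant_comp ue (uend_op_equivariant2 x).
    by apply: uI; exact: (uh _ l e v).
  by rewrite uh //; exact: uend_op_equivariant1.
have nC : ~ central_simple (uEnd VF).
  case=> _ _ /(_ U UC)[b Ub]; apply: Unz.
  have h1 : hpart (sa_gr (uEnd VF)) true 1 = 0.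
    by have := hpartK (sa_gr (uEnd VF)) true false 1; rewrite (sa_one (uEnd VF)).
  by rewrite -Uodd Ub linearZZ h1 scaler0.
split=> //; last first.
  apply: Or33; split=> //; exists U; split=> // x _; exact: UC.
have [e eE] := end_fin_dim (end_action_even VF).
pose E0 := [seq (even_val x : uEnd VF) | x <- e].
exists (E0 ++ [seq (U : uEnd VF) * x | x <- E0]) => x.
have span0 (y : uEnd VF) : homogeneous (sa_gr (uEnd VF)) false y ->
    exists c : nat -> F, y = \sum_(i < size E0) c i *: E0`_i.
  move=> /eqP ye; have [c' cE] := eE (EvenAlg (A := uEnd VF) ye); exists c'.
  have := congr1 (@even_val _ _) cE; rewrite /= => ->.
  rewrite size_map; have vD : {morph (@even_val _ (uEnd VF)) : x y / x + y} by [].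
  rewrite (additive_sum _ _ _ vD); apply: eq_bigr => i _.
  by rewrite (nth_map 0).
have [c1 c1E] := span0 (hpart (sa_gr (uEnd VF)) false x) (hpartK _ false false x).
have odd_even : homogeneous (sa_gr (uEnd VF)) false
    ((U : uEnd VF) * hpart (sa_gr (uEnd VF)) true x).
  exact: (sa_mul (s := uEnd VF) Uodd (hpartK _ true true x)).
have [c2 c2E] := span0 _ odd_even.
pose N := size E0.
(* The odd part of x is a^-1 U (U x_1) with U x_1 even, hence the factor a^-1 and the shift by N. *)
exists (fun i => if (i < N)%N then c1 i else a^-1 * c2 (i - N)%N).
rewrite size_cat (size_map (fun x : uEnd VF => (U : uEnd VF) * x)) big_split_ord /=.
rewrite -{1}(hpartD (sa_gr (uEnd VF)) x); congr (_ + _).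
  rewrite c1E; apply: eq_bigr => i _.
  by rewrite ltn_ord nth_cat ltn_ord.
have -> : hpart (sa_gr (uEnd VF)) true x =
    a^-1 *: ((U : uEnd VF) * ((U : uEnd VF) * hpart (sa_gr (uEnd VF)) true x)).
  by rewrite mulrA UU mulr_algl scalerK.
rewrite c2E mulr_sumr scaler_sumr; apply: eq_bigr => i _.
rewrite ltnNge leq_addr /= addKn nth_cat ltnNge leq_addr /= addKn.
rewrite (nth_map 0 0 (fun x : uEnd VF => (U : uEnd VF) * x)) //.
by rewrite -scalerAr scalerA.
Qed.

End SplittingLevel.

(** * Descent from the separable closure to L *)

Section SemilinearTwist.
Variables (F K : fieldType) (iota : {rmorphism F -> K}) (G : hopf_superalgebra F).
Variables (V : rep G iota) (s : relaut iota) (f : twist s V -> V).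
Hypothesis fiso : rep_iso f.

(** The s-semilinear self-map of V that corresponds to the linear map f on the twist. *)
Definition untwist (v : V) : V := f (bunit (ra_fix s) v).

Lemma untwist_semilinear a x y : untwist (a *: x + y) = s a *: untwist x + untwist y.
Proof. by have [[fl _ _] _] := fiso; rewrite /untwist bunitD bunitZ fl. Qed.

Lemma untwist_equivariant : equivariant false untwist.
Proof.
have /rep_homP[_ fe] := fiso.1.
exact: equivariant_comp fe (bunit_equivariant (ra_fix s) V).
Qed.

(** Base change along an automorphism adds no vectors: x (x) v is 1 (x) t(x) v for t the inverse of
    s. *)
Lemma twist_bunit_surj (z : twist s V) : exists v, z = bunit (ra_fix s) v.
Proof.
have [t tK Kt] := ra_bij s; rewrite (tensor_sum z).
exists (\sum_(q <- repr z) t q.1 *: q.2).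
rewrite (big_morph _ (@bunitD _ _ _ _ _ _ _ (ra_fix s) V) (@bunit0 _ _ _ _ _ _ _ (ra_fix s) V)).
apply: eq_bigr => q _; rewrite bunitZ Kt -scale_bunit //.
Qed.

Lemma untwist_bij : bijective untwist.
Proof.
have [_ [g fK gK]] := fiso.
have [h hE] := choice twist_bunit_surj.
have bI := bunit_inj (phiE := ra_fix s) (V := V).
exists (fun v => h (g v)) => v; first by apply: bI; rewrite -hE fK.
by rewrite /untwist -hE gK.
Qed.

End SemilinearTwist.

(** * The model V' over L inside V *)

Section DescentData.
Variables (F Fs : fieldType) (iota : {rmorphism F -> Fs}) (G : hopf_superalgebra F).
Variables (V : irrep G iota) (L : splittingFieldType F) (k : {rmorphism L -> Fs}).
Variables (kE : forall x, k (in_alg L x) = iota x) (V' : rep G (in_alg L)).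
Variables (theta : bchange kE V' -> V) (theta_iso : rep_iso theta).
Hypothesis EndV : forall f : V -> V, rep_hom f -> exists c : Fs, forall v, f v = c *: v.

Definition incl (v : V') : V := theta (bunit kE v).

Let thL : linear theta. Proof. by case: theta_iso => [[]]. Qed.
Let thE : equivariant false theta. Proof. by have /rep_homP[] := theta_iso.1. Qed.
Let thI : injective theta. Proof. exact: bij_inj theta_iso.2. Qed.

Lemma theta_inverse : exists ti : V -> bchange kE V',
  [/\ linear ti, equivariant false ti, cancel theta ti & cancel ti theta].
Proof.
have [_ [g fK gK]] := theta_iso; exists g.
by have [] := equivariant_inv thL thE fK gK.
Qed.

Lemma inclD : {morph incl : x y / x + y}.
Proof. by move=> x y; rewrite /incl bunitD (linearDf thL). Qed.

Lemma inclZ a x : incl (a *: x) = k a *: incl x.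
Proof. by rewrite /incl bunitZ (linearZf _ _ thL). Qed.

Lemma incl0 : incl 0 = 0. Proof. exact: additive0 inclD. Qed.

Lemma incl_inj : injective incl.
Proof. by move=> x y /thI; apply: bunit_inj. Qed.

Lemma incl_equivariant : equivariant false incl.
Proof. exact: equivariant_comp thE (bunit_equivariant kE V'). Qed.

Lemma incl_span (X : V -> Prop) : subspace X -> (forall v, X (incl v)) -> forall v, X v.
Proof.
move=> sX Xi v; have [ti [_ _ _ tK]] := theta_inverse.
rewrite -(tK v) (tensor_sum (ti v)) (linear_sum_fun _ _ thL).
apply: subspace_sum => // q _ _.
rewrite -[tens _ _]/(bincl _ _ _) (scale_bunit kE) (linearZf _ _ thL).
apply: subspaceZ => //; exact: Xi.
Qed.

(** For a stable U in V' the span of its image in V is stable, hence 0 or V. If it is V while U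
    misses v, a functional vanishing on U and equal to 1 at v, with its scalars extended to Fs,
    would have to vanish everywhere. *)
Lemma small_simple : simple_rep V'.
Proof.
split.
  apply: contrapT => h; have [v nv] := irr_neq0 V; apply: nv.
  apply: (incl_span (X := fun v => v = 0)) => [|u].
    by split=> // a x y -> ->; rewrite scaler0 addr0.
  by rewrite (_ : u = 0) ?incl0 //; apply: contrapT => nu; apply: h; exists u.
move=> U [sU Uh Ua].
pose X0 (X : V -> Prop) := subspace X /\ forall u, U u -> X (incl u).
pose U' v := forall X, X0 X -> X v.
have [ih ia] := incl_equivariant.
have sU' : subspace U'.
  split=> [X [[]] //|a x y Ux Uy X X0X].
  by apply: X0X.1.2; [apply: Ux | apply: Uy].
(* The preimage under f of a subspace containing the image of U is another one, so their
   intersection U' is stable under f. *)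
have pre (f : V -> V) X : linear f ->
    (forall u, U u -> exists2 u', U u' & f (incl u) = incl u') ->
    X0 X -> X0 (fun v => X (f v)).
  move=> fl fU [sX iX]; split.
    split=> [|a x y Xx Xy]; first by rewrite (linear0f fl); apply: sX.1.
    by rewrite fl; apply: sX.2.
  by move=> u /fU[u' Uu' ->]; apply: iX.
have [|U0|Uall] := (irrep_simple V).2 U'.
- split=> // [i x Ux X X0X|l x Ux X X0X].
    apply: (Ux (fun v => X (hpart (rep_gr V) i v))); apply: pre => //.
      by move=> a y z; rewrite linearP.
    by move=> u Uu; exists (hpart (rep_gr V') i u); [apply: Uh | rewrite ih].
  apply: (Ux (fun v => X (act l v))); apply: pre => //; first exact: act_linear.
  by move=> u Uu; exists (act l u); [apply: Ua | rewrite ia].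
- left=> u Uu; apply: incl_inj; rewrite incl0; apply: U0.
  by move=> X [_ iX]; apply: iX.
- right=> v; apply: contrapT => nUv.
  have [l lU lv] := functional_separation sU nUv.
  have [ti [tiL _ thK tK]] := theta_inverse.
  have e u : slice_r (U := res k Fs^o) l (ti (incl u)) = l u *: (1 : res k Fs^o).
    by rewrite /incl thK slice_r_tens.
  have sL (a : Fs) (z : ltensor k Fs^o V') :
      slice_r (U := res k Fs^o) l (a *: z) = a * slice_r (U := res k Fs^o) l z.
    move: z; apply: tensor_ext_add => [x y|x y|x u].
    - by rewrite scalerDr (linearDf (slice_r_linear l)).
    - by rewrite (linearDf (slice_r_linear l)) [LHS]mulrDr.
    - by rewrite [X in slice_r _ X]lscale_tens !slice_r_tens [RHS]mulrCA.
  have : slice_r (U := res k Fs^o) l (ti (incl v)) = 0.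
    apply: (Uall (incl v) (fun w => slice_r (U := res k Fs^o) l (ti w) = 0)).
    split=> [|u Uu]; last by rewrite e (lU u Uu) scale0r.
    split=> [|a x y ex ey]; first by rewrite (linear0f tiL) (linear0f (slice_r_linear l)).
    by rewrite tiL (linearDf (slice_r_linear l)) ey addr0 sL ex mulr0.
  by rewrite e lv scale1r => /eqP; rewrite oner_eq0.
Qed.

Lemma extend_selfmap (f : V' -> V') d : linear f -> equivariant d f ->
  exists g : V -> V,
    [/\ linear g, equivariant d g & forall v, g (incl v) = incl (f v)].
Proof.
move=> fl fe; have [ti [tiL tiE thK tK]] := theta_inverse.
have bl := bchange_map_linear (phiE := kE) fl; have be := bchange_map_equivariant kE fl fe.
exists (theta \o (bchange_map kE f \o ti)); split=> [a x y||v] /=.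
- by rewrite tiL bl thL.
- have := equivariant_comp thE (equivariant_comp be tiE).
  by rewrite addFb addbF.
- by rewrite /incl thK bchange_map_bunit.
Qed.

(** The extension of f to V is a scalar of Fs, and [bunit_scalar] puts it in L because f preserves
    V'. *)
Lemma small_End (f : V' -> V') : linear f -> equivariant false f ->
  exists a, forall v, f v = a *: v.
Proof.
move=> fl fe; have [g [gl ge gE]] := extend_selfmap fl fe.
have [|c cE] := EndV (f := g); first by apply/rep_homP.
have fc v : c *: (bunit kE v : bchange kE V') = bunit kE (f v).
  by apply: thI; rewrite (linearZf _ _ thL) -cE -[RHS]gE.
have [v v0] := small_simple.1.
have [a ca] := bunit_scalar v0 (fc v).
exists a => w; apply: (bunit_inj (phiE := kE)).
by rewrite -fc ca bunitZ.
Qed.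

Lemma incl_neq0 (g : V -> V) v : linear g -> g v <> 0 -> exists u, g (incl u) <> 0.
Proof.
move=> gl nz; apply: contrapT => h; apply: nz.
apply: (incl_span (X := fun v => g v = 0)) => [|u].
  by split=> [|a x y ex ey]; rewrite ?(linear0f gl) // gl ex ey scaler0 addr0.
by apply: contrapT => nu; apply: h; exists u.
Qed.

(** S0 need not preserve V', so its values there are contracted along an L-linear functional mu on
    Fs, chosen to be 1 at a nonzero coordinate of one of them. *)
Lemma small_odd_selfmap (S0 : V -> V) v0 : linear S0 -> equivariant true S0 ->
  S0 v0 <> 0 -> exists (S1 : V' -> V') v1,
    [/\ linear S1, equivariant true S1 & S1 v1 <> 0].
Proof.
move=> Sl Se nz; have [u nu] := incl_neq0 Sl nz.
have [ti [tiL tiE thK tK]] := theta_inverse.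
pose z := ti (S0 (incl u)).
have nz0 : z <> 0.
  by move=> e; apply: nu; rewrite -(tK (S0 _)) -/z e (linear0f thL).
have [l nl] : exists l : {linear V' -> L^o}, slice_r (U := res k Fs^o) l z <> 0.
  apply: contrapT => h; apply: nz0; apply: (slice_r_inj (U := res k Fs^o)) => l.
  rewrite (linear0f (slice_r_linear l)).
  by apply: contrapT => nl; apply: h; exists l.
have [mu mu1] := functional_exists nl.
exists (fun v => slice_l mu (ti (S0 (incl v)))), u; split.
- move=> a x y; rewrite inclD inclZ Sl tiL -ltensor_scaleE.
  exact: slice_l_linear.
- have e1 := equivariant_comp Se incl_equivariant.
  exact: equivariant_comp (slice_l_equivariant kE V' mu) (equivariant_comp tiE e1).
have lm (y : tensor (res k Fs^o) V') : l (slice_l mu y) = mu (slice_r l y).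
  move: y; apply: tensor_ext => [a x y|a x y|x v].
  - by rewrite slice_l_linear linearP.
  - by rewrite slice_r_linear linearP.
  - by rewrite slice_l_tens slice_r_tens !linearZ [LHS]mulrC.
rewrite -/z => e; have := lm z; rewrite e linear0 mu1 => /esym/eqP.
by rewrite oner_eq0.
Qed.

(** The functional mu is 1 at a nonzero coordinate of the image of v, so the contracted map
    survives; restricted to F-scalars it commutes with the coaction on V_F. *)
Lemma small_embedding (VF : base_irrep G) (f : V -> extend iota VF) :
  rep_hom f -> injective f ->
  exists (m0 : V' -> ext_irrep VF L) v0, rep_morph m0 /\ m0 v0 <> 0.
Proof.
move=> /rep_homP[fl fe] fI.
have [v nv] := small_simple.1.
pose z : tensor (res iota Fs^o) VF := f (incl v).
have nz0 : z <> 0.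
  move=> e; apply: nv; apply: incl_inj; apply: fI; rewrite incl0.
  by rewrite (linear0f fl).
have [l nl] : exists l : {linear VF -> F^o}, slice_r l z <> 0.
  apply: contrapT => h; apply: nz0; apply: slice_r_inj => l.
  rewrite (linear0f (slice_r_linear l)).
  by apply: contrapT => nl; apply: h; exists l.
have [mu mu1] := @functional_exists L (res k Fs^o) _ nl.
have muF : linear (mu : res iota Fs^o -> res (in_alg L) L^o).
  move=> a x y; rewrite [a *: x](_ : _ = k (in_alg L a) * (x : Fs)); last first.
    by rewrite kE.
  rewrite -[k _ * _]/((in_alg L a) *: (x : res k Fs^o)).
  exact: (linearP mu).
pose mus := tmap (mu : res iota Fs^o -> res (in_alg L) L^o) (idfun : VF -> VF).
have musD : {morph mus : x y / x + y} := linearDf (tmap_linear muF (@idfun_linear F VF)).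
have musE x u : mus (tens (x : res iota Fs^o) u) = tens (mu x : res (in_alg L) L^o) u.
  by rewrite /mus tmap_tens.
have musZ (a : L) (x : ltensor iota Fs^o VF) :
    mus (k a *: x) = a *: (mus x : ltensor (in_alg L) L^o VF).
  move: x; apply: tensor_ext_add => [x y|x y|x u].
  - by rewrite scalerDr musD.
  - by rewrite musD scalerDr.
  - rewrite [X in mus X]lscale_tens !musE [RHS]lscale_tens.
    congr tens; exact: (linearZZ mu a x).
have mus_eq : equivariant false (mus : extend iota VF -> ext_irrep VF L).
  split=> [j|b]; apply: bincl_ext => [x y|x y|x u].
  - by rewrite linearD musD.
  - by rewrite musD linearD.
  - by rewrite hpart_bincl !musE [RHS]hpart_bincl.
  - by rewrite (linearDf (@act_linear _ _ _ _ _ b)) musD.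
  - by rewrite musD (linearDf (@act_linear _ _ _ _ _ b)).
  - by rewrite act_bincl !musE [RHS]act_bincl.
exists (fun v => mus (f (incl v))), v; split.
  split; last exact: equivariant_comp mus_eq (equivariant_comp fe incl_equivariant).
  by move=> a x y; rewrite inclD inclZ fl musD musZ.
move=> e; have : slice_r (U := res (in_alg L) L^o) l (mus z) = 1.
  by rewrite /mus (slice_r_tmap z muF (@idfun_linear F VF) (l' := l)).
rewrite /z e (linear0f (slice_r_linear l)) => /eqP; rewrite eq_sym.
by rewrite (oner_eq0 L).
Qed.

End DescentData.

(** * Borel-Tits classes *)

(** Composing with the inverse of [phi (ra_mul s t)] makes [phi s (phi t v)] linear and equivariant,
    hence a scalar. *)
Lemma semilinear_cocycle (F K : fieldType) (iota : {rmorphism F -> K})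
    (G : hopf_superalgebra F) (V : rep G iota) (phi : relaut iota -> V -> V) :
  (forall f : V -> V, linear f -> equivariant false f ->
    exists a, forall v, f v = a *: v) ->
  (forall s a x y, phi s (a *: x + y) = s a *: phi s x + phi s y) ->
  (forall s, equivariant false (phi s)) -> (forall s, bijective (phi s)) ->
  exists c : relaut iota -> relaut iota -> K,
    forall s t v, phi s (phi t v) = c s t *: phi (ra_mul s t) v.
Proof.
move=> EndV phiL phiE phiB.
suff h st : exists a, forall v, phi st.1 (phi st.2 v) = a *: phi (ra_mul st.1 st.2) v.
  by have [c cE] := choice h; exists (fun s t => c (s, t)) => s t v; rewrite -cE.
case: st => s t /=; have [psi phiK psiK] := phiB (ra_mul s t).
have [u uK Ku] := ra_bij (ra_mul s t).
have [||a aE] := EndV (fun v => phi s (phi t (psi v))).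
- move=> a x y; have -> : a *: x + y = phi (ra_mul s t) (u a *: psi x + psi y).
    by rewrite phiL Ku !psiK.
  by rewrite phiK !phiL; congr (_ *: _ + _); apply: Ku.
- have e1 := equivariant_comp (phiE t) (equivariant_cancel (phiE _) phiK psiK).
  exact: equivariant_comp (phiE s) e1.
by exists a => v; rewrite -aE phiK.
Qed.

Lemma cohomologous_refl (F Fs : fieldType) (iota : {rmorphism F -> Fs})
    (c : relaut iota -> relaut iota -> Fs) : cohomologous c c.
Proof.
exists (fun=> 1); split=> [s|s|s t]; first by exists [::].
- exact: oner_neq0.
- by rewrite rmorph1 mulr1 divr1 mulr1.
Qed.

(** * Odd isomorphisms compatible with the descent isomorphisms *)

Section Compatible.
Variables (F Fs : fieldType) (iota : {rmorphism F -> Fs}) (G : hopf_superalgebra F).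
Variables (V : irrep G iota) (Phi : forall s : relaut iota, twist s V -> V).
Hypothesis Phi_iso : forall s, rep_iso (@Phi s).

Lemma untwistD s : {morph untwist (@Phi s) : x y / x + y}.
Proof.
by move=> x y; rewrite -[x]scale1r (untwist_semilinear (Phi_iso s)) rmorph1 !scale1r.
Qed.

Lemma untwistZ s a v : untwist (@Phi s) (a *: v) = s a *: untwist (@Phi s) v.
Proof.
rewrite -[a *: v]addr0 (untwist_semilinear (Phi_iso s)).
by rewrite (additive0 (@untwistD s)) addr0.
Qed.

(** The vectors 1 (x) v span the twist, so compatibility may be read on them, where it says that S
    commutes with semilinear maps. *)
Lemma BT_compatibleP (S : V -> V) : BT_compatible Phi (S : V -> Pi_rep V) <->
  [/\ linear S, equivariant true S, bijective S &
    forall s v, S (untwist (@Phi s) v) = untwist (@Phi s) (S v)].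
Proof.
split=> [[[/rep_hom_PiP[Sl Se] Sb] SP]|[Sl Se Sb SP]].
  split=> // s v; rewrite /untwist SP /Pi_map.
  by rewrite bchange_map_bunit.
split; first by split=> //; apply/rep_hom_PiP.
move=> s z; rewrite /Pi_map.
have [[Pl _ _] _] := Phi_iso s; move: z; apply: bchange_ext => [a x y|a x y|v].
- by rewrite Pl Sl.
- by rewrite (bchange_map_linear (phiE := ra_fix s) (V := V) (W := Pi_rep V) Sl) Pl.
- by rewrite -[LHS]/(S (untwist _ _)) SP bchange_map_bunit.
Qed.

Lemma BT_compatible_scale (S : V -> V) (a : F) : a != 0 ->
  BT_compatible Phi (S : V -> Pi_rep V) ->
  BT_compatible Phi ((fun v => iota a *: S v) : V -> Pi_rep V).
Proof.
move=> a0 /BT_compatibleP[Sl [Sh Sa] [T SK TK] SP]; apply/BT_compatibleP.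
have i0 : iota a != 0 by rewrite fmorph_eq0.
split=> [b x y|||s v].
- by rewrite Sl scalerDr !scalerA mulrC.
- split=> [j v|l v]; first by rewrite Sh linearZ.
  by rewrite Sa (linearZf _ _ (@act_linear _ _ _ _ _ l)).
- exists (fun v => T ((iota a)^-1 *: v)) => v; first by rewrite scalerK.
  by rewrite TK scalerKV.
- by rewrite SP untwistZ ra_fix.
Qed.

(** By quasi-rationality S' is x S for a scalar x. Both commute with the semilinear maps, so every s
    fixes x, and [relaut_fixed_field] applies. *)
Lemma BT_compatible_unique (S S' : V -> V) : separable_closure iota ->
  quasi_rational V -> BT_compatible Phi (S : V -> Pi_rep V) ->
  BT_compatible Phi (S' : V -> Pi_rep V) ->
  exists2 a : F, a != 0 & forall v, S' v = iota a *: S v.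
Proof.
move=> cl [EndV _] /BT_compatibleP[Sl Se [T SK TK] SP].
move=> /BT_compatibleP[Sl' Se' Sb' SP'].
have [Tl Te] := equivariant_inv Sl Se SK TK.
have [|x xE] := EndV (T \o S').
  apply/rep_homP; split; first by move=> a y z /=; rewrite Sl' Tl.
  exact: equivariant_comp Te Se'.
have S'E v : S' v = x *: S v by rewrite -(linearZf _ _ Sl) -xE /= TK.
have [v v0] := irr_neq0 V.
have Sv s : S (untwist (@Phi s) v) <> 0.
  move=> e; apply: v0; apply: (bij_inj (untwist_bij (Phi_iso s))).
  apply: (can_inj SK); rewrite e (additive0 (@untwistD s)).
  by rewrite (linear0f Sl).
have [|a xa] := relaut_fixed_field (x := x) cl.
  move=> s; apply: (scalar_cancel (Sv s)).
  by rewrite -S'E SP' S'E untwistZ SP.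
exists a => [|w]; last by rewrite S'E xa.
apply/eqP => a0; apply: v0; apply: (bij_inj Sb').
by rewrite S'E xa a0 rmorph0 scale0r (linear0f Sl').
Qed.

End Compatible.

Theorem theorem4p10 (F : fieldType) (char_neq2 : 2%N \notin [pchar F])
    (Fs : fieldType) (iota : {rmorphism F -> Fs})
    (Fs_sep : separable_closure iota)
    (G : hopf_superalgebra F) (V : irrep G iota) (V_qr : quasi_rational V)
    (Phi : forall s : relaut iota, twist s V -> V) (Phi_BT : BT_choice Phi)
    (c : relaut iota -> relaut iota -> Fs) (c_BT : BT_cocycle Phi c)
    (VF : base_irrep G) (VF_V : lies_over VF V) :
  [/\ brauer_class (End_rep VF) (fun s t => (c s t)^-1),
      ~ rep_isomorphic V (Pi_rep V) ->
        bw_triple (uEnd VF) true 1 (fun s t => (c s t)^-1)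
    & rep_isomorphic V (Pi_rep V) ->
      (exists2 S : V -> Pi_rep V, BT_compatible Phi S &
         forall S' : V -> Pi_rep V, BT_compatible Phi S' <->
           exists2 a : F, a != 0 & forall v, S' v = iota a *: S v) /\
      (forall S : V -> Pi_rep V, BT_compatible Phi S ->
         exists a : F,
           [/\ a != 0,
               forall v : V, Pi_map S (S v) = iota a *: v
             & exists (eps : bool) (D : relaut iota -> relaut iota -> Fs),
                 bw_triple (uEnd VF) eps a D])].
Proof.
case: Phi_BT => Phi_iso [L [k [kE [V' [theta [phi [gL theta_iso phi_iso link]]]]]]].
have [EndV _] := V_qr.
have [f fh fI] := VF_V.
have [psi [psiL psiE psiB psiP]] : exists psi : relaut (in_alg L) -> V' -> V',
    [/\ forall t a x y, psi t (a *: x + y) = t a *: psi t x + psi t y,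
        forall t, equivariant false (psi t), forall t, bijective (psi t)
      & forall t v, psi t v = phi t (bunit (ra_fix t) v)].
  exists (fun t => untwist (phi t)); split=> // t.
  - exact: untwist_semilinear.
  - exact: untwist_equivariant.
  - exact: untwist_bij.
have sV := small_simple theta_iso.
have EndV' := small_End theta_iso EndV.
have [c' c'E] := semilinear_cocycle EndV' psiL psiE psiB.
have [m0 [v0 [m0M m0_nz]]] := small_embedding theta_iso fh fI.
have theta_lin : linear theta by case: theta_iso => [[]].
(* On V' the semilinear map of [Phi s] is [psi t], for t the restriction of s to L. *)
have Psi_incl s : exists2 t, restricts k s t &
    forall v, untwist (Phi s) (incl theta v) = incl theta (psi t v).
  have [t rt tE] := link s; exists t => // v.
  by rewrite /incl psiP -tE bchange_map_bunit.
(* The given cocycle is the inflation of that of [psi], as comparison on one nonzero vector of V'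
   shows; hence no coboundary correction is needed later. *)
have cc' s t : exists s' t',
    [/\ restricts k s s', restricts k t t' & (c s t)^-1 = k (c' s' t')^-1].
  have [s' rs sE] := Psi_incl s; have [t' rt tE] := Psi_incl t.
  exists s', t'; split=> //; rewrite fmorphV; congr _^-1.
  have [u ru uE] := Psi_incl (ra_mul s t).
  have us : u = ra_mul s' t'.
    by apply: relaut_ext => x; apply: (fmorph_inj k); rewrite -ru /= rt rs.
  have [v nv] := sV.1.
  have nz : incl theta (psi u v) <> 0.
    rewrite -(incl0 theta_iso) => /(incl_inj theta_iso) e.
    by apply: nv; apply: (bij_inj (psiB u)); rewrite e (semilinear0 psiL).
  apply: (scalar_cancel nz).
  have := c_BT s t (incl theta v).
  have Pl : linear (Phi t) by case: (Phi_iso t) => [[]].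
  rewrite bchange_map_bunit // -![Phi _ (bunit _ _)]/(untwist _ _).
  rewrite tE sE c'E uE us (inclZ theta_iso) -us => <- //.
have brauer (A : algType F) (op : A -> VF -> VF) : end_action op ->
    brauer_class A (fun s t => (c s t)^-1).
  move=> opA.
  have [n [ff [g [f1 f2 f3 f4]]]] :=
    end_brauer gL sV EndV' psiL psiE psiB c'E m0M m0_nz opA.
  exists L, k, n, ff, g, (fun s t => (c' s t)^-1), (fun s t => (c s t)^-1).
  split=> //; split=> //; exact: cohomologous_refl.
split.
- exact: brauer (end_action_even VF).
- move=> nVPi.
  (* A nonzero odd endomorphism of V_F has a nonzero block on V', whose extension to V is invertible
     by Schur's lemma and identifies V with its parity change. *)
  have odd0 (x : uend VF) v : x.2 v = 0.
    apply: contrapT => nz.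
    have [S1 [v1 [S1l S1e S1n]]] := end_odd_block gL sV psiL psiE psiB m0M m0_nz
      (uend_op_linear2 x) (uend_op_equivariant2 x) nz.
    have [S [Sl Se SE]] := extend_selfmap theta_iso S1l S1e.
    have nS : S (incl theta v1) <> 0.
      by rewrite SE -(incl0 theta_iso) => /(incl_inj theta_iso).
    have [T [_ _ SK TK]] := simple_inverse (irrep_simple V) (irrep_simple V) Sl Se nS.
    by apply: nVPi; exists S; split; [apply/rep_hom_PiP | exists T].
  have pe : purely_even (uEnd VF) by move=> x; apply/uend_evenP.
  have [fd cs] := uend_purely_even_simple gL sV EndV' psiL psiE psiB c'E m0M m0_nz pe.
  split=> //.
  + exact: (uend_css gL sV EndV' psiL psiE psiB m0M m0_nz fd).
  + split; first exact: oner_neq0.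
    exists 1; first by apply: Or31.
    by exists 1; [exact: oner_neq0 | rewrite expr1n mulr1].
  + exact: brauer (end_action_uend pe).
- move=> [S0 [/rep_hom_PiP[S0l S0e] S0b]].
  have [w nw] := irr_neq0 V.
  have S0w : S0 w <> 0.
    by rewrite -(linear0f S0l) => /(bij_inj S0b).
  have [S1 [v1 [S1l S1e S1n]]] := small_odd_selfmap theta_iso S0l S0e S0w.
  have [S' [a [u [SL' SE' Sphi SS' [a0 ul ue uu uh]]]]] :=
    end_odd_central gL sV EndV' psiL psiE psiB c'E m0M m0_nz S1l S1e S1n.
  (* The compatible map found over L is extended to V; its properties are checked on V', which spans
     V over Fs. *)
  have [S [Sl Se SE]] := extend_selfmap theta_iso SL' SE'.
  have SS v : S (S v) = iota a *: v.
    apply: (incl_span theta_iso (X := fun v => S (S v) = iota a *: v)) => [|x].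
      split=> [|b x y ex ey]; first by rewrite !(linear0f Sl) scaler0.
      by rewrite !Sl ex ey scalerDr !scalerA mulrC.
    by rewrite !SE SS' (inclZ theta_iso) kE.
  have ia0 : iota a != 0 by rewrite fmorph_eq0.
  have Sb : bijective S.
    exists (fun v => (iota a)^-1 *: S v) => v; first by rewrite SS scalerK.
    by rewrite (linearZf _ _ Sl) SS scalerK.
  have SBT : BT_compatible Phi (S : V -> Pi_rep V).
    apply/(BT_compatibleP Phi_iso); split=> // s v.
    apply: (incl_span theta_iso
      (X := fun v => S (untwist (Phi s) v) = untwist (Phi s) (S v))) => [|x].
      split=> [|b x y ex ey].
        by rewrite (linear0f Sl) (additive0 (@untwistD _ _ _ _ _ _ Phi_iso s)) (linear0f Sl).
      by rewrite Sl !(untwist_semilinear (Phi_iso s)) Sl ex ey.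
    have [t _ tE] := Psi_incl s.
    by rewrite SE !tE SE Sphi.
  have [fd ncs disc] := uend_odd_type gL sV EndV' psiL psiE psiB c'E m0M m0_nz a0 ul ue uu uh.
  split.
    exists S => // T; split=> [TBT|[b b0 TE]].
      exact: (BT_compatible_unique Phi_iso Fs_sep V_qr SBT TBT).
    rewrite (funext TE); exact: BT_compatible_scale.
  move=> T TBT.
  have [b b0 TE] := BT_compatible_unique Phi_iso Fs_sep V_qr SBT TBT.
  (* T is b S, so its square is b^2 a, in the square class of a. *)
  exists (b ^+ 2 * a); split.
  + by rewrite mulf_neq0 // expf_neq0.
  + move=> v; rewrite /Pi_map !TE (linearZf _ _ Sl) SS !scalerA.
    by rewrite rmorphM rmorphXn expr2.
  (* The sign is minus, so the third invariant is the class of the even part. *)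
  + exists false, (fun s t => (c s t)^-1); split=> //.
    * exact: (uend_css gL sV EndV' psiL psiE psiB m0M m0_nz fd).
    * split; first by rewrite mulf_neq0 // expf_neq0.
      by exists a => //; exists b.
    * exact: brauer (end_action_even VF).
Qed.
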